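(* Let $D\ge4$ and consider the system, for unknowns $P_I(t,\theta)$, $Q_I(t,\theta)$, $I=3,\dots,D-1$, $$\mathcal D^2P_I-t^2\partial_\theta^2P_I=-\tfrac12e^{-2(P+P_I)}\big[(\mathcal DQ_I)^2-(t\partial_\theta Q_I)^2\big],\qquad \mathcal D^2Q_I-t^2\partial_\theta^2Q_I=2\big[\mathcal D(P+P_I)\mathcal DQ_I-t^2\partial_\theta(P+P_I)\partial_\theta Q_I\big],$$ where $\mathcal D=t\partial_t$ and $P=\sum_JP_J$. Let $p_{I0},p_{I1},q_{I0},q_{I1}$ be smooth functions of $\theta$, set $k_I=\sum_Jp_{J0}+p_{I0}$, suppose $1/2<k_I<5/6$ for all $\theta$ and all $I$, and define $$\alpha_I(\theta)=\frac12\Big(\frac{\partial_\theta q_{I0}}{2-2k_I}\Big)^2\exp\Big[-2\Big(p_{I1}+\sum_{J=3}^{D-1}p_{J1}\Big)\Big].$$ Let $\epsilon_J$ satisfy $2(k_I+k_J)-3<\epsilon_J<\min\{2k_I-1,2-2k_I\}$ for all $I,J$. Then for each $\theta_0$ there exists a solution of the system in a neighbourhood of $\theta=\theta_0$ (for small $t>0$) of the form $$P_I=p_{I0}\ln t+p_{I1}+\alpha_I(\theta)t^{2-2k_I}+t^{2-2k_I+\epsilon_I}\pi_I(t,\theta),\qquad Q_I=q_{I0}+t^{2k_I}q_{I1}+t^{2k_I}\kappa_I(t,\theta),$$ where $\pi_I$ and $\kappa_I$ are regular and tend to $0$ as $t\to0$. Given the form of the expansion and the choice of the $\epsilon_I$,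 the solution is unique.
   Context: A function $u(t,\theta)$ defined on an open subset $\Omega\subset[0,\infty)\times\mathbb R$ is called regular if it is $C^\infty$ for $t>0$ and all its partial derivatives of any order with respect to $\theta$ extend continuously to $t=0$ (within $\bar\Omega$). The system is the reduced vacuum Einstein equations for $T^{D-2}$-symmetric spacetimes on $T^{D-1}\times\mathbb R$ in areal time with diagonal orbit metric $e^{2P_I}\delta_{IJ}$ and twist potentials $Q_I$. *)

(* Defs.v *)
From Stdlib Require Import Reals List.
From Coquelicot Require Import Coquelicot.
Open Scope R_scope.

(* Index I ranges over 3..D-1, encoded as 0..N-1 with N = D-3. *)
Definition sumI (N : nat) (f : nat -> R) : R :=
  fold_right (fun i acc => f i + acc) 0 (List.seq 0 N).

Definition dt (f : R -> R -> R) : R -> R -> R :=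
  fun t th => Derive (fun s => f s th) t.
Definition dth (f : R -> R -> R) : R -> R -> R :=
  fun t th => Derive (fun s => f t s) th.

Definition Dop (f : R -> R -> R) : R -> R -> R :=
  fun t th => t * dt f t th.

Fixpoint iterD (w : list bool) (f : R -> R -> R) : R -> R -> R :=
  match w with
  | nil => f
  | b :: w' => (if b then dt else dth) (iterD w' f)
  end.

Fixpoint dthn (n : nat) (f : R -> R -> R) : R -> R -> R :=
  match n with
  | O => f
  | S m => dth (dthn m f)
  end.

Definition smooth_rect (T a b : R) (f : R -> R -> R) : Prop :=
  forall (w : list bool) (t th : R), 0 < t < T -> a < th < b ->
    ex_derive (fun s => iterD w f s th) t /\
    ex_derive (fun s => iterD w f t s) th /\
    continuous (fun z : R * R => iterD w f (fst z) (snd z)) (t, th).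

Definition regular (T a b : R) (f : R -> R -> R) : Prop :=
  smooth_rect T a b f /\
  forall n : nat, exists g : R -> R -> R,
    (forall t th, 0 < t < T -> a < th < b -> g t th = dthn n f t th) /\
    (forall t th, 0 <= t < T -> a < th < b ->
       filterlim (fun z : R * R => g (fst z) (snd z))
         (within (fun z : R * R => 0 <= fst z < T /\ a < snd z < b)
                 (locally (t, th)))
         (locally (g t th))).

Definition smooth1 (f : R -> R) : Prop :=
  forall (n : nat) (x : R), ex_derive_n f n x.

Section Data.
Variables (N : nat) (p0 p1 q0 q1 : nat -> R -> R).

Definition kI (I : nat) (th : R) : R := sumI N (fun J => p0 J th) + p0 I th.

Definition alphaI (I : nat) (th : R) : R :=
  / 2 * (Derive (q0 I) th / (2 - 2 * kI I th)) ^ 2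
      * exp (- 2 * (p1 I th + sumI N (fun J => p1 J th))).

Definition Pform (eps : nat -> R) (pi : nat -> R -> R -> R) (I : nat)
  : R -> R -> R :=
  fun t th => p0 I th * ln t + p1 I th + alphaI I th * Rpower t (2 - 2 * kI I th)
              + Rpower t (2 - 2 * kI I th + eps I) * pi I t th.

Definition Qform (kappa : nat -> R -> R -> R) (I : nat) : R -> R -> R :=
  fun t th => q0 I th + Rpower t (2 * kI I th) * q1 I th
              + Rpower t (2 * kI I th) * kappa I t th.

Definition solves_system (T a b : R) (P Q : nat -> R -> R -> R) : Prop :=
  forall I t th, (I < N)%nat -> 0 < t < T -> a < th < b ->
    let PP := fun t' th' => sumI N (fun J => P J t' th') + P I t' th' in
    Dop (Dop (P I)) t th - t ^ 2 * dth (dth (P I)) t th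
      = - / 2 * exp (- 2 * PP t th)
          * ((Dop (Q I) t th) ^ 2 - (t * dth (Q I) t th) ^ 2) /\
    Dop (Dop (Q I)) t th - t ^ 2 * dth (dth (Q I)) t th
      = 2 * (Dop PP t th * Dop (Q I) t th - t ^ 2 * dth PP t th * dth (Q I) t th).

Definition expansion_solution (eps : nat -> R) (T a b : R)
  (pi kappa : nat -> R -> R -> R) : Prop :=
  0 < T /\ a < b /\
  (forall I, (I < N)%nat ->
     regular T a b (pi I) /\ regular T a b (kappa I) /\
     (forall th, a < th < b ->
        filterlim (fun t => pi I t th) (at_right 0) (locally 0) /\
        filterlim (fun t => kappa I t th) (at_right 0) (locally 0))) /\
  solves_system T a b (Pform eps pi) (Qform kappa).

End Data.

(* Main.v *)
(* In V = DP, X = t P', Z = e^{-(P+P_I)} DQ, Y = t e^{-(P+P_I)} Q' the system is a quadratic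
   semilinear symmetric hyperbolic one. Subtracting p_0 from V and scaling X, Z, Y by t,
   t^k, t^(1-k) makes it Fuchsian: the t-derivative D of every unknown gains a power of t but
   costs a theta-derivative. Finitely many iterates of the corresponding integral equation
   therefore approximate a solution up to O(t^4). The remainder solves the hyperbolic system
   with zero data at t = 0; in Riemann invariants it is a fixed point of integration along
   the characteristics theta -+ t = const, and on functions of size t^4 the factor 1/4 gained
   by integrating against dt/t beats the linear part, so the Picard map contracts, on one
   triangle {|theta - c| + t < r} and in C^n norms for every n.

   Conversely the twist momentum w = e^{-2(P+P_I)} DQ satisfies Dw = t^2 (e^{-2(P+P_I)} Q')',
   so regularity in theta alone controls the t-derivatives of any solution of the given form,
   which hence solves the same integral equation with the same data. Bootstrapping through
   that equation makes the difference of two such solutions O(t^4), and the contraction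
   makes it vanish. *)

Require Import Defs.
From Stdlib Require Import Reals List Lra Lia Psatz FunctionalExtensionality.
From Coquelicot Require Import Coquelicot.
Open Scope R_scope.

(** For data that are only smooth, iterates of the integral equation need not converge: each pass
    consumes a theta-derivative, with no bound uniform in the number of passes. Hence the split into
    finitely many passes, which only have to reach a fixed power of t, and a fixed point for the
    hyperbolic system, where integration along characteristics loses no derivative. The power 4 is
    dictated by the linear part: in Riemann invariants its constants, together with the small
    quadratic terms, add up to 3, and integrating t^4 against dt/t has to beat this. One pass gains
    t^(1/8), so 32 passes suffice. This gain rests on k_I < 5/6, which gives 2 - 2 k_I > 1/3 and
    leaves room for the logarithms that appear when t^(k_I) is differentiated in theta. The eps_I
    enter in the passage between the reduced unknowns and the expansion: their upper bounds make the
    computed remainder of P_I small against the stated power of t, and the lower bound makes 2 - 2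
    k_I + eps_I positive. *)

(* [good_cone]: closed under following any curve of slope at most 1 down to t = 0. *)
Class good (Om : R -> R -> Prop) : Prop := {
  good_open : forall t th, Om t th -> locally_2d Om t th;
  good_pos : forall t th, Om t th -> 0 < t < 1;
  good_cone : forall t th s th', Om t th -> 0 < s <= t ->
    Rabs (th' - th) <= t - s -> Om s th';
  good_bdd : exists R, forall t th, Om t th -> Rabs th <= R }.

Definition eq_on (Om : R -> R -> Prop) (f g : R -> R -> R) : Prop :=
  forall t th, Om t th -> f t th = g t th.

Lemma Rpower_pos x y : 0 < Rpower x y.
Proof. apply exp_pos. Qed.

Lemma Rpower_le_exp (t a b : R) : 0 < t < 1 -> a <= b -> Rpower t b <= Rpower t a.
Proof.
  intros Ht Hab. unfold Rpower.
  assert (ln t < 0) by (rewrite <- ln_1; apply ln_increasing; lra).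
  destruct (Req_dec a b) as [->|]; [lra|].
  left. apply exp_increasing. nra.
Qed.

Lemma Rpower_le_base (t r a : R) : 0 < t <= r -> 0 <= a -> Rpower t a <= Rpower r a.
Proof. intros; apply Rle_Rpower_l; lra. Qed.

(** * Functions smooth in theta and weighted norms *)

Section Calculus.
Context {Om : R -> R -> Prop} {HOm : good Om}.

Lemma on_sym f g : eq_on Om f g -> eq_on Om g f.
Proof. intros H t th Ht; symmetry; auto. Qed.

Lemma loc_th t th : Om t th -> locally th (fun s => Om t s).
Proof. intros H; exact (locally_2d_1d_const_x _ _ _ (good_open _ _ H)). Qed.

Lemma loc_t t th : Om t th -> locally t (fun s => Om s th).
Proof. intros H; exact (locally_2d_1d_const_y _ _ _ (good_open _ _ H)). Qed.

Lemma on_loc_th f g t th : eq_on Om f g -> Om t th -> locally th (fun s => f t s = g t s).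
Proof.
  intros H Ht. generalize (loc_th _ _ Ht). apply filter_imp. intros; auto.
Qed.

Lemma on_loc_t f g t th : eq_on Om f g -> Om t th -> locally t (fun s => f s th = g s th).
Proof.
  intros H Ht. generalize (loc_t _ _ Ht). apply filter_imp. intros; auto.
Qed.

Lemma dth_ext f g : eq_on Om f g -> eq_on Om (dth f) (dth g).
Proof. intros H t th Ht. apply Derive_ext_loc, on_loc_th; auto. Qed.

Lemma c2_ext f g t th : eq_on Om f g -> Om t th ->
  continuity_2d_pt f t th -> continuity_2d_pt g t th.
Proof.
  intros H Ht. apply continuity_2d_pt_ext_loc.
  generalize (good_open _ _ Ht). apply locally_2d_impl, locally_2d_forall. auto.
Qed.

Lemma exth_ext f g t th : eq_on Om f g -> Om t th ->
  ex_derive (fun s => f t s) th -> ex_derive (fun s => g t s) th.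
Proof. intros H Ht. apply ex_derive_ext_loc, on_loc_th; auto. Qed.

(* Smooth in theta, and continuous in (t, theta) with all theta-derivatives; no
   differentiability in t. *)
Fixpoint smn (n : nat) (f : R -> R -> R) : Prop :=
  match n with
  | O => forall t th, Om t th -> continuity_2d_pt f t th
  | S m => (forall t th, Om t th ->
             continuity_2d_pt f t th /\ ex_derive (fun s => f t s) th)
           /\ smn m (dth f)
  end.

Definition sm f := forall n, smn n f.

Lemma smn_ext n : forall f g, eq_on Om f g -> smn n f -> smn n g.
Proof.
  induction n as [|n IH]; simpl; intros f g H Hf.
  - intros; eapply c2_ext; eauto.
  - destruct Hf as [Hf Hd]; split.
    + intros t th Ht; destruct (Hf t th Ht); split; [eapply c2_ext|eapply exth_ext]; eauto.
    + eapply IH; [apply dth_ext; eauto|auto].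
Qed.

Lemma smn_pred n : forall f, smn (S n) f -> smn n f.
Proof.
  induction n as [|n IH]; intros f [H1 H2].
  - intros t th Ht; apply (H1 t th Ht).
  - split; [auto|apply IH; auto].
Qed.

Lemma sm_ext f g : eq_on Om f g -> sm f -> sm g.
Proof. intros H Hf n; eapply smn_ext; eauto. Qed.

Lemma sm_c f : sm f -> forall t th, Om t th -> continuity_2d_pt f t th.
Proof. intros H; exact (H 0%nat). Qed.

Lemma sm_ex f : sm f -> forall t th, Om t th -> ex_derive (fun s => f t s) th.
Proof. intros H t th Ht; apply (proj1 (H 1%nat)); auto. Qed.

Lemma sm_is f : sm f -> forall t th, Om t th -> is_derive (fun s => f t s) th (dth f t th).
Proof. intros H t th Ht. apply Derive_correct, sm_ex; auto. Qed.

Lemma sm_dth f : sm f -> sm (dth f).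
Proof. intros H n; apply (H (S n)). Qed.

Lemma sm_intro f : (forall t th, Om t th ->
    continuity_2d_pt f t th /\ ex_derive (fun s => f t s) th) -> sm (dth f) -> sm f.
Proof. intros H1 H2 [|n]; [intros t th Ht; apply H1; auto|split; auto]. Qed.

Lemma dth_plus f g : sm f -> sm g ->
  eq_on Om (dth (fun t th => f t th + g t th)) (fun t th => dth f t th + dth g t th).
Proof. intros Hf Hg t th Ht. apply Derive_plus; apply sm_ex; auto. Qed.

Lemma dth_mult f g : sm f -> sm g ->
  eq_on Om (dth (fun t th => f t th * g t th))
    (fun t th => dth f t th * g t th + f t th * dth g t th).
Proof. intros Hf Hg t th Ht. apply Derive_mult; apply sm_ex; auto. Qed.

Lemma dth_exp f : sm f ->
  eq_on Om (dth (fun t th => exp (f t th))) (fun t th => dth f t th * exp (f t th)).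
Proof.
  intros Hf t th Ht. apply is_derive_unique. generalize (sm_is _ Hf t th Ht); intros H.
  apply (is_derive_comp exp (fun s => f t s)); [apply is_derive_exp|auto].
Qed.

Lemma sm_const c : sm (fun _ _ => c).
Proof.
  intros n; revert c; induction n as [|n IH]; intros c; simpl.
  - intros; apply continuity_2d_pt_const.
  - split.
    + intros; split; [apply continuity_2d_pt_const|apply ex_derive_const].
    + eapply smn_ext; [|apply (IH 0)]. intros t th _; unfold dth; rewrite Derive_const; reflexivity.
Qed.

Lemma sm_t (g : R -> R) : (forall t th, Om t th -> continuity_pt g t) -> sm (fun t _ => g t).
Proof.
  intros H. apply sm_intro.
  - intros t th Ht; split; [|apply ex_derive_const].
    apply (continuity_1d_2d_pt_comp g (fun u v => u)); [eauto|apply continuity_2d_pt_id1].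
  - eapply sm_ext; [|apply (sm_const 0)]. intros t th _; unfold dth; rewrite Derive_const; reflexivity.
Qed.

Lemma sm_plus f g : sm f -> sm g -> sm (fun t th => f t th + g t th).
Proof.
  intros Hf Hg n; revert f g Hf Hg; induction n as [|n IH]; intros f g Hf Hg; simpl.
  - intros; apply continuity_2d_pt_plus; apply sm_c; auto.
  - split.
    + intros t th Ht; split; [apply continuity_2d_pt_plus; apply sm_c; auto|].
      apply @ex_derive_plus; apply sm_ex; auto.
    + eapply smn_ext; [apply on_sym, dth_plus; auto|].
      apply IH; apply sm_dth; auto.
Qed.

Lemma smn_plus n : forall f g, smn n f -> smn n g -> smn n (fun t th => f t th + g t th).
Proof.
  induction n as [|n IH]; intros f g Hf Hg; simpl.
  - intros; apply continuity_2d_pt_plus; auto.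
  - destruct Hf as [Hf Hf'], Hg as [Hg Hg']. split.
    + intros t th Ht. destruct (Hf t th Ht), (Hg t th Ht).
      split; [apply continuity_2d_pt_plus; auto|apply @ex_derive_plus; auto].
    + eapply smn_ext; [|apply (IH _ _ Hf' Hg')].
      intros t th Ht. symmetry. apply Derive_plus; [apply Hf|apply Hg]; auto.
Qed.

Lemma smn_mult n : forall f g, smn n f -> smn n g -> smn n (fun t th => f t th * g t th).
Proof.
  induction n as [|n IH]; intros f g Hf Hg.
  - simpl; intros; apply continuity_2d_pt_mult; auto.
  - pose proof (smn_pred _ _ Hf) as Hf0. pose proof (smn_pred _ _ Hg) as Hg0.
    destruct Hf as [Hf Hf'], Hg as [Hg Hg']. split.
    + intros t th Ht. destruct (Hf t th Ht), (Hg t th Ht).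
      split; [apply continuity_2d_pt_mult; auto|apply ex_derive_mult; auto].
    + eapply smn_ext; [|apply (smn_plus _ _ _ (IH _ _ Hf' Hg0) (IH _ _ Hf0 Hg'))].
      intros t th Ht. symmetry. apply Derive_mult; [apply Hf|apply Hg]; auto.
Qed.

Lemma sm_mult f g : sm f -> sm g -> sm (fun t th => f t th * g t th).
Proof. intros Hf Hg n. apply smn_mult; auto. Qed.

Lemma sm_scal c f : sm f -> sm (fun t th => c * f t th).
Proof. intros; apply (sm_mult (fun _ _ => c)); auto using sm_const. Qed.

Lemma sm_opp f : sm f -> sm (fun t th => - f t th).
Proof.
  intros. eapply sm_ext; [|apply (sm_scal (-1) f); auto]. intros t th _; simpl; ring.
Qed.

Lemma sm_minus f g : sm f -> sm g -> sm (fun t th => f t th - g t th).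
Proof. intros; apply (sm_plus f (fun t th => - g t th)); auto using sm_opp. Qed.

Lemma dth_minus f g : sm f -> sm g ->
  eq_on Om (dth (fun t th => f t th - g t th)) (fun t th => dth f t th - dth g t th).
Proof. intros Hf Hg t th Ht. apply Derive_minus; apply sm_ex; auto. Qed.

Lemma dth_scal c f : eq_on Om (dth (fun t th => c * f t th)) (fun t th => c * dth f t th).
Proof. intros t th _. apply Derive_scal. Qed.

Lemma continuity_2d_exp f t th : continuity_2d_pt f t th ->
  continuity_2d_pt (fun t th => exp (f t th)) t th.
Proof.
  intros; apply (continuity_1d_2d_pt_comp exp f); auto.
  apply derivable_continuous_pt, derivable_pt_exp.
Qed.

Lemma sm_exp f : sm f -> sm (fun t th => exp (f t th)).
Proof.
  intros Hf n; induction n as [|n IH].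
  - intros t th Ht; apply continuity_2d_exp, sm_c; auto.
  - split.
    + intros t th Ht; split; [apply continuity_2d_exp, sm_c; auto|].
      apply (ex_derive_comp exp (fun s => f t s)); [|apply sm_ex; auto].
      eexists; apply is_derive_exp.
    + eapply smn_ext; [apply on_sym, dth_exp; auto|].
      apply smn_mult; [apply Hf'|auto] || apply smn_mult; auto. apply (Hf (S n)).
Qed.

Lemma dth_t (g : R -> R) : dth (fun t _ => g t) = fun _ _ => 0.
Proof. apply functional_extensionality; intros t; apply functional_extensionality; intros th; unfold dth; apply Derive_const. Qed.

(* [bnd n e mu C f] says that the norm of [f] of order [n] is at most [C], where the
   norms are defined by |f|_0 = sup |f| / t^mu and |f|_(n+1) = |f|_n + e |dth f|_n;
   they are submultiplicative, and tend to |f|_0 as [e] tends to 0. *)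
Fixpoint bnd (n : nat) (e mu C : R) (f : R -> R -> R) : Prop :=
  match n with
  | O => sm f /\ 0 <= C /\ forall t th, Om t th -> Rabs (f t th) <= C * Rpower t mu
  | S m => exists C1 C2, bnd m e mu C1 f /\ bnd m e mu C2 (dth f) /\ C1 + e * C2 <= C
  end.

Lemma bnd_sm n : forall e mu C f, bnd n e mu C f -> sm f.
Proof. induction n as [|n IH]; intros e mu C f; [intros [H _]; auto|].
  intros (C1 & C2 & H & _); eauto. Qed.

Lemma bnd_pos n : forall e mu C f, 0 <= e -> bnd n e mu C f -> 0 <= C.
Proof. induction n as [|n IH]; intros e mu C f He; [intros (_ & H & _); auto|].
  intros (C1 & C2 & H1 & H2 & H). apply IH in H1; auto. apply IH in H2; auto. nra. Qed.

Lemma bnd_ext n : forall e mu C f g, eq_on Om f g -> bnd n e mu C f -> bnd n e mu C g.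
Proof.
  induction n as [|n IH]; intros e mu C f g H.
  - intros (H1 & H2 & H3). split; [eapply sm_ext; eauto|]. split; auto.
    intros t th Ht. rewrite <- H; auto.
  - intros (C1 & C2 & H1 & H2 & H3). exists C1, C2; repeat split; auto.
    + eapply IH; eauto.
    + eapply IH; [apply dth_ext; eauto|auto].
Qed.

Lemma bnd_weak n : forall e mu C D f, C <= D -> bnd n e mu C f -> bnd n e mu D f.
Proof.
  induction n as [|n IH]; intros e mu C D f H.
  - intros (H1 & H2 & H3). split; auto. split; [lra|].
    intros t th Ht. eapply Rle_trans; [apply H3; auto|].
    apply Rmult_le_compat_r; [left; apply Rpower_pos|auto].
  - intros (C1 & C2 & H1 & H2 & H3). exists C1, C2; repeat split; auto; lra.
Qed.

Lemma bnd_const0 n e mu : bnd n e mu 0 (fun _ _ => 0).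
Proof.
  revert e mu; induction n as [|n IH]; intros e mu.
  - split; [apply sm_const|split; [lra|]]. intros; rewrite Rabs_R0; lra.
  - exists 0, 0; repeat split; auto; [|lra].
    eapply bnd_ext; [|apply IH]. intros t th _; unfold dth; rewrite Derive_const; reflexivity.
Qed.

Lemma bnd_plus n : forall e mu C D f g, bnd n e mu C f -> bnd n e mu D g ->
  bnd n e mu (C + D) (fun t th => f t th + g t th).
Proof.
  induction n as [|n IH]; intros e mu C D f g Hf Hg.
  - destruct Hf as (F1 & F2 & F3), Hg as (G1 & G2 & G3).
    split; [apply sm_plus; auto|]. split; [lra|].
    intros t th Ht. eapply Rle_trans; [apply Rabs_triang|].
    specialize (F3 t th Ht); specialize (G3 t th Ht); lra.
  - assert (sm f) by (eapply bnd_sm; eauto). assert (sm g) by (eapply bnd_sm; eauto).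
    destruct Hf as (C1 & C2 & F1 & F2 & F3), Hg as (D1 & D2 & G1 & G2 & G3).
    exists (C1 + D1), (C2 + D2); repeat split; [auto| |lra].
    eapply bnd_ext; [apply on_sym, dth_plus; auto|auto].
Qed.

(** By the Leibniz rule, (C1 + e C2)(D1 + e D2) exceeds what is required by the surplus e^2 C2 D2 >=
    0, so no binomial constants appear. A Lipschitz estimate for products therefore has the same
    shape in every order. *)
Lemma bnd_mult n : forall e mu nu C D f g, 0 <= e -> bnd n e mu C f -> bnd n e nu D g ->
  bnd n e (mu + nu) (C * D) (fun t th => f t th * g t th).
Proof.
  induction n as [|n IH]; intros e mu nu C D f g He Hf Hg.
  - destruct Hf as (F1 & F2 & F3), Hg as (G1 & G2 & G3).
    split; [apply sm_mult; auto|]. split; [nra|].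
    intros t th Ht. rewrite Rabs_mult, Rpower_plus.
    replace (C * D * (Rpower t mu * Rpower t nu))
      with ((C * Rpower t mu) * (D * Rpower t nu)) by ring.
    apply Rmult_le_compat; auto using Rabs_pos.
  - assert (sm f) by (eapply bnd_sm; eauto). assert (sm g) by (eapply bnd_sm; eauto).
    destruct Hf as (C1 & C2 & F1 & F2 & F3), Hg as (D1 & D2 & G1 & G2 & G3).
    pose proof (bnd_pos _ _ _ _ _ He F1). pose proof (bnd_pos _ _ _ _ _ He F2).
    pose proof (bnd_pos _ _ _ _ _ He G1). pose proof (bnd_pos _ _ _ _ _ He G2).
    exists (C1 * D1), (C2 * D1 + C1 * D2); repeat split; [auto| |].
    + eapply bnd_ext; [apply on_sym, dth_mult; auto|].
      apply bnd_plus; auto.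
    + apply Rle_trans with ((C1 + e * C2) * (D1 + e * D2)).
      * assert (0 <= e * (e * (C2 * D2))) by (repeat apply Rmult_le_pos; auto). lra.
      * apply Rmult_le_compat; auto; apply Rplus_le_le_0_compat; auto; apply Rmult_le_pos; auto.
Qed.

Lemma bnd_scal n : forall e mu C c f, bnd n e mu C f ->
  bnd n e mu (Rabs c * C) (fun t th => c * f t th).
Proof.
  induction n as [|n IH]; intros e mu C c f Hf.
  - destruct Hf as (F1 & F2 & F3).
    split; [apply sm_scal; auto|]. split; [apply Rmult_le_pos; auto using Rabs_pos|].
    intros t th Ht. rewrite Rabs_mult, Rmult_assoc.
    apply Rmult_le_compat_l; auto using Rabs_pos.
  - assert (sm f) by (eapply bnd_sm; eauto).
    destruct Hf as (C1 & C2 & F1 & F2 & F3).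
    exists (Rabs c * C1), (Rabs c * C2); repeat split; [auto| |].
    + eapply bnd_ext; [apply on_sym, dth_scal|auto].
    + pose proof (Rabs_pos c). nra.
Qed.

Lemma bnd_opp n e mu C f : bnd n e mu C f -> bnd n e mu C (fun t th => - f t th).
Proof.
  intros H. replace C with (Rabs (-1) * C) by (rewrite Rabs_left by lra; ring).
  apply (bnd_scal _ _ _ _ (-1)) in H.
  eapply bnd_ext; [|apply H]. intros t th _; simpl; ring.
Qed.

Lemma bnd_minus n e mu C D f g : bnd n e mu C f -> bnd n e mu D g ->
  bnd n e mu (C + D) (fun t th => f t th - g t th).
Proof. intros Hf Hg. apply (bnd_plus n e mu C D f (fun t th => - g t th)); auto using bnd_opp. Qed.

Lemma bnd_exp_weak n : forall e mu nu C f, nu <= mu -> bnd n e mu C f -> bnd n e nu C f.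
Proof.
  induction n as [|n IH]; intros e mu nu C f H.
  - intros (H1 & H2 & H3). split; auto. split; [lra|].
    intros t th Ht. eapply Rle_trans; [apply H3; auto|].
    apply Rmult_le_compat_l; auto. apply Rpower_le_exp; auto. eapply good_pos; eauto.
  - intros (C1 & C2 & H1 & H2 & H3). exists C1, C2; repeat split; eauto; lra.
Qed.

(** Derivatives enter the norm only with a factor [e], so the sup bound [C0] is kept and all the
    rest is multiplied by [e]. This lets a domain chosen from sup bounds serve for every order. *)
Lemma bnd_small_e n : forall e mu C C0 f, 0 <= e <= 1 -> bnd 0 e mu C0 f -> bnd n 1 mu C f ->
  bnd n e mu (C0 + e * C) f.
Proof.
  assert (M : forall n e mu C f, 0 <= e <= 1 -> bnd n 1 mu C f -> bnd n e mu C f).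
  { clear n. induction n as [|n IH]; intros e mu C f He; [auto|].
    intros (C1 & C2 & H1 & H2 & H3). exists C1, C2; repeat split; auto.
    apply bnd_pos in H2; [|lra]. nra. }
  induction n as [|n IH]; intros e mu C C0 f He H0.
  - intros (_ & H & _). apply bnd_weak with C0; [|exact H0]. nra.
  - intros (C1 & C2 & H1 & H2 & H3). exists (C0 + e * C1), C2; repeat split; [auto|auto|nra].
Qed.

(** The smallest weight given to a derivative of order at most n is [e ^ n]. Dividing by it turns
    convergence in the weighted norm into convergence of each derivative. *)
Lemma bnd_rescale n : forall e mu C f, 0 < e <= 1 -> bnd n e mu C f ->
  bnd n 1 mu (C / e ^ n) f.
Proof.
  induction n as [|n IH]; intros e mu C f He.
  - simpl. unfold Rdiv. rewrite Rinv_1, Rmult_1_r. auto.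
  - intros (C1 & C2 & H1 & H2 & H3). exists (C1 / e ^ n), (C2 / e ^ n).
    repeat split; auto.
    assert (0 < e ^ n) by (apply pow_lt; lra).
    apply bnd_pos in H1; [|lra]. 
    apply Rmult_le_reg_r with (e ^ S n); [apply pow_lt; lra|].
    unfold Rdiv at 3. rewrite Rmult_assoc, Rinv_l, Rmult_1_r by (apply pow_nonzero; lra).
    replace ((C1 / e ^ n + 1 * (C2 / e ^ n)) * e ^ S n) with (e * C1 + e * C2)
      by (simpl; field; lra). nra.
Qed.

(* All theta-derivatives of [f] are O(t^mu), uniformly on the domain. *)
Definition OO (mu : R) (f : R -> R -> R) : Prop := forall n, exists C, bnd n 1 mu C f.

Lemma OO_sm mu f : OO mu f -> sm f.
Proof. intros H; destruct (H 0%nat) as [C HC]. eapply bnd_sm; eauto. Qed.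

Lemma OO_ext mu f g : eq_on Om f g -> OO mu f -> OO mu g.
Proof. intros H Hf n; destruct (Hf n) as [C HC]; exists C; eapply bnd_ext; eauto. Qed.

Lemma OO_weak mu nu f : nu <= mu -> OO mu f -> OO nu f.
Proof. intros H Hf n; destruct (Hf n) as [C HC]; exists C; eapply bnd_exp_weak; eauto. Qed.

Lemma OO_zero mu : OO mu (fun _ _ => 0).
Proof. intros n; exists 0; apply bnd_const0. Qed.

Lemma OO_plus mu f g : OO mu f -> OO mu g -> OO mu (fun t th => f t th + g t th).
Proof. intros Hf Hg n; destruct (Hf n) as [C HC], (Hg n) as [D HD].
  eexists; apply bnd_plus; eauto. Qed.

Lemma OO_minus mu f g : OO mu f -> OO mu g -> OO mu (fun t th => f t th - g t th).
Proof. intros Hf Hg n; destruct (Hf n) as [C HC], (Hg n) as [D HD].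
  eexists; apply bnd_minus; eauto. Qed.

Lemma OO_opp mu f : OO mu f -> OO mu (fun t th => - f t th).
Proof. intros Hf n; destruct (Hf n) as [C HC]. eexists; apply bnd_opp; eauto. Qed.

Lemma OO_scal mu c f : OO mu f -> OO mu (fun t th => c * f t th).
Proof. intros Hf n; destruct (Hf n) as [C HC]. eexists; apply bnd_scal; eauto. Qed.

Lemma OO_mult mu nu la f g : OO mu f -> OO nu g -> la <= mu + nu ->
  OO la (fun t th => f t th * g t th).
Proof. intros Hf Hg Hl n; destruct (Hf n) as [C HC], (Hg n) as [D HD].
  eexists; eapply bnd_exp_weak; [exact Hl|]. apply bnd_mult; eauto; lra. Qed.

Lemma OO_dth mu f : OO mu f -> OO mu (dth f).
Proof. intros Hf n; destruct (Hf (S n)) as (C & C1 & C2 & _ & H & _). eauto. Qed.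

Lemma OO_intro mu C f : 0 <= C ->
  (forall t th, Om t th -> continuity_2d_pt f t th /\ ex_derive (fun s => f t s) th) ->
  (forall t th, Om t th -> Rabs (f t th) <= C * Rpower t mu) ->
  OO mu (dth f) -> OO mu f.
Proof.
  intros HC H1 H2 H3. assert (Hs : sm f) by (apply sm_intro; auto; eapply OO_sm; eauto).
  intros n; induction n as [|n [D HD]].
  - exists C; split; auto.
  - destruct (H3 n) as [D' HD']. exists (D + 1 * D'), D, D'; repeat split; auto; lra.
Qed.

Lemma OO_0 mu f : OO mu f -> exists C, 0 <= C /\
  forall t th, Om t th -> Rabs (f t th) <= C * Rpower t mu.
Proof. intros H; destruct (H 0%nat) as (C & _ & H1 & H2); eauto. Qed.

Lemma dthn_S n f : dthn n (dth f) = dthn (S n) f.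
Proof. induction n as [|n IH]; simpl in *; congruence. Qed.

Lemma sm_dthn f n : sm f -> sm (dthn n f).
Proof. intros H; induction n as [|n IH]; simpl; auto. apply sm_dth; auto. Qed.

Lemma OO_of_dthn mu f : sm f -> (forall n, exists C, 0 <= C /\
    forall t th, Om t th -> Rabs (dthn n f t th) <= C * Rpower t mu) -> OO mu f.
Proof.
  intros Hs H n; revert f Hs H; induction n as [|n IH]; intros f Hs H.
  - destruct (H 0%nat) as (C & H1 & H2). exists C; split; auto.
  - destruct (IH f Hs H) as [C HC]. destruct (IH (dth f)) as [D HD].
    + apply sm_dth; auto.
    + intros m. rewrite dthn_S. apply H.
    + exists (C + 1 * D), C, D; repeat split; auto; lra.
Qed.

(** The derivative f' + f' (exp f - 1) needs exp f - 1 only at the preceding order, so the induction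
    closes. Order 0 is |exp x - 1| <= |x| exp C for |x| <= C. *)
Lemma OO_exp_minus_1 mu f : 0 <= mu -> OO mu f -> OO mu (fun t th => exp (f t th) - 1).
Proof.
  intros Hmu Hf. assert (Hs := OO_sm _ _ Hf).
  assert (Hse : sm (fun t th => exp (f t th) - 1)).
  { apply (sm_minus (fun t th => exp (f t th)) (fun _ _ => 1));
      [apply sm_exp; auto|apply sm_const]. }
  assert (Hd : eq_on Om (fun t th => dth f t th + dth f t th * (exp (f t th) - 1))
     (dth (fun t th => exp (f t th) - 1))).
  { intros t th Ht. symmetry. apply is_derive_unique. generalize (sm_is _ Hs t th Ht); intros H.
    evar_last; [apply @is_derive_minus; [|apply is_derive_const]|].
    - apply (is_derive_comp exp (fun s => f t s)); [apply is_derive_exp|apply H].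
    - unfold minus, plus, opp, scal, mult, zero; simpl; unfold mult; simpl; ring. }
  intros n; induction n as [|n [C IH]].
  - destruct (OO_0 _ _ Hf) as (C & HC & Hb).
    exists (C * exp C). split; [auto|split; [apply Rmult_le_pos; auto; left; apply exp_pos|]].
    intros t th Ht. specialize (Hb t th Ht).
    assert (HR : Rpower t mu <= 1).
    { replace 1 with (Rpower t 0); [apply Rpower_le_exp; auto; eapply good_pos; eauto|].
      apply Rpower_O. eapply good_pos; eauto. }
    pose proof (Rpower_pos t mu) as HRp.
    assert (Hx : Rabs (f t th) <= C) by nra.
    set (x := f t th) in *.
    assert (Rabs (exp x - 1) <= Rabs x * exp C).
    { assert (exp x <= exp C).
      { destruct (Req_dec x C) as [->|]; [lra|].
        left; apply exp_increasing. pose proof (Rle_abs x); lra. }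
      pose proof (exp_ineq1_le x). pose proof (exp_ineq1_le (-x)) as E2.
      pose proof (exp_pos x).
      assert (exp x * exp (-x) = 1) by (rewrite <- exp_plus; replace (x + - x) with 0 by ring; apply exp_0).
      assert (exp x - 1 <= x * exp x) by nra.
      assert (1 <= exp C) by (rewrite <- exp_0; destruct (Req_dec C 0) as [->|]; [lra|left; apply exp_increasing; lra]).
      destruct (Rle_dec 0 x).
      - rewrite (Rabs_right x) in * by lra. rewrite Rabs_right by lra. nra.
      - rewrite (Rabs_left x) in * by lra. rewrite Rabs_left1 by nra. nra. }
    pose proof (exp_pos C). nra.
  - destruct (OO_dth _ _ Hf n) as [D HD].
    exists (C + 1 * (D + D * C)), C, (D + D * C); repeat split; auto; [|lra].
    eapply bnd_ext; [apply Hd|]. apply bnd_plus; auto.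
    eapply bnd_exp_weak; [|apply bnd_mult]; eauto; lra.
Qed.

Lemma smooth1_Derive g : smooth1 g -> smooth1 (Derive g).
Proof.
  intros H [|n] x; simpl; auto.
  apply (ex_derive_ext (Derive_n g (S n))); [|apply (H (S (S n)) x)].
  intros y. generalize (Derive_n_comp g n 1 y). rewrite Nat.add_1_r. intros E; symmetry; exact E.
Qed.

Lemma smooth1_ex g x : smooth1 g -> ex_derive g x.
Proof. intros H; apply (H 1%nat x). Qed.

Lemma smooth1_bounded g R : smooth1 g -> exists C, 0 <= C /\ forall x, Rabs x <= R -> Rabs (g x) <= C.
Proof.
  intros H. destruct (Rle_dec 0 R) as [HR|HR].
  2: { exists 0; split; [lra|]. intros x Hx; pose proof (Rabs_pos x); lra. }
  destruct (continuity_ab_maj (fun x => Rabs (g x)) (-R) R) as [M [HM _]]; [lra| |].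
  { intros c _. apply (continuity_pt_comp g Rabs); [|apply Rcontinuity_abs].
    apply derivable_continuous_pt. apply ex_derive_Reals_0, smooth1_ex; auto. }
  exists (Rabs (g M)); split; [apply Rabs_pos|]. intros x Hx. apply HM.
  apply Rabs_le_between; auto.
Qed.

Lemma OO_smooth1 g : smooth1 g -> OO 0 (fun _ th => g th).
Proof.
  destruct good_bdd as [R HR].
  assert (Hb : forall g, smooth1 g -> exists C, 0 <= C /\
    forall t th, Om t th -> Rabs (g th) <= C * Rpower t 0).
  { clear g. intros g H. destruct (smooth1_bounded g R H) as (C & HC & Hb).
    exists C; split; auto. intros t th Ht.
    rewrite Rpower_O, Rmult_1_r; [eauto|]. eapply good_pos; eauto. }
  assert (Hs : forall n g, smooth1 g -> smn n (fun _ th => g th)).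
  { clear g. induction n as [|n IH]; intros g H.
    - intros t th Ht. apply (continuity_1d_2d_pt_comp g (fun u v => v)); [|apply continuity_2d_pt_id2].
      apply derivable_continuous_pt. apply ex_derive_Reals_0, smooth1_ex; auto.
    - split; [|apply (IH (Derive g)), smooth1_Derive; auto].
      intros t th Ht; split; [|apply smooth1_ex; auto].
      apply (continuity_1d_2d_pt_comp g (fun u v => v)); [|apply continuity_2d_pt_id2].
      apply derivable_continuous_pt. apply ex_derive_Reals_0, smooth1_ex; auto. }
  intros H n; revert g H; induction n as [|n IH]; intros g H.
  - destruct (Hb g H) as (C & HC & H2). exists C; split; [intros n; apply Hs; auto|auto].
  - destruct (IH g H) as [C HC]. destruct (IH (Derive g)) as [D HD]; [apply smooth1_Derive; auto|].
    exists (C + 1 * D), C, D; repeat split; auto; lra.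
Qed.

Lemma OO_const c : OO 0 (fun _ _ => c).
Proof.
  apply (OO_smooth1 (fun _ => c)). intros [|[|n]] x; simpl; auto; [apply ex_derive_const|].
  apply (ex_derive_ext (fun _ => 0)); [|apply ex_derive_const].
  intros y. symmetry. apply (Derive_n_const n c).
Qed.

Lemma Rpower_0_1 t th : Om t th -> Rpower t 0 = 1.
Proof. intros H. apply Rpower_O. eapply good_pos; eauto. Qed.

Lemma ln_cont t : 0 < t -> continuity_pt ln t.
Proof. intros. apply derivable_continuous_pt. exists (/ t). apply derivable_pt_lim_ln; auto. Qed.

Lemma sm_ln : sm (fun t _ => ln t).
Proof. apply (sm_t ln). intros t th Ht; apply ln_cont. eapply good_pos; eauto. Qed.

Lemma OO_of_t mu C (g : R -> R) : 0 <= C -> (forall t th, Om t th -> continuity_pt g t) ->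
  (forall t th, Om t th -> Rabs (g t) <= C * Rpower t mu) -> OO mu (fun t _ => g t).
Proof.
  intros HC H1 H2. apply (OO_intro mu C); auto.
  - intros t th Ht. split; [|apply ex_derive_const].
    apply (continuity_1d_2d_pt_comp g (fun u v => u)); [eauto|apply continuity_2d_pt_id1].
  - rewrite dth_t. apply OO_zero.
Qed.

(** From exp x >= 1 + x at x = - s ln t: a logarithm costs an arbitrarily small power of t. *)
Lemma OO_ln s : 0 < s -> OO (- s) (fun t _ => ln t).
Proof.
  intros Hs. apply (OO_of_t (- s) (/ s) ln).
  - left; apply Rinv_0_lt_compat; auto.
  - intros t th Ht. apply ln_cont. eapply good_pos; eauto.
  - intros t th Ht. destruct (good_pos _ _ Ht) as [H0 H1].
    assert (ln t < 0) by (rewrite <- ln_1; apply ln_increasing; lra).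
    rewrite Rabs_left by auto. unfold Rpower.
    pose proof (exp_ineq1_le (- s * ln t)).
    apply Rmult_le_reg_l with s; auto. rewrite <- Rmult_assoc, Rinv_r by lra. lra.
Qed.

Lemma Rpower_cont a t : 0 < t -> continuity_pt (fun t => Rpower t a) t.
Proof.
  intros. apply derivable_continuous_pt. exists (a * Rpower t (a - 1)).
  apply derivable_pt_lim_power; auto.
Qed.

Lemma OO_Rp mu : OO mu (fun t _ => Rpower t mu).
Proof.
  apply (OO_of_t mu 1 (fun t => Rpower t mu)); [lra| |].
  - intros t th Ht. apply Rpower_cont. eapply good_pos; eauto.
  - intros. rewrite Rabs_right; [lra|]. left; apply Rpower_pos.
Qed.

Lemma dth_tpow a : sm (fun _ th => a th) -> 
  eq_on Om (dth (fun t th => Rpower t (a th))) (fun t th => Derive a th * ln t * Rpower t (a th)).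
Proof.
  intros Ha t th Ht. pose proof (sm_is _ Ha t th Ht) as H.
  apply is_derive_unique. unfold Rpower.
  apply (is_derive_comp exp (fun s => a s * ln t)); [apply is_derive_exp|].
  evar_last; [apply (is_derive_scal_l a th _ (ln t) H)|].
  unfold scal; simpl; unfold mult; simpl. reflexivity.
Qed.

Lemma sm_tpow a : sm (fun _ th => a th) -> sm (fun t th => Rpower t (a th)).
Proof.
  intros. unfold Rpower. apply (sm_exp (fun t th => a th * ln t)).
  apply (sm_mult (fun _ th => a th)); auto. apply sm_ln.
Qed.

(** Each theta-derivative of t^(a(theta)) brings a factor a' ln t, so the exponent must exceed [mu]
    by a margin. The induction spends half of the margin [s] on the logarithm and keeps the other
    half for the derivatives to come. *)
Lemma OO_tpow a mu s : OO 0 (fun _ th => a th) -> 0 < s ->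
  (forall t th, Om t th -> mu + s <= a th) -> OO mu (fun t th => Rpower t (a th)).
Proof.
  intros Ha Hs H n. assert (Hsm := OO_sm _ _ Ha). revert mu s Hs H.
  induction n as [|n IH]; intros mu s Hs H.
  - exists 1; split; [apply sm_tpow; auto|split; [lra|]].
    intros t th Ht. rewrite Rabs_right, Rmult_1_l; [|left; apply Rpower_pos].
    apply Rpower_le_exp; [eapply good_pos; eauto|]. specialize (H t th Ht); lra.
  - destruct (IH mu s Hs H) as [C HC].
    destruct (IH (mu + s/2) (s/2)) as [D HD]; [lra|intros t th Ht; specialize (H t th Ht); lra|].
    destruct (OO_mult 0 (-(s/2)) (-(s/2)) _ _ (OO_dth _ _ Ha) (OO_ln (s/2) ltac:(lra)) ltac:(lra) n) as [A HA].
    exists (C + 1 * (A * D)), C, (A * D); repeat split; auto; [|lra].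
    eapply bnd_ext; [apply on_sym, (dth_tpow a Hsm)|].
    eapply bnd_exp_weak; [|apply (bnd_mult n 1 (-(s/2)) (mu + s/2) A D); [lra|exact HA|exact HD]]. lra.
Qed.

End Calculus.
Arguments smn : clear implicits.
Arguments sm : clear implicits.
Arguments bnd : clear implicits.
Arguments OO : clear implicits.

(** * Composition in two variables and decay at t = 0 *)

Lemma loc2_comp (g1 g2 : R -> R -> R) (P : R -> R -> Prop) x y :
  continuity_2d_pt g1 x y -> continuity_2d_pt g2 x y ->
  locally_2d P (g1 x y) (g2 x y) -> locally_2d (fun u v => P (g1 u v) (g2 u v)) x y.
Proof.
  intros H1 H2 [d Hd]. generalize (locally_2d_and _ _ _ _ (H1 d) (H2 d)).
  apply locally_2d_impl, locally_2d_forall. intros u v [A B]; auto.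
Qed.

Lemma c2_comp (f g1 g2 : R -> R -> R) x y :
  continuity_2d_pt g1 x y -> continuity_2d_pt g2 x y ->
  continuity_2d_pt f (g1 x y) (g2 x y) ->
  continuity_2d_pt (fun u v => f (g1 u v) (g2 u v)) x y.
Proof.
  intros H1 H2 H eps.
  apply (loc2_comp g1 g2 (fun a b => Rabs (f a b - f (g1 x y) (g2 x y)) < eps)); auto.
Qed.

(** Both h - (C / mu) s^mu and - h - (C / mu) s^mu are nonincreasing in s and tend to 0 at s = 0.
    The factors 1/mu in the later estimates all come from here. *)
Lemma est_decay (h h' : R -> R) (t C mu : R) : 0 < t -> 0 < mu ->
  (forall s, 0 < s <= t -> is_derive h s (h' s) /\ Rabs (h' s) <= C * Rpower s mu / s) ->
  (forall eps, 0 < eps -> exists eta, 0 < eta /\ forall s, 0 < s < eta -> s <= t -> Rabs (h s) <= eps) ->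
  Rabs (h t) <= C / mu * Rpower t mu.
Proof.
  intros Ht Hmu Hd H0.
  assert (Hp : forall s, 0 < s -> is_derive (fun s => C / mu * Rpower s mu) s (C * Rpower s mu / s)).
  { intros s Hs. evar_last; [apply (is_derive_scal (fun s => Rpower s mu)); apply is_derive_Reals, derivable_pt_lim_power; auto|].
    unfold Rminus. rewrite Rpower_plus, Rpower_Ropp, Rpower_1 by auto. field. lra. }
  assert (Hm : forall (sg : R), Rabs sg = 1 -> forall s, 0 < s < t ->
    sg * h t - C / mu * Rpower t mu <= sg * h s - C / mu * Rpower s mu).
  { intros sg Hsg s Hs.
    destruct (MVT_gen (fun s => sg * h s - C / mu * Rpower s mu) s t
      (fun s => sg * h' s - C * Rpower s mu / s)) as (c & Hc & E).
    - intros x Hx. rewrite Rmin_left, Rmax_right in Hx by lra.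
      apply @is_derive_minus; [apply is_derive_scal, Hd; lra|apply Hp; lra].
    - intros x Hx. rewrite Rmin_left, Rmax_right in Hx by lra.
      apply derivable_continuous_pt. apply ex_derive_Reals_0.
      eexists. apply @is_derive_minus; [apply is_derive_scal, Hd; lra|apply Hp; lra].
    - rewrite Rmin_left, Rmax_right in Hc by lra.
      assert (sg * h' c <= C * Rpower c mu / c).
      { eapply Rle_trans; [apply Rle_abs|]. rewrite Rabs_mult, Hsg, Rmult_1_l.
        apply Hd; lra. }
      simpl in E. nra. }
  apply le_epsilon. intros eps He.
  destruct (H0 eps He) as (eta & Heta & Hs).
  set (s := Rmin (eta / 2) (t / 2)).
  assert (0 < s) by (apply Rmin_pos; lra).
  assert (s <= eta / 2) by apply Rmin_l. assert (s <= t / 2) by apply Rmin_r.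
  specialize (Hs s ltac:(lra) ltac:(lra)).
  assert (HC : 0 <= C).
  { destruct (Hd t ltac:(lra)) as [_ HH]. pose proof (Rabs_pos (h' t)).
    assert (0 < Rpower t mu / t) by (apply Rdiv_lt_0_compat; [apply Rpower_pos|auto]).
    unfold Rdiv in *. nra. }
  assert (0 <= C / mu * Rpower s mu).
  { apply Rmult_le_pos; [apply Rdiv_le_0_compat; auto|left; apply Rpower_pos]. }
  pose proof (Hm 1 Rabs_R1 s ltac:(lra)).
  pose proof (Hm (-1) ltac:(rewrite Rabs_left; lra) s ltac:(lra)).
  apply Rabs_le_between in Hs. apply Rabs_le_between. lra.
Qed.

(** The kind of convergence demanded of [kappa]: pointwise in theta and without a rate. *)
Definition tends0 (Om : R -> R -> Prop) (h : R -> R -> R) : Prop :=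
  forall t th, Om t th -> forall eps, 0 < eps -> exists eta, 0 < eta /\
    forall s, 0 < s < eta -> s <= t -> Rabs (h s th) <= eps.

Lemma small_Rpower C mu eps : 0 < mu -> 0 < eps -> exists eta, 0 < eta /\
  forall s, 0 < s < eta -> C * Rpower s mu <= eps.
Proof.
  intros Hmu He. set (D := Rabs C + 1).
  assert (HD : 0 < D) by (unfold D; pose proof (Rabs_pos C); lra).
  exists (Rpower (eps / D) (/ mu)). split; [apply Rpower_pos|].
  intros s Hs. apply Rle_trans with (D * Rpower s mu).
  - apply Rmult_le_compat_r; [left; apply Rpower_pos|]. unfold D; pose proof (Rle_abs C); lra.
  - assert (Rpower s mu <= eps / D).
    { replace (eps / D) with (Rpower (Rpower (eps / D) (/ mu)) mu).
      - apply Rle_Rpower_l; lra.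
      - rewrite Rpower_mult, Rinv_l by lra. apply Rpower_1. apply Rdiv_lt_0_compat; auto. }
    apply Rmult_le_reg_l with (/ D); [apply Rinv_0_lt_compat; auto|].
    rewrite <- Rmult_assoc, Rinv_l by lra. unfold Rdiv in *. lra.
Qed.

(** * Integration along characteristics *)

Section Integral.
Context {Om : R -> R -> Prop} {HOm : good Om}.

Lemma tends0_OO mu h : 0 < mu -> OO Om mu h -> tends0 Om h.
Proof.
  intros Hmu H t th Ht eps He. destruct (OO_0 _ _ H) as (C & HC & Hb).
  destruct (small_Rpower C mu eps Hmu He) as (eta & Heta & Hs).
  exists eta; split; auto. intros s Hs1 Hs2. eapply Rle_trans; [apply Hb|apply Hs; auto].
  apply (good_cone t th); auto; [lra|]. rewrite Rminus_diag, Rabs_R0; lra.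
Qed.

Lemma tends0_plus f g : tends0 Om f -> tends0 Om g -> tends0 Om (fun t th => f t th + g t th).
Proof.
  intros Hf Hg t th Ht eps He.
  destruct (Hf t th Ht (eps/2) ltac:(lra)) as (a & Ha & Ha').
  destruct (Hg t th Ht (eps/2) ltac:(lra)) as (b & Hb & Hb').
  exists (Rmin a b); split; [apply Rmin_pos; auto|]. intros s Hs Hst.
  assert (s < a) by (eapply Rlt_le_trans; [apply Hs|apply Rmin_l]).
  assert (s < b) by (eapply Rlt_le_trans; [apply Hs|apply Rmin_r]).
  eapply Rle_trans; [apply Rabs_triang|].
  specialize (Ha' s ltac:(lra) Hst). specialize (Hb' s ltac:(lra) Hst). lra.
Qed.

Lemma Om_vert t th s : Om t th -> 0 < s <= t -> Om s th.
Proof. intros H Hs. apply (good_cone t th); auto. rewrite Rminus_diag, Rabs_R0; lra. Qed.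

(* [J c f] is the improper integral of f(s, theta - c (t - s)) ds / s over 0 < s < t. The
   substitution s = sigma^32 makes its integrand continuous up to sigma = 0 as soon as f = O(s^(1/16)). *)
Definition char_integrand (c : R) (f : R -> R -> R) (phi s : R) : R :=
  if Rle_dec s 0 then 0 else 32 * f (s ^ 32) (phi + c * s ^ 32) / s.

(** The parameter [phi] labels the characteristic theta = phi + c s. For fixed [phi] the time t
    occurs only in the upper limit of integration. *)
Definition char_prim (c : R) (f : R -> R -> R) (t phi : R) : R :=
  RInt (char_integrand c f phi) 0 (Rpower t (/ 32)).

Definition J (c : R) (f : R -> R -> R) : R -> R -> R :=
  fun t th => char_prim c f t (th - c * t).

Lemma root32 t : 0 < t -> Rpower t (/ 32) ^ 32 = t.
Proof.
  intros Ht. rewrite <- Rpower_pow by apply Rpower_pos. rewrite Rpower_mult.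
  replace (/ 32 * INR 32) with 1 by (simpl; field). apply Rpower_1; auto.
Qed.

Lemma pow32_le s t : 0 < s -> 0 < t -> s <= Rpower t (/ 32) -> s ^ 32 <= t.
Proof. intros. rewrite <- (root32 t) by auto. apply pow_incr; lra. Qed.

Context (c : R) (Hc : Rabs c <= 1).

Lemma char_dom t phi s : Om t (phi + c * t) -> 0 < s <= Rpower t (/ 32) ->
  Om (s ^ 32) (phi + c * s ^ 32).
Proof.
  intros H Hs. destruct (good_pos _ _ H).
  assert (0 < s ^ 32) by (apply pow_lt; lra).
  assert (s ^ 32 <= t) by (apply pow32_le; lra).
  apply (good_cone t (phi + c * t)); auto.
  replace (phi + c * s ^ 32 - (phi + c * t)) with (c * (s ^ 32 - t)) by ring.
  rewrite Rabs_mult, (Rabs_left1 (s ^ 32 - t)) by lra. nra.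
Qed.

Lemma c2_pow : forall n x y, continuity_2d_pt (fun u v => v ^ n) x y.
Proof.
  induction n as [|n IH]; intros x y; simpl; [apply continuity_2d_pt_const|].
  apply continuity_2d_pt_mult; [apply continuity_2d_pt_id2|apply IH].
Qed.

Lemma c2_char1 : forall x y, continuity_2d_pt (fun u v => u + c * v ^ 32) x y.
Proof.
  intros. apply continuity_2d_pt_plus; [apply continuity_2d_pt_id1|].
  apply continuity_2d_pt_mult; [apply continuity_2d_pt_const|apply c2_pow].
Qed.

(** Differentiation under the integral needs the integrand near the endpoint s = 0 as well. A
    positive v close to 0 lies below the root of t, so the cone property applies; for v <= 0 the
    integrand is 0 by definition. *)
Lemma char_dom_near t phi s : Om t (phi + c * t) -> s <= Rpower t (/ 32) ->
  locally_2d (fun u v => 0 < v -> Om (v ^ 32) (u + c * v ^ 32)) phi s.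
Proof.
  intros H Hs. destruct (Rlt_dec 0 s) as [H0|H0].
  - apply (locally_2d_impl (fun u v => Om (v ^ 32) (u + c * v ^ 32))).
    + apply locally_2d_forall; auto.
    + apply (loc2_comp (fun u v => v ^ 32) (fun u v => u + c * v ^ 32));
        [apply c2_pow|apply c2_char1|].
      apply good_open, (char_dom t); auto.
  - destruct (good_open _ _ H) as [d Hd].
    assert (Hr : 0 < Rmin d (Rpower t (/ 32))) by (apply Rmin_pos; [apply cond_pos|apply Rpower_pos]).
    exists (mkposreal _ Hr). simpl. intros u v Hu Hv Hv0.
    assert (Rmin d (Rpower t (/ 32)) <= d) by apply Rmin_l.
    assert (Rmin d (Rpower t (/ 32)) <= Rpower t (/ 32)) by apply Rmin_r.
    apply (char_dom t).
    + apply Hd.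
      * rewrite Rminus_diag, Rabs_R0; apply cond_pos.
      * replace (u + c * t - (phi + c * t)) with (u - phi) by ring. lra.
    + apply Rabs_lt_between in Hv. lra.
Qed.

Lemma pow32_Rpower s : 0 < s -> Rpower (s ^ 32) (/ 16) = s * s.
Proof.
  intros. rewrite <- Rpower_pow, Rpower_mult by auto.
  replace (INR 32 * / 16) with (1 + 1) by (simpl; field).
  rewrite Rpower_plus, Rpower_1; auto.
Qed.

Lemma char_bound f C phi s : (forall t th, Om t th -> Rabs (f t th) <= C * Rpower t (/ 16)) ->
  0 <= C -> (0 < s -> Om (s ^ 32) (phi + c * s ^ 32)) ->
  Rabs (char_integrand c f phi s) <= 32 * C * Rabs s.
Proof.
  intros Hf HC H. unfold char_integrand. destruct (Rle_dec s 0) as [Hs|Hs].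
  - rewrite Rabs_R0. pose proof (Rabs_pos s). nra.
  - assert (0 < s) by lra. specialize (Hf _ _ (H H0)). rewrite pow32_Rpower in Hf by auto.
    unfold Rdiv. rewrite !Rabs_mult, (Rabs_right (/ s)), (Rabs_right 32), (Rabs_right s);
      try lra; [|left; apply Rinv_0_lt_compat; auto].
    apply Rmult_le_reg_r with s; auto. rewrite Rmult_assoc, Rinv_l by lra. lra.
Qed.

Lemma char_c2 f t phi s : OO Om (/ 16) f -> Om t (phi + c * t) -> s <= Rpower t (/ 32) ->
  continuity_2d_pt (char_integrand c f) phi s.
Proof.
  intros Hf Ht Hs. destruct (OO_0 _ _ Hf) as (C & HC & Hb).
  pose proof (char_dom_near t phi s Ht Hs) as Hn.
  destruct (Rtotal_order s 0) as [H0|[H0|H0]].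
  - apply continuity_2d_pt_ext_loc with (fun _ _ => 0); [|apply continuity_2d_pt_const].
    assert (Hr : 0 < - s) by lra. exists (mkposreal _ Hr); simpl. intros u v _ Hv.
    unfold char_integrand. destruct (Rle_dec v 0); auto. apply Rabs_lt_between in Hv. lra.
  - intros eps. subst s.
    assert (Hr : 0 < eps / (32 * C + 1)) by (apply Rdiv_lt_0_compat; [apply cond_pos|lra]).
    assert (He : locally_2d (fun u v => Rabs v < eps / (32 * C + 1)) phi 0).
    { exists (mkposreal _ Hr); simpl. intros u v _ Hv. rewrite Rminus_0_r in Hv; auto. }
    generalize (locally_2d_and _ _ _ _ Hn He). apply locally_2d_impl, locally_2d_forall.
    intros u v [A B]. unfold char_integrand at 2. destruct (Rle_dec 0 0); [|lra].
    rewrite Rminus_0_r. eapply Rle_lt_trans; [apply (char_bound f C); auto|].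
    apply Rlt_div_r in B; [|lra]. pose proof (Rabs_pos v). lra.
  - apply continuity_2d_pt_ext_loc with (fun u v => 32 * f (v ^ 32) (u + c * v ^ 32) * / v).
    + exists (mkposreal _ H0); simpl. intros u v _ Hv. unfold char_integrand.
      destruct (Rle_dec v 0); auto. apply Rabs_lt_between in Hv. lra.
    + apply continuity_2d_pt_mult; [apply continuity_2d_pt_mult; [apply continuity_2d_pt_const|]|].
      * apply (c2_comp f (fun u v => v ^ 32) (fun u v => u + c * v ^ 32));
          [apply c2_pow|apply c2_char1|].
        apply (@sm_c Om f); [eapply OO_sm; eauto|]. apply (char_dom t); auto.
      * apply continuity_2d_pt_inv; [apply continuity_2d_pt_id2|lra].
Qed.

Lemma c2_pt2 (f : R -> R -> R) x y : continuity_2d_pt f x y -> continuous (fun v => f x v) y.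
Proof.
  intros H. apply continuity_pt_filterlim. intros eps He.
  destruct (H (mkposreal _ He)) as [d Hd]. exists d; split; [apply cond_pos|].
  intros v [_ Hv]. apply Hd; auto. rewrite Rminus_diag, Rabs_R0; apply cond_pos.
Qed.

Lemma char_ex_RInt f t phi b : OO Om (/ 16) f -> Om t (phi + c * t) -> b <= Rpower t (/ 32) ->
  ex_RInt (char_integrand c f phi) 0 b.
Proof.
  intros Hf Ht Hb. apply @ex_RInt_continuous. intros z Hz.
  apply (c2_pt2 (char_integrand c f)). eapply char_c2; eauto.
  eapply Rle_trans; [apply Hz|]. apply Rmax_lub; [left; apply Rpower_pos|auto].
Qed.

Lemma char_Derive f phi s : OO Om (/ 16) f -> (0 < s -> Om (s ^ 32) (phi + c * s ^ 32)) ->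
  is_derive (fun u => char_integrand c f u s) phi (char_integrand c (dth f) phi s).
Proof.
  intros Hf H. unfold char_integrand. destruct (Rle_dec s 0) as [Hs|Hs]; [apply @is_derive_const|].
  assert (Hs' : 0 < s) by lra. pose proof (sm_is f (OO_sm _ _ Hf) _ _ (H Hs')) as Hd.
  apply (is_derive_ext (fun u => (32 / s) * f (s ^ 32) (u + c * s ^ 32))).
  - intros u; simpl; field; lra.
  - evar_last; [apply is_derive_scal; apply (is_derive_comp (fun x => f (s ^ 32) x) (fun u => u + c * s ^ 32)); [exact Hd|]|].
    + evar_last; [apply @is_derive_plus; [apply is_derive_id|apply is_derive_const]|].
      simpl. unfold plus, one, zero; simpl. rewrite Rplus_0_r. reflexivity.
    + unfold scal; simpl; unfold mult; simpl. field; lra.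
Qed.

Lemma prim_dphi f t phi : OO Om (/ 16) f -> Om t (phi + c * t) ->
  is_derive (fun u => char_prim c f t u) phi (char_prim c (dth f) t phi).
Proof.
  intros Hf Ht. unfold char_prim. set (b := Rpower t (/ 32)).
  assert (Hb : 0 < b) by apply Rpower_pos.
  assert (Hloc : locally phi (fun u => Om t (u + c * t))).
  { destruct (good_open _ _ Ht) as [d Hd]. exists d. intros u Hu. apply Hd.
    - rewrite Rminus_diag, Rabs_R0; apply cond_pos.
    - replace (u + c * t - (phi + c * t)) with (u - phi) by ring. apply Hu. }
  evar_last; [apply (is_derive_RInt_param (char_integrand c f) 0 b phi)|].
  - generalize Hloc. apply filter_imp. intros u Hu s Hs.
    rewrite Rmin_left, Rmax_right in Hs by lra. eexists. apply char_Derive; auto.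
    intros H0. apply (char_dom t); auto. unfold b in Hs; lra.
  - intros s Hs. rewrite Rmin_left, Rmax_right in Hs by lra.
    apply continuity_2d_pt_ext_loc with (char_integrand c (dth f)).
    + generalize (char_dom_near t phi s Ht ltac:(unfold b in Hs; lra)).
      apply locally_2d_impl, locally_2d_forall. intros u v Huv.
      symmetry. apply is_derive_unique. apply char_Derive; auto.
    + eapply char_c2; [apply OO_dth; auto|eauto|unfold b in Hs; lra].
  - generalize Hloc. apply filter_imp. intros u Hu. eapply char_ex_RInt; eauto. unfold b; lra.
  - apply RInt_ext. intros s Hs. rewrite Rmin_left, Rmax_right in Hs by lra.
    apply is_derive_unique. apply char_Derive; auto. intros _. apply (char_dom t); auto. unfold b in Hs; lra.
Qed.

Lemma prim_dt f t phi : OO Om (/ 16) f -> Om t (phi + c * t) ->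
  is_derive (fun s => char_prim c f s phi) t (f t (phi + c * t) / t).
Proof.
  intros Hf Ht. destruct (good_pos _ _ Ht) as [H0 H1]. unfold char_prim. set (b := Rpower t (/ 32)).
  assert (Hb : 0 < b) by apply Rpower_pos.
  (* Differentiating the integral in its upper limit requires integrability slightly beyond t, hence
     a later point of the domain on the same characteristic. *)
  assert (exists t2, t < t2 /\ Om t2 (phi + c * t2)) as (t2 & Ht2 & HOm2).
  { destruct (good_open _ _ Ht) as [d Hd]. pose proof (cond_pos d). exists (t + d / 2). split; [lra|].
    apply Hd.
    - rewrite Rabs_right; lra.
    - replace (phi + c * (t + d / 2) - (phi + c * t)) with (c * (d / 2)) by ring.
      rewrite Rabs_mult, (Rabs_right (d / 2)) by lra. nra. }
  assert (Hb2 : b < Rpower t2 (/ 32)).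
  { unfold b. apply Rlt_Rpower_l; lra. }
  evar_last; [apply (is_derive_comp (fun x => RInt (char_integrand c f phi) 0 x) (fun s => Rpower s (/ 32)))|].
  - apply @is_derive_RInt with (a := 0).
    + exists (mkposreal (Rpower t2 (/ 32) - b) ltac:(lra)). intros x Hx.
      apply @RInt_correct. apply (char_ex_RInt f t2); auto.
      unfold ball in Hx; simpl in Hx. unfold AbsRing_ball, abs, minus, plus, opp in Hx; simpl in Hx.
      apply Rabs_lt_between in Hx. fold b in Hx. lra.
    + apply (c2_pt2 (char_integrand c f)). apply (char_c2 f t); auto. unfold b; lra.
  - apply is_derive_Reals, derivable_pt_lim_power; auto.
  - unfold char_integrand.
    match goal with |- scal ?x ?y = ?z => change (x * y = z) end. unfold Rminus.
    rewrite Rpower_plus, Rpower_Ropp, Rpower_1 by auto. fold b.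
    assert (E : b ^ 32 = t) by (apply root32; auto).
    rewrite E. destruct (Rle_dec b 0); [lra|]. field. lra.
Qed.

(** A t-derivative that exists nearby and is continuous, together with a phi-derivative at the
    point, gives total differentiability. The chain rule at phi = theta - c t, which moves with t,
    rests on it. *)
Lemma prim_diff f t phi : OO Om (/ 16) f -> Om t (phi + c * t) ->
  differentiable_pt_lim (char_prim c f) t phi (f t (phi + c * t) / t) (char_prim c (dth f) t phi).
Proof.
  intros Hf Ht. apply filterdiff_differentiable_pt_lim.
  assert (Hg : locally_2d (fun u v => Om u (v + c * u)) t phi).
  { apply (loc2_comp (fun u v => u) (fun u v => v + c * u)).
    - apply continuity_2d_pt_id1.
    - apply continuity_2d_pt_plus; [apply continuity_2d_pt_id2|].
      apply continuity_2d_pt_mult; [apply continuity_2d_pt_const|apply continuity_2d_pt_id1].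
    - apply good_open; auto. }
  apply (is_derive_filterdiff (char_prim c f) t phi (fun u v => f u (v + c * u) / u)).
  - apply (locally_2d_locally (fun u v => is_derive (fun z => char_prim c f z v) u (f u (v + c * u) / u)) t phi).
    generalize Hg. apply locally_2d_impl, locally_2d_forall.
    intros u v Huv. apply prim_dt; auto.
  - apply prim_dphi; auto.
  - apply (continuity_2d_pt_filterlim (fun u v => f u (v + c * u) / u)). destruct (good_pos _ _ Ht).
    apply (continuity_2d_pt_mult (fun u v => f u (v + c * u)) (fun u v => / u)).
    + apply (c2_comp f (fun u v => u) (fun u v => v + c * u)).
      * apply continuity_2d_pt_id1.
      * apply continuity_2d_pt_plus; [apply continuity_2d_pt_id2|].
        apply continuity_2d_pt_mult; [apply continuity_2d_pt_const|apply continuity_2d_pt_id1].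
      * apply (@sm_c Om f); auto. eapply OO_sm; eauto.
    + apply continuity_2d_pt_inv; [apply continuity_2d_pt_id1|apply Rgt_not_eq; auto].
Qed.

Lemma J_dth f : OO Om (/ 16) f -> forall t th, Om t th ->
  is_derive (fun s => J c f t s) th (J c (dth f) t th).
Proof.
  intros Hf t th Ht. unfold J.
  evar_last; [apply (is_derive_comp (fun x => char_prim c f t x) (fun s => s - c * t))|].
  - apply prim_dphi; auto. replace (th - c * t + c * t) with th by ring; auto.
  - apply @is_derive_minus; [apply is_derive_id|apply is_derive_const].
  - unfold scal; simpl; unfold mult, minus, plus, opp, one, zero; simpl. ring.
Qed.

(** This is the transport equation D u + c t u' = f for u = [J c f], with u' already written as
    [J c (dth f)]. *)
Lemma J_dt f : OO Om (/ 16) f -> forall t th, Om t th ->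
  is_derive (fun s => J c f s th) t (f t th / t - c * J c (dth f) t th).
Proof.
  intros Hf t th Ht. apply is_derive_Reals. unfold J.
  replace (f t th / t - c * char_prim c (dth f) t (th - c * t))
    with (f t (th - c * t + c * t) / t * 1 + char_prim c (dth f) t (th - c * t) * (- c))
    by (replace (th - c * t + c * t) with th by ring; ring).
  apply (derivable_pt_lim_comp_2d (char_prim c f) (fun s => s) (fun s => th - c * s)).
  - apply prim_diff; auto. replace (th - c * t + c * t) with th by ring; auto.
  - apply derivable_pt_lim_id.
  - apply is_derive_Reals. auto_derive; auto; ring.
Qed.

Lemma J_c2 f : OO Om (/ 16) f -> forall t th, Om t th -> continuity_2d_pt (J c f) t th.
Proof.
  intros Hf t th Ht. unfold J.
  apply (c2_comp (char_prim c f) (fun u v => u) (fun u v => v - c * u)).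
  - apply continuity_2d_pt_id1.
  - apply continuity_2d_pt_minus; [apply continuity_2d_pt_id2|].
    apply continuity_2d_pt_mult; [apply continuity_2d_pt_const|apply continuity_2d_pt_id1].
  - apply differentiable_continuity_pt. eexists. eexists. apply prim_diff; auto.
    replace (th - c * t + c * t) with th by ring; auto.
Qed.

Lemma J_dth_on f : OO Om (/ 16) f -> eq_on Om (dth (J c f)) (J c (dth f)).
Proof. intros Hf t th Ht. apply is_derive_unique, J_dth; auto. Qed.

Lemma J_sm f : OO Om (/ 16) f -> sm Om (J c f).
Proof.
  intros Hf n; revert f Hf; induction n as [|n IH]; intros f Hf.
  - intros t th Ht; apply J_c2; auto.
  - split.
    + intros t th Ht; split; [apply J_c2; auto|eexists; apply J_dth; auto].
    + eapply smn_ext; [apply on_sym, J_dth_on; auto|]. apply IH, OO_dth; auto.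
Qed.

Lemma J_bound0 f mu C : OO Om (/ 16) f -> 0 < mu ->
  (forall t th, Om t th -> Rabs (f t th) <= C * Rpower t mu) ->
  forall t th, Om t th -> Rabs (J c f t th) <= C / mu * Rpower t mu.
Proof.
  intros Hf Hmu Hb t th Ht. destruct (good_pos _ _ Ht) as [H0 H1].
  assert (HOm' : forall s, 0 < s <= t -> Om s (th - c * t + c * s)).
  { intros s Hs. apply (good_cone t th); auto.
    replace (th - c * t + c * s - th) with (c * (s - t)) by ring.
    rewrite Rabs_mult, (Rabs_left1 (s - t)) by lra. nra. }
  unfold J.
  apply (est_decay (fun s => char_prim c f s (th - c * t)) (fun s => f s (th - c * t + c * s) / s)); auto.
  - intros s Hs. split; [apply prim_dt; auto|].
    unfold Rdiv. rewrite Rabs_mult, (Rabs_right (/ s)) by (left; apply Rinv_0_lt_compat; lra).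
    apply Rmult_le_compat_r; [left; apply Rinv_0_lt_compat; lra|]. apply Hb; auto.
  (* That the integral vanishes at t = 0 comes from the rate 1/16: the integrand is at most 32 D
     sigma on an interval of length b, and b^2 = s^(1/16). *)
  - destruct (OO_0 _ _ Hf) as (D & HD & Hbd). intros eps He.
    destruct (small_Rpower (32 * D) (/ 16) eps ltac:(lra) He) as (eta & Heta & Hs).
    exists eta; split; auto. intros s Hs1 Hs2. eapply Rle_trans; [|apply (Hs s); auto].
    assert (Hs3 : 0 < s <= t) by lra. pose proof (HOm' s Hs3) as HOs.
    unfold char_prim. set (b := Rpower s (/ 32)). assert (0 < b) by apply Rpower_pos.
    eapply Rle_trans; [apply (abs_RInt_le_const _ 0 b (32 * D * b)); [lra| |]|].
    + eapply char_ex_RInt; eauto. unfold b; lra.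
    + intros x Hx. eapply Rle_trans; [apply (char_bound f D); auto|].
      * intros Hx0. apply (char_dom s); auto. unfold b in Hx; lra.
      * rewrite Rabs_right by lra. apply Rmult_le_compat_l; lra.
    + replace (Rpower s (/ 16)) with (b * b); [right; ring|].
      unfold b. rewrite <- Rpower_plus. f_equal. field.
Qed.

(** Since [J] commutes with [dth], the sup estimate passes to every order with the same factor
    1/mu. *)
Lemma J_bnd n e mu C f : OO Om (/ 16) f -> 0 < mu -> bnd Om n e mu C f ->
  bnd Om n e mu (C / mu) (J c f).
Proof.
  intros Hf Hmu; revert C f Hf; induction n as [|n IH]; intros C f Hf H.
  - destruct H as (H1 & H2 & H3). split; [apply J_sm; auto|split].
    + apply Rdiv_le_0_compat; auto.
    + apply J_bound0; auto.
  - destruct H as (C1 & C2 & H1 & H2 & H3). exists (C1 / mu), (C2 / mu); repeat split.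
    + apply IH; auto.
    + eapply bnd_ext; [apply on_sym, J_dth_on; auto|]. apply IH; auto. apply OO_dth; auto.
    + replace (C1 / mu + e * (C2 / mu)) with ((C1 + e * C2) / mu) by (field; lra).
      apply Rmult_le_compat_r; auto. left; apply Rinv_0_lt_compat; auto.
Qed.

Lemma J_OO mu f : / 16 <= mu -> OO Om mu f -> OO Om mu (J c f).
Proof.
  intros Hmu Hf n. destruct (Hf n) as [C HC]. eexists. apply J_bnd; eauto; [|lra].
  eapply OO_weak; eauto.
Qed.

Lemma J_minus f g : OO Om (/ 16) f -> OO Om (/ 16) g ->
  eq_on Om (J c (fun t th => f t th - g t th)) (fun t th => J c f t th - J c g t th).
Proof.
  intros Hf Hg t th Ht. unfold J, char_prim.
  assert (H : Om t (th - c * t + c * t)) by (replace (th - c * t + c * t) with th by ring; auto).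
  match goal with |- _ = ?a - ?b => change (a - b) with (minus a b) end.
  rewrite <- RInt_minus; [|eapply char_ex_RInt; eauto; lra|eapply char_ex_RInt; eauto; lra].
  apply RInt_ext. intros s Hs. unfold char_integrand, minus, plus, opp; simpl.
  destruct (Rle_dec s 0); [ring|]. unfold Rdiv; ring.
Qed.

Lemma J_ext f g : eq_on Om f g -> eq_on Om (J c f) (J c g).
Proof.
  intros Hfg t th Ht. unfold J, char_prim. apply RInt_ext. intros s Hs.
  pose proof (Rpower_pos t (/ 32)). rewrite Rmin_left, Rmax_right in Hs by lra.
  unfold char_integrand. destruct (Rle_dec s 0); auto. rewrite Hfg; auto.
  apply (char_dom t); [|lra]. replace (th - c * t + c * t) with th by ring; auto.
Qed.

End Integral.

(** Two primitives of f/t that vanish at t = 0 differ by a function with derivative 0, to which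
    [est_decay] applies with C = 0. This is the tool that turns a differential equation with known
    limit at t = 0 into an integral equation. *)
Lemma J0_unique {Om} {HOm : good Om} h f : OO Om (/ 16) f ->
  (forall t th, Om t th -> is_derive (fun s => h s th) t (f t th / t)) ->
  tends0 Om h -> eq_on Om h (J 0 f).
Proof.
  assert (Hc : Rabs 0 <= 1) by (rewrite Rabs_R0; lra).
  intros Hf Hd H0 t th Ht. destruct (good_pos _ _ Ht).
  assert (Hle : Rabs (h t th - J 0 f t th) <= 0 / 1 * Rpower t 1).
  { apply (est_decay (fun s => h s th - J 0 f s th) (fun _ => 0)); [lra|lra| |].
    - intros s Hs. assert (Om s th) by (eapply Om_vert; eauto). split.
      + evar_last; [apply @is_derive_minus; [apply Hd; auto|apply J_dt; auto]|].
        unfold minus, plus, opp; simpl. ring.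
      + rewrite Rabs_R0. right. unfold Rdiv; ring.
    - assert (Hm : tends0 Om (fun t th => h t th + - J 0 f t th)).
      { apply tends0_plus; auto. apply (tends0_OO (/ 16)); [lra|]. apply OO_opp, J_OO; auto; lra. }
      exact (Hm t th Ht). }
  unfold Rdiv in Hle. rewrite !Rmult_0_l in Hle. pose proof (Rabs_pos (h t th - J 0 f t th)).
  assert (h t th - J 0 f t th = 0) by (apply Rabs_eq_0; lra). lra.
Qed.

Lemma geometric_lim (a : nat -> R) K q : 0 <= q < 1 ->
  (forall j, Rabs (a (S j) - a j) <= K * q ^ j) ->
  forall j, Rabs (real (Lim_seq a) - a j) <= K / (1 - q) * q ^ j.
Proof.
  intros Hq H.
  assert (HK : 0 <= K).
  { specialize (H 0%nat). simpl in H. pose proof (Rabs_pos (a 1%nat - a 0%nat)). lra. }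
  assert (Hm : forall j m, Rabs (a (m + j)%nat - a j) <= K / (1 - q) * (q ^ j - q ^ (m + j))).
  { intros j m; induction m as [|m IH]; simpl.
    - rewrite !Rminus_diag, Rabs_R0, Rmult_0_r. lra.
    - replace (a (S (m + j)) - a j) with ((a (S (m + j)) - a (m + j)%nat) + (a (m + j)%nat - a j)) by ring.
      eapply Rle_trans; [apply Rabs_triang|]. specialize (H (m + j)%nat).
      replace (K / (1 - q) * (q ^ j - q * q ^ (m + j))) with
        (K * q ^ (m + j) + K / (1 - q) * (q ^ j - q ^ (m + j))) by (field; lra). lra. }
  assert (HK' : 0 <= K / (1 - q)) by (apply Rdiv_le_0_compat; lra).
  assert (Hm' : forall j m, Rabs (a (m + j)%nat - a j) <= K / (1 - q) * q ^ j).
  { intros j m. eapply Rle_trans; [apply Hm|]. apply Rmult_le_compat_l; auto.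
    assert (0 <= q ^ (m + j)) by (apply pow_le; lra). lra. }
  assert (Hq0 : is_lim_seq (fun j => K / (1 - q) * q ^ j) 0).
  { evar_last; [apply is_lim_seq_scal_l, is_lim_seq_geom; rewrite Rabs_right; lra|].
    simpl. f_equal; ring. }
  assert (Hex : ex_finite_lim_seq a).
  { apply ex_lim_seq_cauchy_corr. intros eps. apply is_lim_seq_spec in Hq0.
    destruct (Hq0 (pos_div_2 eps)) as [N HN]. exists N. intros n m Hn Hm2.
    specialize (HN N (Nat.le_refl _)). rewrite Rminus_0_r in HN. simpl in HN.
    pose proof (Rle_abs (K / (1 - q) * q ^ N)).
    pose proof (Hm' N (n - N)%nat) as E1. replace (n - N + N)%nat with n in E1 by lia.
    pose proof (Hm' N (m - N)%nat) as E2. replace (m - N + N)%nat with m in E2 by lia.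
    replace (a n - a m) with ((a n - a N) + - (a m - a N)) by ring.
    eapply Rle_lt_trans; [apply Rabs_triang|]. rewrite Rabs_Ropp. lra. }
  apply Lim_seq_correct' in Hex. intros j.
  assert (Hl : is_lim_seq (fun m => Rabs (a (m + j)%nat - a j)) (Rabs (real (Lim_seq a) - a j))).
  { apply (is_lim_seq_abs (fun m => a (m + j)%nat - a j) (Finite (real (Lim_seq a) - a j))).
    apply (is_lim_seq_minus' (fun m => a (m + j)%nat) (fun _ => a j)); [|apply is_lim_seq_const].
    apply (is_lim_seq_incr_n a j); auto. }
  refine (is_lim_seq_le _ (fun _ => K / (1 - q) * q ^ j) _ (K / (1 - q) * q ^ j) _ Hl (is_lim_seq_const _)).
  intros m; apply Hm'.
Qed.

Lemma pow_small K q eps : 0 <= q < 1 -> 0 < eps -> exists j, K * q ^ j < eps.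
Proof.
  intros Hq He.
  assert (Hq0 : is_lim_seq (fun j => K * q ^ j) 0).
  { evar_last; [apply is_lim_seq_scal_l, is_lim_seq_geom; rewrite Rabs_right; lra|].
    simpl. f_equal; ring. }
  apply is_lim_seq_spec in Hq0. destruct (Hq0 (mkposreal _ He)) as [N HN].
  exists N. specialize (HN N (Nat.le_refl _)). rewrite Rminus_0_r in HN. simpl in HN.
  eapply Rle_lt_trans; [apply Rle_abs|auto].
Qed.

(** * Limits and the Picard iteration *)

Section Limits.
Context {Om : R -> R -> Prop} {HOm : good Om}.

Lemma Rpower_le_1 t th mu : 0 <= mu -> Om t th -> Rpower t mu <= 1.
Proof.
  intros Hmu H. rewrite <- (Rpower_0_1 t th H). apply Rpower_le_exp; auto.
  eapply good_pos; eauto.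
Qed.

Lemma dthn_minus n : forall f g, sm Om f -> sm Om g ->
  eq_on Om (dthn n (fun t th => f t th - g t th)) (fun t th => dthn n f t th - dthn n g t th).
Proof.
  intros f g Hf Hg. induction n as [|n IH]; [intros t th _; auto|].
  intros t th Ht. simpl. rewrite (dth_ext _ _ IH t th Ht).
  apply (@dth_minus Om); auto; apply sm_dthn; auto.
Qed.

Lemma bnd_dthn n : forall mu C f, bnd Om n 1 mu C f ->
  forall t th, Om t th -> Rabs (dthn n f t th) <= C * Rpower t mu.
Proof.
  induction n as [|n IH]; intros mu C f H t th Ht.
  - apply H; auto.
  - destruct H as (C1 & C2 & H1 & H2 & H3). rewrite <- dthn_S.
    eapply Rle_trans; [apply (IH mu C2); auto|].
    apply Rmult_le_compat_r; [left; apply Rpower_pos|]. apply bnd_pos in H1; lra.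
Qed.

Lemma OO_dthn_bound mu f : OO Om mu f -> forall n, exists C, 0 <= C /\
  forall t th, Om t th -> Rabs (dthn n f t th) <= C * Rpower t mu.
Proof.
  intros H n. destruct (H n) as [C HC]. exists C; split; [eapply bnd_pos; eauto; lra|].
  apply bnd_dthn; auto.
Qed.

(** Each derivative has its own limit [W n]. Uniform convergence identifies [W (S n)] as the
    derivative of [W n], and the geometric bounds carry the weight t^mu over to the limit. *)
Lemma OO_lim mu (w : nat -> R -> R -> R) : 0 <= mu -> (forall j, OO Om mu (w j)) ->
  (forall n, exists C q, 0 <= C /\ 0 <= q < 1 /\ forall j t th, Om t th ->
     Rabs (dthn n (w (S j)) t th - dthn n (w j) t th) <= C * q ^ j * Rpower t mu) ->
  OO Om mu (fun t th => real (Lim_seq (fun j => w j t th))).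
Proof.
  intros Hmu Hw Hq.
  set (W := fun n t th => real (Lim_seq (fun j => dthn n (w j) t th))).
  assert (Hb : forall n, exists C q, 0 <= C /\ 0 <= q < 1 /\ forall j t th, Om t th ->
     Rabs (W n t th - dthn n (w j) t th) <= C * q ^ j * Rpower t mu).
  { intros n. destruct (Hq n) as (C & q & HC & Hq1 & H). exists (C / (1 - q)), q.
    repeat split; try tauto; [apply Rdiv_le_0_compat; lra|].
    intros j t th Ht.
    replace (C / (1 - q) * q ^ j * Rpower t mu) with ((C * Rpower t mu) / (1 - q) * q ^ j)
      by (field; lra).
    apply (geometric_lim (fun j => dthn n (w j) t th)); auto.
    intros i. rewrite (Rmult_comm _ (q ^ i)), <- Rmult_assoc, (Rmult_comm _ C). auto. }
  assert (Hu : forall n eps, 0 < eps -> exists N, forall j, (N <= j)%nat -> forall t th, Om t th ->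
     Rabs (W n t th - dthn n (w j) t th) < eps).
  { intros n eps He. destruct (Hb n) as (C & q & HC & Hq1 & H).
    destruct (pow_small C q eps Hq1 He) as [N HN]. exists N. intros j Hj t th Ht.
    eapply Rle_lt_trans; [apply H; auto|].
    pose proof (Rpower_le_1 t th mu Hmu Ht). pose proof (Rpower_pos t mu).
    assert (q ^ j <= q ^ N).
    { replace j with (N + (j - N))%nat by lia. rewrite pow_add.
      assert (q ^ (j - N) <= 1) by (rewrite <- (pow1 (j - N)); apply pow_incr; lra).
      assert (0 <= q ^ N) by (apply pow_le; lra). nra. }
    assert (0 <= q ^ j) by (apply pow_le; lra).
    assert (0 <= C * q ^ j) by (apply Rmult_le_pos; auto).
    assert (C * q ^ j <= C * q ^ N) by (apply Rmult_le_compat_l; auto). nra. }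
  assert (Hd : forall n t th, Om t th -> is_derive (W n t) th (W (S n) t th)).
  { intros n t th Ht. destruct (loc_th t th Ht) as [d Hd].
    pose (D := fun x => Rabs (x - th) < d).
    assert (HD : forall x, D x -> Om t x) by (intros x Hx; apply Hd; exact Hx).
    apply (CVU_Derive (fun j x => dthn n (w j) t x) D).
    - intros x Hx. unfold D in *.
      assert (0 < d - Rabs (x - th)) by lra.
      exists (mkposreal _ H). intros y Hy. unfold ball in Hy; simpl in Hy.
      unfold AbsRing_ball, abs, minus, plus, opp in Hy; simpl in Hy.
      replace (y - th) with ((y + - x) + (x - th)) by ring.
      eapply Rle_lt_trans; [apply Rabs_triang|]. lra.
    - intros x y z Hx Hy Hz. unfold D in *. apply Rabs_lt_between in Hx. apply Rabs_lt_between in Hy.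
      apply Rabs_lt_between. lra.
    - intros eps. destruct (Hu n eps (cond_pos eps)) as [N HN]. exists N. intros j Hj x Hx.
      rewrite Rabs_minus_sym. apply HN; auto.
    - intros j x Hx. apply (@sm_ex Om); auto. apply sm_dthn. eapply OO_sm; eauto.
    - intros j x Hx. apply continuity_pt_filterlim.
      apply (c2_pt2 (dthn (S n) (w j))). apply (@sm_c Om); auto. apply sm_dthn. eapply OO_sm; eauto.
    - intros eps. destruct (Hu (S n) eps (cond_pos eps)) as [N HN]. exists N. intros j Hj x Hx.
      rewrite Rabs_minus_sym. apply HN; auto.
    - unfold D. rewrite Rminus_diag, Rabs_R0. apply cond_pos. }
  assert (Hc : forall n t th, Om t th -> continuity_2d_pt (W n) t th).
  { intros n t th Ht eps. pose proof (cond_pos eps).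
    destruct (Hu n (eps / 3) ltac:(lra)) as [N HN]. specialize (HN N (Nat.le_refl _)).
    assert (Hcj : continuity_2d_pt (dthn n (w N)) t th).
    { apply (@sm_c Om); auto. apply sm_dthn. eapply OO_sm; eauto. }
    assert (He : 0 < eps / 3) by lra.
    generalize (locally_2d_and _ _ _ _ (good_open _ _ Ht) (Hcj (mkposreal _ He))).
    apply locally_2d_impl, locally_2d_forall. simpl. intros u v [A B].
    pose proof (HN u v A) as E1. pose proof (HN t th Ht) as E2.
    replace (W n u v - W n t th) with ((W n u v - dthn n (w N) u v)
      + ((dthn n (w N) u v - dthn n (w N) t th) + - (W n t th - dthn n (w N) t th))) by ring.
    eapply Rle_lt_trans; [apply Rabs_triang|]. eapply Rle_lt_trans.
    { apply Rplus_le_compat_l, Rabs_triang. }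
    rewrite Rabs_Ropp. lra. }
  assert (Hon : forall n, eq_on Om (dthn n (W 0%nat)) (W n)).
  { induction n as [|n IH]; [intros t th _; auto|].
    intros t th Ht. simpl. rewrite (dth_ext _ _ IH t th Ht). apply is_derive_unique, Hd; auto. }
  change (OO Om mu (W 0%nat)).
  assert (Hs : forall m n, smn Om m (W n)).
  { induction m as [|m IH]; intros n.
    - intros t th Ht; apply Hc; auto.
    - split; [intros t th Ht; split; [apply Hc; auto|eexists; apply Hd; auto]|].
      eapply smn_ext; [|apply (IH (S n))].
      intros t th Ht; symmetry; apply is_derive_unique, Hd; auto. }
  apply OO_of_dthn; [intros m; apply Hs|].
  intros n. destruct (OO_dthn_bound _ _ (Hw 0%nat) n) as (C & HC & H1).
  destruct (Hb n) as (D & q & HD & _ & H2). exists (C + D). split; [lra|].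
  intros t th Ht. rewrite Hon by auto. specialize (H1 t th Ht). specialize (H2 0%nat t th Ht).
  simpl in H2. rewrite Rmult_1_r in H2.
  replace (W n t th) with (dthn n (w 0%nat) t th + (W n t th - dthn n (w 0%nat) t th)) by ring.
  eapply Rle_trans; [apply Rabs_triang|]. lra.
Qed.

(* Since |.|_n tends to the sup norm as e tends to 0, a map that contracts in the sup norm
   contracts in every |.|_n on the same domain, for suitable e = e(n). *)
Lemma picard {riemann_idx : Type} (ok : riemann_idx -> Prop) (c : riemann_idx -> R)
  (G : (riemann_idx -> R -> R -> R) -> riemann_idx -> R -> R -> R) (lam A C0 rho : R) :
  (forall i, Rabs (c i) <= 1) -> 0 <= A < lam -> / 16 <= lam -> 0 <= C0 ->
  C0 <= (lam - A) * rho ->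
  (forall w, (forall i, ok i -> OO Om lam (w i)) -> forall i, ok i -> OO Om lam (G w i)) ->
  (forall n, exists e, 0 < e <= 1 /\
     (forall i, ok i -> bnd Om n e lam C0 (G (fun _ _ _ => 0) i)) /\
     forall w w' d, 0 <= d ->
       (forall i, ok i -> bnd Om n e lam rho (w i) /\ bnd Om n e lam rho (w' i) /\
          bnd Om n e lam d (fun t th => w i t th - w' i t th)) ->
       forall i, ok i -> bnd Om n e lam (A * d) (fun t th => G w i t th - G w' i t th)) ->
  exists w, forall i, ok i -> OO Om lam (w i) /\ eq_on Om (w i) (J (c i) (G w i)).
Proof.
  intros Hc HA Hlam HC0 Hrho HG Hcon.
  set (q := A / lam).
  assert (Hq : 0 <= q < 1).
  { unfold q; split; [apply Rdiv_le_0_compat; lra|]. apply Rlt_div_l; lra. }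
  assert (Hr : C0 / lam <= rho * (1 - q)).
  { replace (rho * (1 - q)) with ((lam - A) * rho / lam) by (unfold q; field; lra).
    apply Rmult_le_compat_r; auto. left; apply Rinv_0_lt_compat; lra. }
  assert (HC0l : 0 <= C0 / lam) by (apply Rdiv_le_0_compat; lra).
  assert (Hrho0 : 0 <= rho) by nra.
  set (w := fix w (j : nat) : riemann_idx -> R -> R -> R :=
    match j with O => fun _ _ _ => 0 | S j => fun i => J (c i) (G (w j) i) end).
  assert (Hw : forall j i, ok i -> OO Om lam (w j i)).
  { induction j as [|j IH]; intros i Hi; simpl; [apply OO_zero|]. apply J_OO; auto. }
  assert (HGw : forall j i, ok i -> OO Om (/ 16) (G (w j) i)).
  { intros j i Hi. eapply OO_weak; [apply Hlam|]. apply HG; auto. }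
  (* The radius rho (1 - q^j) grows by rho (1 - q) q^j, which dominates the j-th increment by [Hr].
     Hence no iterate leaves the ball of radius rho, on which the contraction is assumed. *)
  assert (Hcv : forall n, exists e, 0 < e <= 1 /\ forall j i, ok i ->
    bnd Om n e lam (rho * (1 - q ^ j)) (w j i) /\
    bnd Om n e lam (C0 / lam * q ^ j) (fun t th => w (S j) i t th - w j i t th)).
  { intros n. destruct (Hcon n) as (e & He & H0 & HL). exists e; split; auto.
    induction j as [|j IH]; intros i Hi.
    - split.
      + simpl. rewrite Rminus_diag, Rmult_0_r. apply bnd_const0.
      + replace (C0 / lam * q ^ 0) with (C0 / lam) by (simpl; ring).
        apply bnd_ext with (w 1%nat i); [intros t th _; simpl; ring|].
        apply J_bnd; auto; try lra. apply (HGw 0%nat); auto.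
    - assert (HS : forall i, ok i -> bnd Om n e lam (rho * (1 - q ^ S j)) (w (S j) i)).
      { intros k Hk. destruct (IH k Hk) as [I1 I2].
        apply bnd_weak with (rho * (1 - q ^ j) + C0 / lam * q ^ j).
        - assert (0 <= q ^ j) by (apply pow_le; lra). simpl.
          assert (C0 / lam * q ^ j <= rho * (1 - q) * q ^ j) by (apply Rmult_le_compat_r; auto). lra.
        - eapply bnd_ext; [|apply (bnd_plus _ _ _ _ _ _ _ I1 I2)]. intros t th _. ring. }
      split; [apply HS; auto|].
      assert (Hle : forall m, rho * (1 - q ^ m) <= rho).
      { intros m. assert (0 <= q ^ m) by (apply pow_le; lra). nra. }
      apply bnd_ext with (J (c i) (fun t th => G (w (S j)) i t th - G (w j) i t th)).
      { apply J_minus; auto. }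
      replace (C0 / lam * q ^ S j) with (A * (C0 / lam * q ^ j) / lam) by (unfold q; simpl; field; lra).
      apply J_bnd; auto; [|lra|].
      + eapply OO_weak; [apply Hlam|]. apply OO_minus; apply HG; auto.
      + apply HL; auto.
        * apply Rmult_le_pos; auto. apply pow_le; lra.
        * intros k Hk. destruct (IH k Hk) as [I1 I2]. repeat split; auto.
          -- eapply bnd_weak; [apply Hle|auto].
          -- eapply bnd_weak; [apply Hle|eauto]. }
  set (W := fun i t th => real (Lim_seq (fun j => w j i t th))).
  assert (HW : forall i, ok i -> OO Om lam (W i)).
  { intros i Hi. apply (OO_lim lam (fun j => w j i)); [lra|auto|].
    intros n. destruct (Hcv n) as (e & He & Hj). exists (C0 / lam / e ^ n), q.
    assert (0 < e ^ n) by (apply pow_lt; lra).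
    split; [apply Rdiv_le_0_compat; auto|]. split; auto. intros j t th Ht.
    rewrite <- dthn_minus; auto; try (eapply OO_sm; eauto).
    replace (C0 / lam / e ^ n * q ^ j) with (C0 / lam * q ^ j / e ^ n) by (field; lra).
    apply bnd_dthn; auto. apply bnd_rescale; auto. apply Hj; auto. }
  exists W. intros i Hi. split; auto.
  (* The fixed-point identity is pointwise, so order 0 is enough. At that order the norm does not
     depend on the weight, and [e] here and [e'] below need not agree. *)
  destruct (Hcv 0%nat) as (e & He & Hj).
  set (K := C0 / lam / (1 - q)).
  assert (HK : 0 <= K <= rho).
  { unfold K; split; [apply Rdiv_le_0_compat; lra|]. apply Rle_div_l; lra. }
  assert (HWj : forall j k, ok k -> forall t th, Om t th ->
    Rabs (W k t th - w j k t th) <= K * q ^ j * Rpower t lam).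
  { intros j k Hk t th Ht.
    replace (K * q ^ j * Rpower t lam) with (C0 / lam * Rpower t lam / (1 - q) * q ^ j)
      by (unfold K; field; lra).
    apply (geometric_lim (fun j => w j k t th)); auto. intros m.
    destruct (Hj m k Hk) as [_ (_ & _ & H)].
    rewrite Rmult_assoc, (Rmult_comm (Rpower _ _)), <- Rmult_assoc. apply (H t th Ht). }
  destruct (Hcon 0%nat) as (e' & He' & _ & HL).
  intros t th Ht. apply cond_eq. intros eps Heps.
  assert (HJ : forall j, Rabs (W i t th - J (c i) (G W i) t th)
    <= (K + A * K / lam) * q ^ j).
  { intros j.
    assert (Hqj : 0 <= q ^ j) by (apply pow_le; lra).
    pose proof (HWj (S j) i Hi t th Ht) as E1.
    assert (E2 : Rabs (J (c i) (fun t th => G (w j) i t th - G W i t th) t th)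
       <= A * (K * q ^ j) / lam * Rpower t lam).
    { apply J_bound0; auto; [|lra|].
      - eapply OO_weak; [apply Hlam|]. apply OO_minus; apply HG; auto.
      - apply (HL (w j) W); auto.
        + apply Rmult_le_pos; lra.
        + intros k Hk. destruct (Hj j k Hk) as [(B1 & B2 & B3) _]. repeat split; auto.
          * intros u v Hu. eapply Rle_trans; [apply B3; auto|].
            apply Rmult_le_compat_r; [left; apply Rpower_pos|]. nra.
          * eapply OO_sm; eauto.
          * intros u v Hu. pose proof (HWj 0%nat k Hk u v Hu) as E3. simpl in E3.
            rewrite Rminus_0_r, Rmult_1_r in E3. pose proof (Rpower_pos u lam). nra.
          * apply sm_minus; eapply OO_sm; eauto.
          * apply Rmult_le_pos; lra.
          * intros u v Hu. rewrite Rabs_minus_sym. apply HWj; auto. }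
    rewrite (J_minus (c i) (Hc i)) in E2; auto.
    2: { eapply OO_weak; [apply Hlam|]. apply HG; auto. }
    change (J (c i) (G (w j) i) t th) with (w (S j) i t th) in E2.
    pose proof (Rpower_le_1 t th lam ltac:(lra) Ht). pose proof (Rpower_pos t lam).
    replace (W i t th - J (c i) (G W i) t th) with ((W i t th - w (S j) i t th) +
       (w (S j) i t th - J (c i) (G W i) t th)) by ring.
    eapply Rle_trans; [apply Rabs_triang|].
    assert (K * q ^ S j * Rpower t lam <= K * q ^ j).
    { assert (0 <= K * q ^ j) by (apply Rmult_le_pos; lra). simpl.
      assert (K * (q * q ^ j) <= K * q ^ j) by nra.
      assert (0 <= q * q ^ j) by (apply Rmult_le_pos; lra).
      assert (0 <= K * (q * q ^ j)) by (apply Rmult_le_pos; lra). nra. }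
    assert (A * (K * q ^ j) / lam * Rpower t lam <= A * K / lam * q ^ j).
    { replace (A * K / lam * q ^ j) with (A * (K * q ^ j) / lam) by (field; lra).
      assert (0 <= K * q ^ j) by (apply Rmult_le_pos; lra).
      assert (0 <= A * (K * q ^ j)) by (apply Rmult_le_pos; lra).
      assert (0 <= A * (K * q ^ j) / lam) by (apply Rdiv_le_0_compat; lra). nra. }
    lra. }
  destruct (pow_small (K + A * K / lam) q eps Hq Heps) as [j Hjj].
  eapply Rle_lt_trans; [apply (HJ j)|auto].
Qed.

End Limits.

(** * Finite sums over the components *)

Lemma sumI_closed (P : (R -> R -> R) -> Prop) N (f : nat -> R -> R -> R) :
  P (fun _ _ => 0) -> (forall f g, P f -> P g -> P (fun t th => f t th + g t th)) ->
  (forall J, (J < N)%nat -> P (f J)) -> P (fun t th => sumI N (fun J => f J t th)).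
Proof.
  intros H0 Hp H. unfold sumI.
  assert (Hl : forall J, In J (List.seq 0 N) -> P (f J)).
  { intros J HJ. apply in_seq in HJ. apply H; lia. }
  revert Hl. generalize (List.seq 0 N). induction l as [|j l IH]; intros Hl; simpl; auto.
  apply (Hp (f j) (fun t th => fold_right (fun i acc => f i t th + acc) 0 l)).
  - apply Hl; left; auto.
  - apply IH. intros; apply Hl; right; auto.
Qed.

Lemma sumI_is_derive N (f : nat -> R -> R) (l : nat -> R) x :
  (forall J, (J < N)%nat -> is_derive (f J) x (l J)) ->
  is_derive (fun s => sumI N (fun J => f J s)) x (sumI N l).
Proof.
  intros H. unfold sumI.
  assert (Hl : forall J, In J (List.seq 0 N) -> is_derive (f J) x (l J)).
  { intros J HJ. apply in_seq in HJ. apply H; lia. }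
  revert Hl. generalize (List.seq 0 N). induction l0 as [|j l' IH]; intros Hl; simpl.
  - apply @is_derive_const.
  - apply @is_derive_plus; [apply Hl; left; auto|apply IH; intros; apply Hl; right; auto].
Qed.

Lemma sumI_ext N f g : (forall J, (J < N)%nat -> f J = g J) -> sumI N f = sumI N g.
Proof.
  intros H. unfold sumI.
  assert (Hl : forall J, In J (List.seq 0 N) -> f J = g J).
  { intros J HJ. apply in_seq in HJ. apply H; lia. }
  revert Hl. generalize (List.seq 0 N). induction l as [|j l' IH]; intros Hl; simpl; auto.
  rewrite Hl, IH; auto; [intros; apply Hl; right; auto|left; auto].
Qed.

Lemma sumI_lin N a b f g : sumI N (fun J => a * f J + b * g J) = a * sumI N f + b * sumI N g.
Proof.
  unfold sumI. generalize (List.seq 0 N). induction l as [|j l' IH]; simpl; [ring|].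
  rewrite IH; ring.
Qed.

Lemma sumI_minus N f g : sumI N (fun J => f J - g J) = sumI N f - sumI N g.
Proof.
  replace (sumI N f - sumI N g) with (1 * sumI N f + (-1) * sumI N g) by ring.
  rewrite <- sumI_lin. apply sumI_ext; intros; ring.
Qed.

Lemma sumI_plus N f g : sumI N (fun J => f J + g J) = sumI N f + sumI N g.
Proof.
  replace (sumI N f + sumI N g) with (1 * sumI N f + 1 * sumI N g) by ring.
  rewrite <- sumI_lin. apply sumI_ext; intros; ring.
Qed.

Lemma sumI_scal N a f : sumI N (fun J => a * f J) = a * sumI N f.
Proof.
  replace (a * sumI N f) with (a * sumI N f + 0 * sumI N f) by ring.
  rewrite <- sumI_lin. apply sumI_ext; intros; ring.
Qed.

Lemma fin_bound N (P : nat -> R -> Prop) :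
  (forall I C D, C <= D -> P I C -> P I D) ->
  (forall I, (I < N)%nat -> exists C, P I C) -> exists C, forall I, (I < N)%nat -> P I C.
Proof.
  intros Hm. induction N as [|N IH]; intros H; [exists 0; lia|].
  destruct IH as [C HC]; [intros; apply H; lia|]. destruct (H N) as [D HD]; [lia|].
  exists (Rmax C D). intros I HI. destruct (Nat.eq_dec I N) as [->|].
  - eapply Hm; [apply Rmax_r|auto].
  - eapply Hm; [apply Rmax_l|apply HC; lia].
Qed.

(* A state collects, in this order, the reduced unknowns v = DP - p0, x = dP/dtheta,
   z = t^(-k) e^(-(P + P_I)) DQ and y = t^k e^(-(P + P_I)) dQ/dtheta. *)
Record state := mkstate { sv : nat -> R -> R -> R; sx : nat -> R -> R -> R;
                    sz : nat -> R -> R -> R; sy : nat -> R -> R -> R }.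

Ltac split4 := refine (conj _ (conj _ (conj _ _))).

(** * The Fuchsian form of the system *)

Section System.
Context {Om : R -> R -> Prop} {HOm : good Om}.
Context (N : nat) (k : nat -> R -> R).

(** Applied to the P_J this is P + P_I, the only combination through which the components of the
    system are coupled. *)
Definition SS (f : nat -> R -> R -> R) (I : nat) : R -> R -> R :=
  fun t th => sumI N (fun J => f J t th) + f I t th.

(** Obtained from the system by writing t^(2k) z^2 for e^(-2(P + P_I)) (DQ)^2 and t^(2-2k) y^2 for
    e^(-2(P + P_I)) (t Q')^2. The terms with [ln t] come from differentiating powers t^k in theta.
    The [x] row lacks p0', which is produced by the logarithm in the initial state. *)
Definition fuchs_rhs (u : state) : state := mkstate
  (fun I t th => t * t * dth (sx u I) t th
     - / 2 * (Rpower t (2 * k I th) * (sz u I t th * sz u I t th)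
              - Rpower t (2 - 2 * k I th) * (sy u I t th * sy u I t th)))
  (fun I => dth (sv u I))
  (fun I t th => Rpower t (2 - 2 * k I th) * (dth (sy u I) t th - Derive (k I) th * ln t * sy u I t th)
     + SS (sv u) I t th * sz u I t th
     - Rpower t (2 - 2 * k I th) * (SS (sx u) I t th * sy u I t th))
  (fun I t th => Rpower t (2 * k I th) * (dth (sz u I) t th + Derive (k I) th * ln t * sz u I t th)
     - SS (sv u) I t th * sy u I t th
     + Rpower t (2 * k I th) * (SS (sx u) I t th * sz u I t th)).

Definition Near4 (av ax az ay : R) (u w : state) : Prop := forall I, (I < N)%nat ->
  OO Om av (fun t th => sv u I t th - sv w I t th) /\
  OO Om ax (fun t th => sx u I t th - sx w I t th) /\
  OO Om az (fun t th => sz u I t th - sz w I t th) /\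
  OO Om ay (fun t th => sy u I t th - sy w I t th).

(** The [x] row of [fuchs_rhs] is just v' and gains no power of t. Keeping v ahead of the other
    components by 1/8 lets every pass gain 1/8 in all four. *)
Definition Near (a : R) : state -> state -> Prop := Near4 (a + / 8) a a a.

(** The exponent -1/16 leaves room for the term p0' ln t in x. *)
Definition admissible (u : state) : Prop := forall I, (I < N)%nat ->
  OO Om (/ 8) (sv u I) /\ OO Om (- / 16) (sx u I) /\ OO Om 0 (sz u I) /\ OO Om 0 (sy u I).

Lemma OO_SS mu f I : (I < N)%nat -> (forall J, (J < N)%nat -> OO Om mu (f J)) -> OO Om mu (SS f I).
Proof.
  intros HI H. apply (OO_plus mu (fun t th => sumI N (fun J => f J t th)) (f I)); auto.
  apply (sumI_closed (OO Om mu)); auto; [apply OO_zero|intros; apply OO_plus; auto].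
Qed.

Lemma OO_SS_diff mu f g I : (I < N)%nat ->
  (forall J, (J < N)%nat -> OO Om mu (fun t th => f J t th - g J t th)) ->
  OO Om mu (fun t th => SS f I t th - SS g I t th).
Proof.
  intros HI H. eapply OO_ext; [|apply (OO_SS mu (fun J t th => f J t th - g J t th) I HI H)].
  intros t th _. unfold SS. rewrite sumI_minus. ring.
Qed.

Lemma OO_dth_diff mu f g : sm Om f -> sm Om g -> OO Om mu (fun t th => f t th - g t th) ->
  OO Om mu (fun t th => dth f t th - dth g t th).
Proof.
  intros Hf Hg H. eapply OO_ext; [apply dth_minus; auto|]. apply OO_dth; auto.
Qed.

Lemma OO_mult_diff a m m' b la f f' g g' :
  OO Om a (fun t th => f t th - f' t th) -> OO Om m g -> OO Om m' f' ->
  OO Om b (fun t th => g t th - g' t th) -> la <= a + m -> la <= m' + b ->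
  OO Om la (fun t th => f t th * g t th - f' t th * g' t th).
Proof.
  intros H1 H2 H3 H4 L1 L2.
  apply (OO_ext la (fun t th => (f t th - f' t th) * g t th + f' t th * (g t th - g' t th))).
  - intros t th _; ring.
  - apply OO_plus; eapply OO_mult; eauto.
Qed.

Context (Hk : forall I, (I < N)%nat -> OO Om 0 (fun _ th => k I th)).
Context (Hkb : forall I t th, (I < N)%nat -> Om t th -> / 2 < k I th < 5 / 6).

Lemma OO_affine_k a b I : (I < N)%nat -> OO Om 0 (fun _ th => a + b * k I th).
Proof.
  intros HI. apply (OO_plus 0 (fun _ _ => a) (fun _ th => b * k I th)); [apply OO_const|].
  apply (OO_scal 0 b (fun _ th => k I th)); auto.
Qed.

(** The bound k < 5/6 gives 2 - 2k > 1/3 = 5/16 + 1/48, and the margin 1/48 pays for the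
    logarithms. *)
Lemma OO_tb I : (I < N)%nat -> OO Om (5 / 16) (fun t th => Rpower t (2 - 2 * k I th)).
Proof.
  intros HI. apply (OO_tpow (fun th => 2 - 2 * k I th) (5 / 16) (/ 48)); [|lra|].
  - eapply OO_ext; [|apply (OO_affine_k 2 (-2) I HI)]. intros t th _; ring.
  - intros t th Ht. specialize (Hkb I t th HI Ht). lra.
Qed.

Lemma OO_t2k I : (I < N)%nat -> OO Om (3 / 4) (fun t th => Rpower t (2 * k I th)).
Proof.
  intros HI. apply (OO_tpow (fun th => 2 * k I th) (3 / 4) (/ 4)); [|lra|].
  - eapply OO_ext; [|apply (OO_affine_k 0 2 I HI)]. intros t th _; ring.
  - intros t th Ht. specialize (Hkb I t th HI Ht). lra.
Qed.

Lemma OO_tt : OO Om 2 (fun t _ => t * t).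
Proof.
  eapply OO_ext; [|apply OO_Rp]. intros t th Ht. simpl.
  replace 2 with (1 + 1) by ring. rewrite Rpower_plus, Rpower_1; auto.
  eapply good_pos; eauto.
Qed.

Lemma OO_id : OO Om 1 (fun t _ => t).
Proof.
  eapply OO_ext; [|apply OO_Rp]. intros t th Ht. simpl.
  rewrite Rpower_1; auto. eapply good_pos; eauto.
Qed.

Lemma OO_kln I : (I < N)%nat -> OO Om (- / 16) (fun t th => Derive (k I) th * ln t).
Proof.
  intros HI. apply (OO_mult 0 (- / 16) (- / 16) (fun _ th => Derive (k I) th) (fun t _ => ln t)).
  - apply (OO_dth 0 (fun _ th => k I th)); auto.
  - apply OO_ln; lra.
  - lra.
Qed.

(** The v row has to gain 1/4 on the rate of y, and t^(2-2k) supplies 5/16. In the z and y rows the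
    products with v give exactly a + 1/8, either from the extra 1/8 in the difference of v or from v
    itself being O(t^(1/8)). The logarithms and x cost 1/16 each time, which the powers of t in
    front of them cover. *)
Lemma src_near a u w : admissible u -> admissible w -> Near a u w -> Near (a + / 8) (fuchs_rhs u) (fuchs_rhs w).
Proof.
  intros Cu Cw Hn I HI.
  assert (Nv : forall J, (J < N)%nat -> OO Om (a + / 8) (fun t th => sv u J t th - sv w J t th)) by apply Hn.
  assert (Nx : forall J, (J < N)%nat -> OO Om a (fun t th => sx u J t th - sx w J t th)) by apply Hn.
  destruct (Hn I HI) as (_ & _ & Nz & Ny).
  assert (Uv := OO_SS (/ 8) (sv u) I HI (fun J HJ => proj1 (Cu J HJ))).
  assert (Wv := OO_SS (/ 8) (sv w) I HI (fun J HJ => proj1 (Cw J HJ))).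
  assert (Ux := OO_SS (- / 16) (sx u) I HI (fun J HJ => proj1 (proj2 (Cu J HJ)))).
  assert (Wx := OO_SS (- / 16) (sx w) I HI (fun J HJ => proj1 (proj2 (Cw J HJ)))).
  assert (SNv := OO_SS_diff (a + / 8) (sv u) (sv w) I HI Nv).
  assert (SNx := OO_SS_diff a (sx u) (sx w) I HI Nx).
  destruct (Cu I HI) as (Uv1 & Ux1 & Uz & Uy). destruct (Cw I HI) as (Wv1 & Wx1 & Wz & Wy).
  assert (Dx := OO_dth_diff _ _ _ (OO_sm _ _ Ux1) (OO_sm _ _ Wx1) (Nx I HI)).
  assert (Dv := OO_dth_diff _ _ _ (OO_sm _ _ Uv1) (OO_sm _ _ Wv1) (Nv I HI)).
  assert (Dz := OO_dth_diff _ _ _ (OO_sm _ _ Uz) (OO_sm _ _ Wz) Nz).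
  assert (Dy := OO_dth_diff _ _ _ (OO_sm _ _ Uy) (OO_sm _ _ Wy) Ny).
  pose proof (OO_tb I HI) as Tb. pose proof (OO_t2k I HI) as T2. pose proof (OO_kln I HI) as KL.
  split; [|split; [|split]]; simpl.
  - eapply OO_ext.
    2: apply (OO_minus (a + / 8 + / 8)
      (fun t th => t * t * (dth (sx u I) t th - dth (sx w I) t th))
      (fun t th => / 2 * (Rpower t (2 * k I th) * (sz u I t th * sz u I t th - sz w I t th * sz w I t th)
         - Rpower t (2 - 2 * k I th) * (sy u I t th * sy u I t th - sy w I t th * sy w I t th)))).
    + intros t th _; simpl; ring.
    + eapply OO_mult; [apply OO_tt|exact Dx|lra].
    + apply (OO_scal _ (/ 2)). apply OO_minus.
      * eapply OO_mult; [exact T2|eapply OO_mult_diff; [exact Nz|exact Uz|exact Wz|exact Nz|apply Rle_refl|lra]|lra].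
      * eapply OO_mult; [exact Tb|eapply OO_mult_diff; [exact Ny|exact Uy|exact Wy|exact Ny|apply Rle_refl|lra]|lra].
  - exact Dv.
  - eapply OO_ext.
    2: apply (OO_minus (a + / 8)
      (fun t th => Rpower t (2 - 2 * k I th) * ((dth (sy u I) t th - dth (sy w I) t th)
          - Derive (k I) th * ln t * (sy u I t th - sy w I t th))
        + (SS (sv u) I t th * sz u I t th - SS (sv w) I t th * sz w I t th))
      (fun t th => Rpower t (2 - 2 * k I th) * (SS (sx u) I t th * sy u I t th - SS (sx w) I t th * sy w I t th))).
    + intros t th _; simpl; ring.
    + apply OO_plus.
      * eapply OO_mult; [exact Tb| |].
        -- apply (OO_minus (a - / 16)); [eapply OO_weak; [|exact Dy]; lra|].
           eapply OO_mult; [exact KL|exact Ny|lra].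
        -- lra.
      * eapply OO_mult_diff; [exact SNv|exact Uz|exact Wv|exact Nz|lra|lra].
    + eapply OO_mult; [exact Tb|eapply (OO_mult_diff a 0 (- / 16) a (a - / 16)); [exact SNx|exact Uy|exact Wx|exact Ny|lra|lra]|lra].
  - eapply OO_ext.
    2: apply (OO_plus (a + / 8)
      (fun t th => Rpower t (2 * k I th) * ((dth (sz u I) t th - dth (sz w I) t th)
          + Derive (k I) th * ln t * (sz u I t th - sz w I t th))
        - (SS (sv u) I t th * sy u I t th - SS (sv w) I t th * sy w I t th))
      (fun t th => Rpower t (2 * k I th) * (SS (sx u) I t th * sz u I t th - SS (sx w) I t th * sz w I t th))).
    + intros t th _; simpl; ring.
    + apply OO_minus.
      * eapply OO_mult; [exact T2| |].
        -- apply (OO_plus (a - / 16)); [eapply OO_weak; [|exact Dz]; lra|].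
           eapply OO_mult; [exact KL|exact Nz|lra].
        -- lra.
      * eapply OO_mult_diff; [exact SNv|exact Uy|exact Wv|exact Ny|lra|lra].
    + eapply OO_mult; [exact T2|eapply (OO_mult_diff a 0 (- / 16) a (a - / 16)); [exact SNx|exact Uz|exact Wx|exact Nz|lra|lra]|lra].
Qed.

Definition zero_state : state := mkstate (fun _ _ _ => 0) (fun _ _ _ => 0) (fun _ _ _ => 0) (fun _ _ _ => 0).

Definition In4 (av ax az ay : R) (u : state) : Prop := forall I, (I < N)%nat ->
  OO Om av (sv u I) /\ OO Om ax (sx u I) /\ OO Om az (sz u I) /\ OO Om ay (sy u I).

Lemma In4_weak av ax az ay bv bx bz By u : bv <= av -> bx <= ax -> bz <= az -> By <= ay ->
  In4 av ax az ay u -> In4 bv bx bz By u.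
Proof.
  intros H1 H2 H3 H4 H I HI. destruct (H I HI) as (A1 & A2 & A3 & A4).
  split4; eapply OO_weak; eauto.
Qed.

Lemma src_In u : admissible u -> In4 (3 / 16) (/ 16) (/ 16) (/ 16) (fuchs_rhs u).
Proof.
  intros Cu.
  assert (C0 : admissible zero_state) by (intros I HI; split4; apply OO_zero).
  (* Comparison with the zero state turns the estimate for differences into one for sizes. The rate
     -1/16 is the one that the logarithm in [sx] permits; one pass makes it 1/16. *)
  assert (Hn : Near (- / 16) u zero_state).
  { intros I HI. destruct (Cu I HI) as (A1 & A2 & A3 & A4). simpl.
    split4; (eapply OO_ext; [intros t th _; symmetry; apply Rminus_0_r|]);
      [eapply OO_weak; [|exact A1]|eapply OO_weak; [|exact A2]|eapply OO_weak; [|exact A3]|eapply OO_weak; [|exact A4]]; lra. }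
  intros I HI. destruct (src_near _ _ _ Cu C0 Hn I HI) as (B1 & B2 & B3 & B4).
  assert (Hz : forall t th, dth (fun _ _ => 0) t th = 0) by (intros; unfold dth; apply Derive_const).
  assert (HS : forall t th, SS (fun _ _ _ => 0) I t th = 0).
  { intros t th. unfold SS. rewrite (sumI_ext N _ (fun _ => 0 * 0)), sumI_scal; [ring|intros; ring]. }
  split4.
  - eapply OO_weak; [|eapply OO_ext; [|apply B1]]; [lra|].
    intros t th _; simpl. rewrite Hz. ring.
  - eapply OO_weak; [|eapply OO_ext; [|apply B2]]; [lra|].
    intros t th _; simpl. rewrite Hz. ring.
  - eapply OO_weak; [|eapply OO_ext; [|apply B3]]; [lra|].
    intros t th _; simpl. rewrite Hz, !HS. ring.
  - eapply OO_weak; [|eapply OO_ext; [|apply B4]]; [lra|].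
    intros t th _; simpl. rewrite Hz, !HS. ring.
Qed.

Definition J_state (u : state) : state := mkstate (fun I => J 0 (sv u I)) (fun I => J 0 (sx u I))
  (fun I => J 0 (sz u I)) (fun I => J 0 (sy u I)).

Definition add_state (u w : state) : state := mkstate (fun I t th => sv u I t th + sv w I t th)
  (fun I t th => sx u I t th + sx w I t th) (fun I t th => sz u I t th + sz w I t th)
  (fun I t th => sy u I t th + sy w I t th).

Definition eq_state (u w : state) : Prop := forall I, (I < N)%nat ->
  eq_on Om (sv u I) (sv w I) /\ eq_on Om (sx u I) (sx w I) /\
  eq_on Om (sz u I) (sz w I) /\ eq_on Om (sy u I) (sy w I).

Lemma Rabs_0_le_1 : Rabs 0 <= 1.
Proof. rewrite Rabs_R0; lra. Qed.

Lemma JJ_In av ax az ay u : / 16 <= av -> / 16 <= ax -> / 16 <= az -> / 16 <= ay ->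
  In4 av ax az ay u -> In4 av ax az ay (J_state u).
Proof.
  intros ? ? ? ? H I HI. destruct (H I HI) as (A1 & A2 & A3 & A4).
  split4; apply (J_OO 0 Rabs_0_le_1); auto.
Qed.

Lemma JJ_near av ax az ay u w : / 16 <= av -> / 16 <= ax -> / 16 <= az -> / 16 <= ay ->
  In4 (/ 16) (/ 16) (/ 16) (/ 16) u -> In4 (/ 16) (/ 16) (/ 16) (/ 16) w ->
  Near4 av ax az ay u w -> Near4 av ax az ay (J_state u) (J_state w).
Proof.
  intros ? ? ? ? Hu Hw H I HI. destruct (H I HI) as (A1 & A2 & A3 & A4).
  destruct (Hu I HI) as (B1 & B2 & B3 & B4). destruct (Hw I HI) as (C1 & C2 & C3 & C4).
  split4; (eapply OO_ext; [apply (J_minus 0 Rabs_0_le_1); auto|]); apply (J_OO 0 Rabs_0_le_1); auto.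
Qed.

Lemma Near4_add av ax az ay u0 u w : Near4 av ax az ay u w ->
  Near4 av ax az ay (add_state u0 u) (add_state u0 w).
Proof.
  intros H I HI. destruct (H I HI) as (A1 & A2 & A3 & A4).
  split4; (eapply OO_ext; [|eauto]); intros t th _; simpl; ring.
Qed.

Lemma Near4_ext av ax az ay u w u' w' : eq_state u u' -> eq_state w w' ->
  Near4 av ax az ay u w -> Near4 av ax az ay u' w'.
Proof.
  intros Hu Hw H I HI. destruct (H I HI) as (A1 & A2 & A3 & A4).
  destruct (Hu I HI) as (B1 & B2 & B3 & B4). destruct (Hw I HI) as (C1 & C2 & C3 & C4).
  split4; (eapply OO_ext; [|eauto]); intros t th Ht; cbv beta;
    (rewrite B1, C1 || rewrite B2, C2 || rewrite B3, C3 || rewrite B4, C4); auto.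
Qed.

Lemma onst_refl u : eq_state u u.
Proof. intros I HI; split4; intros t th _; auto. Qed.

Context (u0 : state) (Hu0 : forall I t th, sv u0 I t th = 0) (Cu0 : admissible u0).

Definition fixed_point (u : state) : Prop := eq_state u (add_state u0 (J_state (fuchs_rhs u))).

Fixpoint iterate (n : nat) : state := match n with O => u0 | S n => add_state u0 (J_state (fuchs_rhs (iterate n))) end.

Lemma In4_JJsrc u : admissible u -> In4 (3 / 16) (/ 16) (/ 16) (/ 16) (J_state (fuchs_rhs u)).
Proof. intros Cu. apply JJ_In; try lra. apply src_In; auto. Qed.

Lemma Cls_add u : In4 (/ 8) 0 0 0 u -> admissible (add_state u0 u).
Proof.
  intros H I HI. destruct (H I HI) as (A1 & A2 & A3 & A4). destruct (Cu0 I HI) as (B1 & B2 & B3 & B4).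
  split4; simpl; apply OO_plus; auto. eapply OO_weak; eauto. lra.
Qed.

Lemma iterate_admissible n : admissible (iterate n).
Proof.
  induction n as [|n IH]; simpl; auto. apply Cls_add.
  eapply In4_weak; [| | | |apply In4_JJsrc; auto]; lra.
Qed.

Lemma src_In16 u : admissible u -> In4 (/ 16) (/ 16) (/ 16) (/ 16) (fuchs_rhs u).
Proof. intros Cu. eapply In4_weak; [| | | |apply src_In; auto]; lra. Qed.

Lemma iterate_near n : Near (INR n / 8) (iterate (S n)) (iterate n).
Proof.
  induction n as [|n IH].
  - intros I HI. destruct (In4_JJsrc u0 Cu0 I HI) as (A1 & A2 & A3 & A4).
    simpl. unfold Rdiv. rewrite Rmult_0_l, Rplus_0_l.
    split4; [apply (OO_weak (3 / 16)); [lra|]; apply (OO_ext _ _ _ (fun t th _ => eq_sym (Rplus_minus_l _ _)) A1)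
      |apply (OO_weak (/ 16)); [lra|]; apply (OO_ext _ _ _ (fun t th _ => eq_sym (Rplus_minus_l _ _)) A2)
      |apply (OO_weak (/ 16)); [lra|]; apply (OO_ext _ _ _ (fun t th _ => eq_sym (Rplus_minus_l _ _)) A3)
      |apply (OO_weak (/ 16)); [lra|]; apply (OO_ext _ _ _ (fun t th _ => eq_sym (Rplus_minus_l _ _)) A4)].
  - assert (0 <= INR n) by apply pos_INR. rewrite S_INR.
    change (iterate (S (S n))) with (add_state u0 (J_state (fuchs_rhs (iterate (S n))))).
    change (iterate (S n)) with (add_state u0 (J_state (fuchs_rhs (iterate n)))) at 2.
    apply Near4_add, JJ_near; try lra; try apply src_In16; try apply iterate_admissible.
    replace ((INR n + 1) / 8) with (INR n / 8 + / 8) by field.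
    apply src_near; auto; apply iterate_admissible.
Qed.

Lemma FP_near u w : admissible u -> admissible w -> fixed_point u -> fixed_point w -> forall n, Near (INR n / 8) u w.
Proof.
  intros Cu Cw Fu Fw. induction n as [|n IH].
  - apply (Near4_ext _ _ _ _ (add_state u0 (J_state (fuchs_rhs u))) (add_state u0 (J_state (fuchs_rhs w)))).
    + intros I HI; destruct (Fu I HI) as (?&?&?&?); split4; apply on_sym; auto.
    + intros I HI; destruct (Fw I HI) as (?&?&?&?); split4; apply on_sym; auto.
    + apply Near4_add. intros I HI.
      destruct (In4_JJsrc u Cu I HI) as (A1 & A2 & A3 & A4).
      destruct (In4_JJsrc w Cw I HI) as (B1 & B2 & B3 & B4).
      simpl. unfold Rdiv. rewrite Rmult_0_l, Rplus_0_l.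
      split4; apply OO_minus; (eapply OO_weak; [|eauto]); lra.
  - assert (0 <= INR n) by apply pos_INR. rewrite S_INR.
    apply (Near4_ext _ _ _ _ (add_state u0 (J_state (fuchs_rhs u))) (add_state u0 (J_state (fuchs_rhs w)))).
    + intros I HI; destruct (Fu I HI) as (?&?&?&?); split4; apply on_sym; auto.
    + intros I HI; destruct (Fw I HI) as (?&?&?&?); split4; apply on_sym; auto.
    + apply Near4_add, JJ_near; try lra; try apply src_In16; auto.
      replace ((INR n + 1) / 8) with (INR n / 8 + / 8) by field.
      apply src_near; auto.
Qed.

End System.

Arguments Near4 Om N av ax az ay u w : clear implicits.
Arguments Near Om N a u w : clear implicits.
Arguments admissible Om N u : clear implicits.
Arguments In4 Om N av ax az ay u : clear implicits.
Arguments eq_state Om N u w : clear implicits.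
Arguments fixed_point Om N k u0 u : clear implicits.

(** * Triangular domains and restriction to smaller domains *)

Definition triangle (c r t th : R) : Prop := 0 < t /\ Rabs (th - c) + t < r.

Lemma tri_good c r : r <= 1 -> good (triangle c r).
Proof.
  intros Hr. split.
  - intros t th [H1 H2].
    assert (Hd : 0 < Rmin (t / 2) ((r - Rabs (th - c) - t) / 3)) by (apply Rmin_pos; lra).
    exists (mkposreal _ Hd). simpl. intros u v Hu Hv.
    pose proof (Rmin_l (t / 2) ((r - Rabs (th - c) - t) / 3)).
    pose proof (Rmin_r (t / 2) ((r - Rabs (th - c) - t) / 3)).
    apply Rabs_lt_between in Hu. split; [lra|].
    replace (v - c) with ((v - th) + (th - c)) by ring.
    pose proof (Rabs_triang (v - th) (th - c)). lra.
  - intros t th [H1 H2]. pose proof (Rabs_pos (th - c)). lra.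
  - intros t th s th' [H1 H2] Hs H. split; [lra|].
    replace (th' - c) with ((th' - th) + (th - c)) by ring.
    pose proof (Rabs_triang (th' - th) (th - c)). lra.
  - exists (Rabs c + 1). intros t th [H1 H2].
    replace th with ((th - c) + c) by ring. pose proof (Rabs_triang (th - c) c). lra.
Qed.

Lemma tri_sub c r r' t th : r <= r' -> triangle c r t th -> triangle c r' t th.
Proof. unfold triangle; lra. Qed.

Lemma tri_t c r t th : triangle c r t th -> 0 < t <= r.
Proof. intros [H1 H2]. pose proof (Rabs_pos (th - c)). lra. Qed.

Section Restrict.
Context {Om0 Om : R -> R -> Prop} (Hsub : forall t th, Om t th -> Om0 t th).

Lemma smn_sub n : forall f, smn Om0 n f -> smn Om n f.
Proof.
  induction n as [|n IH]; intros f; simpl; [auto|]. intros [H1 H2]; split; auto.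
Qed.

Lemma sm_sub f : sm Om0 f -> sm Om f.
Proof. intros H n; apply smn_sub; auto. Qed.

Lemma bnd_sub n : forall e mu C f, bnd Om0 n e mu C f -> bnd Om n e mu C f.
Proof.
  induction n as [|n IH]; intros e mu C f.
  - intros (H1 & H2 & H3). split; [apply sm_sub; auto|split; auto].
  - intros (C1 & C2 & H1 & H2 & H3). exists C1, C2; auto.
Qed.

Lemma OO_sub mu f : OO Om0 mu f -> OO Om mu f.
Proof. intros H n; destruct (H n) as [C HC]; exists C; apply bnd_sub; auto. Qed.

Lemma Cls_sub N u : admissible Om0 N u -> admissible Om N u.
Proof. intros H I HI. destruct (H I HI) as (?&?&?&?). split4; apply OO_sub; auto. Qed.
End Restrict.

(** On the triangle t <= r, so surplus decay t^(mu - nu) becomes the factor r^(mu - nu). Shrinking r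
    makes a decaying function small without changing the weight [e]. *)
Lemma bnd_exp_tri c r n : r <= 1 -> forall e mu nu C f, nu <= mu ->
  bnd (triangle c r) n e mu C f -> bnd (triangle c r) n e nu (C * Rpower r (mu - nu)) f.
Proof.
  intros Hr. induction n as [|n IH]; intros e mu nu C f H.
  - intros (H1 & H2 & H3). pose proof (Rpower_pos r (mu - nu)).
    split; auto. split; [nra|].
    intros t th Ht. eapply Rle_trans; [apply H3; auto|]. rewrite Rmult_assoc.
    apply Rmult_le_compat_l; auto. replace mu with ((mu - nu) + nu) at 1 by ring.
    rewrite Rpower_plus. apply Rmult_le_compat_r; [left; apply Rpower_pos|].
    apply Rpower_le_base; [eapply tri_t; eauto|lra].
  - intros (C1 & C2 & H1 & H2 & H3). exists (C1 * Rpower r (mu - nu)), (C2 * Rpower r (mu - nu)).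
    repeat split; auto. pose proof (Rpower_pos r (mu - nu)). nra.
Qed.

(** * The hyperbolic form and the remainder *)

Section Hyperbolic.
Context {Om : R -> R -> Prop} {HOm : good Om}.
Context (N : nat) (k dp0 : nat -> R -> R).

Lemma is_derive_on f g t th l : eq_on Om f g -> Om t th ->
  is_derive (fun s => g s th) t l -> is_derive (fun s => f s th) t l.
Proof.
  intros H Ht. apply is_derive_ext_loc. generalize (on_loc_t _ _ t th H Ht).
  apply filter_imp. auto.
Qed.

(** The equation D f = g together with differentiability in t, in the form h' = g/t that [est_decay]
    and [J0_unique] work with. *)
Definition hasD (Om : R -> R -> Prop) (f g : R -> R -> R) : Prop :=
  forall t th, Om t th -> is_derive (fun s => f s th) t (g t th / t).

Lemma hasD_on f f' g g' : eq_on Om f f' -> eq_on Om g g' -> hasD Om f' g' -> hasD Om f g.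
Proof.
  intros H1 H2 H t th Ht. rewrite H2 by auto. eapply is_derive_on; eauto.
Qed.

Lemma hasD_plus f g f' g' : hasD Om f f' -> hasD Om g g' ->
  hasD Om (fun t th => f t th + g t th) (fun t th => f' t th + g' t th).
Proof.
  intros H1 H2 t th Ht. evar_last; [apply @is_derive_plus; [apply H1|apply H2]; auto|].
  unfold plus; simpl. unfold Rdiv; ring.
Qed.

Lemma hasD_scal c f f' : hasD Om f f' -> hasD Om (fun t th => c * f t th) (fun t th => c * f' t th).
Proof.
  intros H1 t th Ht. evar_last; [apply (is_derive_scal (fun s => f s th)); apply H1; auto|].
  unfold Rdiv; ring.
Qed.

Lemma hasD_minus f g f' g' : hasD Om f f' -> hasD Om g g' ->
  hasD Om (fun t th => f t th - g t th) (fun t th => f' t th - g' t th).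
Proof.
  intros H1 H2 t th Ht. evar_last; [apply @is_derive_minus; [apply H1|apply H2]; auto|].
  unfold minus, plus, opp; simpl. unfold Rdiv; ring.
Qed.

Lemma hasD_mult f g f' g' : hasD Om f f' -> hasD Om g g' ->
  hasD Om (fun t th => f t th * g t th) (fun t th => f' t th * g t th + f t th * g' t th).
Proof.
  intros H1 H2 t th Ht.
  evar_last; [apply (is_derive_mult (fun s => f s th) (fun s => g s th));
    [apply H1; auto|apply H2; auto|intros; apply Rmult_comm]|].
  unfold plus, mult; simpl. unfold Rdiv; ring.
Qed.

Lemma hasD_exp f f' : hasD Om f f' ->
  hasD Om (fun t th => exp (f t th)) (fun t th => f' t th * exp (f t th)).
Proof.
  intros H1 t th Ht.
  evar_last; [apply (is_derive_comp exp (fun s => f s th)); [apply is_derive_exp|apply H1; auto]|].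
  unfold scal; simpl; unfold mult; simpl. unfold Rdiv; ring.
Qed.

Lemma hasD_ln : hasD Om (fun t _ => ln t) (fun _ _ => 1).
Proof.
  intros t th Ht. destruct (good_pos _ _ Ht). evar_last; [apply is_derive_ln; auto|].
  unfold Rdiv; ring.
Qed.

Lemma hasD_th (g : R -> R) : hasD Om (fun _ th => g th) (fun _ _ => 0).
Proof.
  intros t th Ht. evar_last; [apply @is_derive_const|]. unfold zero; simpl. unfold Rdiv; ring.
Qed.

Lemma hasD_tpow a : hasD Om (fun t th => Rpower t (a th)) (fun t th => a th * Rpower t (a th)).
Proof.
  intros t th Ht. destruct (good_pos _ _ Ht).
  evar_last; [apply is_derive_Reals, derivable_pt_lim_power; auto|].
  unfold Rminus. rewrite Rpower_plus, Rpower_Ropp, Rpower_1 by auto. unfold Rdiv; ring.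
Qed.

Lemma hasD_id : hasD Om (fun t _ => t) (fun t _ => t).
Proof.
  intros t th Ht. destruct (good_pos _ _ Ht). evar_last; [apply @is_derive_id|].
  unfold one; simpl. field; lra.
Qed.

Lemma hasD_J0 f : OO Om (/ 16) f -> hasD Om (J 0 f) f.
Proof.
  intros Hf t th Ht. evar_last; [apply (J_dt 0 Rabs_0_le_1 f Hf); auto|]. ring.
Qed.

Lemma hasD_SS f f' I : (I < N)%nat -> (forall J, (J < N)%nat -> hasD Om (f J) (f' J)) ->
  hasD Om (SS N f I) (SS N f' I).
Proof.
  intros HI H t th Ht. unfold SS.
  evar_last; [apply @is_derive_plus;
    [apply (sumI_is_derive N (fun J s => f J s th)); intros J HJ; apply H; auto|apply H; auto]|].
  unfold plus; simpl. unfold Rdiv. rewrite Rmult_plus_distr_r. f_equal.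
  rewrite Rmult_comm, <- sumI_scal. apply sumI_ext; intros; ring.
Qed.

Lemma dth_SS f I t th : (I < N)%nat -> Om t th -> (forall J, (J < N)%nat -> sm Om (f J)) ->
  dth (SS N f I) t th = SS N (fun J => dth (f J)) I t th.
Proof.
  intros HI Ht H. apply is_derive_unique. unfold SS. apply @is_derive_plus.
  - apply (sumI_is_derive N (fun J s => f J t s)). intros J HJ. apply (@sm_is Om); auto.
  - apply (@sm_is Om); auto.
Qed.

(* The unknowns V = v, X = t x, Z = t^k z, Y = t^(1-k) y satisfy the semilinear symmetric
   hyperbolic system  DV = t X' + F_V, DX = t V' + F_X, DZ = t Y' + F_Z, DY = t Z' + F_Y. *)
Definition hyp (u : state) : state := mkstate (sv u) (fun I t th => t * sx u I t th)
  (fun I t th => Rpower t (k I th) * sz u I t th)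
  (fun I t th => Rpower t (1 - k I th) * sy u I t th).

(** The linear terms X, k Z and (1 - k) Y stem from the scaling by t, t^k and t^(1-k). The
    inhomogeneity t p0' restores the term that is missing from [fuchs_rhs]. *)
Definition hyp_rhs (U : state) : state := mkstate
  (fun I t th => - / 2 * (sz U I t th * sz U I t th - sy U I t th * sy U I t th))
  (fun I t th => sx U I t th + t * dp0 I th)
  (fun I t th => k I th * sz U I t th + SS N (sv U) I t th * sz U I t th
     - SS N (sx U) I t th * sy U I t th)
  (fun I t th => (1 - k I th) * sy U I t th - SS N (sv U) I t th * sy U I t th
     + SS N (sx U) I t th * sz U I t th).

Lemma bnd_SS n e mu C f I : 0 <= e -> (I < N)%nat -> (forall J, (J < N)%nat -> bnd Om n e mu C (f J)) ->
  bnd Om n e mu ((INR N + 1) * C) (SS N f I).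
Proof.
  intros He HI H. rewrite Rmult_plus_distr_r, Rmult_1_l. apply bnd_plus; auto.
  unfold sumI.
  assert (Hl : forall J, In J (List.seq 0 N) -> bnd Om n e mu C (f J)).
  { intros J HJ. apply in_seq in HJ. apply H; lia. }
  revert Hl. replace (INR N) with (INR (length (List.seq 0 N))) by (rewrite length_seq; auto). generalize (List.seq 0 N).
  induction l as [|j l IH]; intros Hl.
  - simpl. rewrite Rmult_0_l. apply bnd_const0.
  - cbn [length fold_right]. rewrite S_INR, Rmult_plus_distr_r, Rmult_1_l, Rplus_comm.
    apply (bnd_plus n e mu C _ (f j) (fun t th => fold_right (fun i acc => f i t th + acc) 0 l)).
    + apply Hl; left; auto.
    + apply IH; intros; apply Hl; right; auto.
Qed.

Lemma bnd_mult_diff n e lam C d f f' g g' : 0 <= e ->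
  bnd Om n e 0 C g -> bnd Om n e 0 C f' ->
  bnd Om n e lam d (fun t th => f t th - f' t th) ->
  bnd Om n e lam d (fun t th => g t th - g' t th) ->
  bnd Om n e lam (2 * (C * d)) (fun t th => f t th * g t th - f' t th * g' t th).
Proof.
  intros He H1 H2 H3 H4.
  apply bnd_ext with (fun t th => g t th * (f t th - f' t th) + f' t th * (g t th - g' t th)).
  { intros t th _; simpl; ring. }
  replace (2 * (C * d)) with (C * d + C * d) by ring.
  apply bnd_plus; rewrite <- (Rplus_0_l lam); apply bnd_mult; auto.
Qed.

Definition B4 (n : nat) (e mu C : R) (u : state) : Prop := forall I, (I < N)%nat ->
  bnd Om n e mu C (sv u I) /\ bnd Om n e mu C (sx u I) /\
  bnd Om n e mu C (sz u I) /\ bnd Om n e mu C (sy u I).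

Definition sub_state (u w : state) : state := mkstate (fun I t th => sv u I t th - sv w I t th)
  (fun I t th => sx u I t th - sx w I t th) (fun I t th => sz u I t th - sz w I t th)
  (fun I t th => sy u I t th - sy w I t th).

(** For states of size [kap] the quadratic terms have Lipschitz constants proportional to [kap],
    where N + 1 counts the summands of [SS]. Only the linear terms keep constants that do not shrink
    with the domain. *)
Lemma FF_diff n e kap K lam d a b : 0 <= e ->
  (forall I, (I < N)%nat -> bnd Om n e 0 K (fun _ th => k I th) /\
     bnd Om n e 0 K (fun _ th => 1 - k I th)) ->
  B4 n e 0 kap a -> B4 n e 0 kap b -> B4 n e lam d (sub_state a b) ->
  forall I, (I < N)%nat ->
    bnd Om n e lam (2 * (kap * d)) (sv (sub_state (hyp_rhs a) (hyp_rhs b)) I) /\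
    bnd Om n e lam d (sx (sub_state (hyp_rhs a) (hyp_rhs b)) I) /\
    bnd Om n e lam (K * d + 4 * ((INR N + 1) * (kap * d))) (sz (sub_state (hyp_rhs a) (hyp_rhs b)) I) /\
    bnd Om n e lam (K * d + 4 * ((INR N + 1) * (kap * d))) (sy (sub_state (hyp_rhs a) (hyp_rhs b)) I).
Proof.
  intros He Hk Ha Hb Hd I HI.
  destruct (Ha I HI) as (A1 & A2 & A3 & A4). destruct (Hb I HI) as (B1 & B2 & B3 & B4).
  destruct (Hd I HI) as (D1 & D2 & D3 & D4). destruct (Hk I HI) as (K1 & K2).
  simpl in D1, D2, D3, D4.
  assert (Sa : bnd Om n e 0 ((INR N + 1) * kap) (SS N (sv a) I)) by (apply bnd_SS; auto; intros; apply Ha; auto).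
  assert (Sb : bnd Om n e 0 ((INR N + 1) * kap) (SS N (sv b) I)) by (apply bnd_SS; auto; intros; apply Hb; auto).
  assert (Xb : bnd Om n e 0 ((INR N + 1) * kap) (SS N (sx b) I)) by (apply bnd_SS; auto; intros; apply Hb; auto).
  assert (Sd : bnd Om n e lam ((INR N + 1) * d) (fun t th => SS N (sv a) I t th - SS N (sv b) I t th)).
  { eapply bnd_ext; [|apply (bnd_SS n e lam d (sv (sub_state a b)) I); auto; intros; apply Hd; auto].
    intros t th _. unfold SS; simpl. rewrite sumI_minus. ring. }
  assert (Xd : bnd Om n e lam ((INR N + 1) * d) (fun t th => SS N (sx a) I t th - SS N (sx b) I t th)).
  { eapply bnd_ext; [|apply (bnd_SS n e lam d (sx (sub_state a b)) I); auto; intros; apply Hd; auto].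
    intros t th _. unfold SS; simpl. rewrite sumI_minus. ring. }
  assert (M : forall f f' g g', bnd Om n e 0 kap g -> bnd Om n e 0 ((INR N + 1) * kap) f' ->
     bnd Om n e lam ((INR N + 1) * d) (fun t th => f t th - f' t th) ->
     bnd Om n e lam d (fun t th => g t th - g' t th) ->
     bnd Om n e lam (2 * ((INR N + 1) * (kap * d))) (fun t th => f t th * g t th - f' t th * g' t th)).
  { intros f f' g g' H1 H2 H3 H4.
    apply bnd_ext with (fun t th => g t th * (f t th - f' t th) + f' t th * (g t th - g' t th)).
    { intros t th _; simpl; ring. }
    replace (2 * ((INR N + 1) * (kap * d))) with (kap * ((INR N + 1) * d) + (INR N + 1) * kap * d) by ring.
    apply bnd_plus; rewrite <- (Rplus_0_l lam); apply bnd_mult; auto. }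
  split4; simpl.
  - apply bnd_ext with (fun t th => (- / 2) * ((sz a I t th * sz a I t th - sz b I t th * sz b I t th)
      - (sy a I t th * sy a I t th - sy b I t th * sy b I t th))).
    { intros t th _; simpl; ring. }
    replace (2 * (kap * d)) with (Rabs (- / 2) * (2 * (kap * d) + 2 * (kap * d)))
      by (rewrite Rabs_left by lra; field).
    apply (bnd_scal n e lam _ (- / 2)). apply bnd_minus; apply bnd_mult_diff; auto.
  - eapply bnd_ext; [|exact D2]. intros t th _; simpl; ring.
  - apply bnd_ext with (fun t th => k I th * (sz a I t th - sz b I t th) +
      ((SS N (sv a) I t th * sz a I t th - SS N (sv b) I t th * sz b I t th)
       - (SS N (sx a) I t th * sy a I t th - SS N (sx b) I t th * sy b I t th))).
    { intros t th _; simpl; ring. }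
    replace (4 * ((INR N + 1) * (kap * d))) with
      (2 * ((INR N + 1) * (kap * d)) + 2 * ((INR N + 1) * (kap * d))) by ring.
    apply bnd_plus; [rewrite <- (Rplus_0_l lam); apply (bnd_mult n e 0 lam K d (fun _ th => k I th)); auto|].
    apply bnd_minus; apply M; auto.
  - apply bnd_ext with (fun t th => (1 - k I th) * (sy a I t th - sy b I t th) +
      ((SS N (sx a) I t th * sz a I t th - SS N (sx b) I t th * sz b I t th)
       - (SS N (sv a) I t th * sy a I t th - SS N (sv b) I t th * sy b I t th))).
    { intros t th _; simpl; ring. }
    replace (4 * ((INR N + 1) * (kap * d))) with
      (2 * ((INR N + 1) * (kap * d)) + 2 * ((INR N + 1) * (kap * d))) by ring.
    apply bnd_plus; [rewrite <- (Rplus_0_l lam); apply (bnd_mult n e 0 lam K d (fun _ th => 1 - k I th)); auto|].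
    apply bnd_minus; apply M; auto.
Qed.

Context (Hk : forall I, (I < N)%nat -> OO Om 0 (fun _ th => k I th)).

(** Everything reduces to t^k t^(1-k) = t and to the logarithms from differentiating t^k and
    t^(1-k). The identities hold for arbitrary admissible states, not only for solutions, so they
    serve for the approximate solution as well as for the corrected one. *)
Lemma hyp_identities u I t th : (I < N)%nat -> Om t th -> admissible Om N u ->
  t * dth (sx (hyp u) I) t th + sv (hyp_rhs (hyp u)) I t th = sv (fuchs_rhs N k u) I t th /\
  t * dth (sv (hyp u) I) t th + sx (hyp_rhs (hyp u)) I t th
    = t * (sx u I t th + sx (fuchs_rhs N k u) I t th + dp0 I th) /\
  t * dth (sy (hyp u) I) t th + sz (hyp_rhs (hyp u)) I t th
    = k I th * sz (hyp u) I t th + Rpower t (k I th) * sz (fuchs_rhs N k u) I t th /\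
  t * dth (sz (hyp u) I) t th + sy (hyp_rhs (hyp u)) I t th
    = (1 - k I th) * sy (hyp u) I t th + Rpower t (1 - k I th) * sy (fuchs_rhs N k u) I t th.
Proof.
  intros HI Ht Cu. destruct (good_pos _ _ Ht) as [H0 _].
  destruct (Cu I HI) as (C1 & C2 & C3 & C4).
  assert (Sk : sm Om (fun _ th => k I th)) by (eapply OO_sm; eauto).
  assert (Sk1 : sm Om (fun _ th => 1 - k I th)).
  { apply (sm_minus (fun _ _ => 1) (fun _ th => k I th)); auto. apply sm_const. }
  assert (E1 : Rpower t (2 - 2 * k I th) = Rpower t (1 - k I th) * Rpower t (1 - k I th))
    by (rewrite <- Rpower_plus; f_equal; ring).
  assert (E2 : Rpower t (2 * k I th) = Rpower t (k I th) * Rpower t (k I th))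
    by (rewrite <- Rpower_plus; f_equal; ring).
  assert (E3 : Rpower t (k I th) * Rpower t (1 - k I th) = t).
  { rewrite <- Rpower_plus. replace (k I th + (1 - k I th)) with 1 by ring. apply Rpower_1; auto. }
  assert (ES : SS N (fun J t th => t * sx u J t th) I t th = t * SS N (sx u) I t th).
  { unfold SS. rewrite sumI_scal. ring. }
  split4; simpl.
  - assert (Ed : dth (fun t th => t * sx u I t th) t th = t * dth (sx u I) t th)
      by (unfold dth; apply Derive_scal).
    rewrite Ed, E1, E2. ring.
  - ring.
  - rewrite ES.
    rewrite (dth_mult (fun t th => Rpower t (1 - k I th)) (sy u I)
       (sm_tpow (fun th => 1 - k I th) Sk1) (OO_sm _ _ C4) t th Ht).
    rewrite (dth_tpow (fun th => 1 - k I th) Sk1 t th Ht).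
    replace (Derive (fun th => 1 - k I th) th) with (- Derive (k I) th).
    2: { symmetry. apply is_derive_unique. evar_last.
         - apply @is_derive_minus; [apply is_derive_const|]. apply (sm_is _ Sk t th Ht).
         - unfold minus, plus, opp, zero; simpl. unfold dth. rewrite Rplus_0_l. auto. }
    rewrite E1. set (a := Rpower t (k I th)) in *. set (b := Rpower t (1 - k I th)) in *.
    transitivity (a * b * b * (dth (sy u I) t th - Derive (k I) th * ln t * sy u I t th)
      + k I th * (a * sz u I t th) + SS N (sv u) I t th * (a * sz u I t th)
      - a * b * b * (SS N (sx u) I t th * sy u I t th)); [rewrite E3; ring|ring].
  - rewrite ES.
    rewrite (dth_mult (fun t th => Rpower t (k I th)) (sz u I)
       (sm_tpow (fun th => k I th) Sk) (OO_sm _ _ C3) t th Ht).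
    rewrite (dth_tpow (k I) Sk t th Ht).
    rewrite E2. set (a := Rpower t (k I th)) in *. set (b := Rpower t (1 - k I th)) in *.
    transitivity (a * b * a * (dth (sz u I) t th + Derive (k I) th * ln t * sz u I t th)
      + (1 - k I th) * (b * sy u I t th) - SS N (sv u) I t th * (b * sy u I t th)
      + a * b * a * (SS N (sx u) I t th * sz u I t th)); [rewrite E3; ring|ring].
Qed.

Context (u0 : state) (Hu0 : forall I t th, sv u0 I t th = 0).
Context (Du0 : forall I, (I < N)%nat -> hasD Om (sx u0 I) (fun _ th => dp0 I th) /\
  hasD Om (sz u0 I) (fun _ _ => 0) /\ hasD Om (sy u0 I) (fun _ _ => 0)).

(** The source [g] is left free: for a fixed point it is [fuchs_rhs] of [u] itself, for an iterate
    it is [fuchs_rhs] of the preceding one. *)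
Lemma step_hasD u g : eq_state Om N u (add_state u0 (J_state g)) -> In4 Om N (/ 16) (/ 16) (/ 16) (/ 16) g ->
  forall I, (I < N)%nat -> hasD Om (sv u I) (sv g I) /\
    hasD Om (sx u I) (fun t th => dp0 I th + sx g I t th) /\
    hasD Om (sz u I) (sz g I) /\ hasD Om (sy u I) (sy g I).
Proof.
  intros Hu Hg I HI. destruct (Hu I HI) as (U1 & U2 & U3 & U4).
  destruct (Hg I HI) as (G1 & G2 & G3 & G4). destruct (Du0 I HI) as (D2 & D3 & D4).
  split4.
  - eapply hasD_on; [| |apply (hasD_J0 _ G1)]; [|intros t th _; auto].
    intros t th Ht. rewrite U1 by auto. simpl. rewrite Hu0. ring.
  - eapply hasD_on; [apply U2| |apply (hasD_plus _ _ _ _ D2 (hasD_J0 _ G2))]. intros t th _; auto.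
  - eapply hasD_on; [apply U3| |apply (hasD_plus _ _ _ _ D3 (hasD_J0 _ G3))]. intros t th _; simpl; ring.
  - eapply hasD_on; [apply U4| |apply (hasD_plus _ _ _ _ D4 (hasD_J0 _ G4))]. intros t th _; simpl; ring.
Qed.

(** The converse direction: the differential equations fix u - u0 up to a constant on each vertical
    line, and closeness to [u0] at t = 0 makes that constant 0. *)
Lemma FP_intro om u : 0 < om -> In4 Om N (/ 16) (/ 16) (/ 16) (/ 16) (fuchs_rhs N k u) ->
  Near4 Om N om om om om u u0 ->
  (forall I, (I < N)%nat -> hasD Om (sv u I) (sv (fuchs_rhs N k u) I) /\
    hasD Om (sx u I) (fun t th => dp0 I th + sx (fuchs_rhs N k u) I t th) /\
    hasD Om (sz u I) (sz (fuchs_rhs N k u) I) /\ hasD Om (sy u I) (sy (fuchs_rhs N k u) I)) ->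
  fixed_point Om N k u0 u.
Proof.
  intros Hom Hg Hn Hd I HI. destruct (Hg I HI) as (G1 & G2 & G3 & G4).
  destruct (Hn I HI) as (N1 & N2 & N3 & N4). destruct (Hd I HI) as (D1 & D2 & D3 & D4).
  destruct (Du0 I HI) as (E2 & E3 & E4).
  assert (M : forall f f0 g g0, OO Om (/ 16) g -> OO Om om (fun t th => f t th - f0 t th) ->
     hasD Om f (fun t th => g0 t th + g t th) -> hasD Om f0 g0 ->
     eq_on Om f (fun t th => f0 t th + J 0 g t th)).
  { intros f f0 g g0 H1 H2 H3 H4 t th Ht.
    enough (f t th - f0 t th = J 0 g t th) by lra.
    apply (J0_unique (fun t th => f t th - f0 t th) g H1); auto.
    - apply (hasD_on (fun t th => f t th - f0 t th) (fun t th => f t th - f0 t th) g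
        (fun t th => g0 t th + g t th - g0 t th)); [intros ? ? _; auto|intros ? ? _; ring|].
      apply hasD_minus; auto.
    - apply (tends0_OO om); auto. }
  split4; simpl.
  - apply (M _ _ _ (fun _ _ => 0)); auto.
    + eapply hasD_on; [| |apply D1]; intros t th _; [auto|simpl; ring].
    + apply (hasD_on _ (fun _ _ => 0) _ (fun _ _ => 0)); [intros ? ? _; auto|intros ? ? _; auto|].
      apply (hasD_th (fun _ => 0)).
  - apply (M _ _ _ (fun _ th => dp0 I th)); auto.
  - apply (M _ _ _ (fun _ _ => 0)); auto.
    eapply hasD_on; [| |apply D3]; intros t th _; [auto|simpl; ring].
  - apply (M _ _ _ (fun _ _ => 0)); auto.
    eapply hasD_on; [| |apply D4]; intros t th _; [auto|simpl; ring].
Qed.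

End Hyperbolic.

Arguments B4 Om N n e mu C u : clear implicits.

Lemma Rpower_m1 t : 0 < t -> Rpower t (- 1) = / t.
Proof.
  intros. unfold Rpower. replace (- 1 * ln t) with (- ln t) by ring.
  rewrite exp_Ropp, exp_ln; auto.
Qed.

Section Bounds.
Context {Om : R -> R -> Prop} {HOm : good Om}.
Context (N : nat) (k dp0 : nat -> R -> R).

Lemma In4_B4 mu n u : In4 Om N mu mu mu mu u -> exists C, 0 <= C /\ B4 Om N n 1 mu C u.
Proof.
  intros H.
  destruct (fin_bound N (fun I C => 0 <= C /\ bnd Om n 1 mu C (sv u I) /\ bnd Om n 1 mu C (sx u I) /\
    bnd Om n 1 mu C (sz u I) /\ bnd Om n 1 mu C (sy u I))) as [C HC].
  - intros I C D HCD (H0 & H1 & H2 & H3 & H4). split; [lra|].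
    split4; eapply bnd_weak; eauto.
  - intros I HI. destruct (H I HI) as (A1 & A2 & A3 & A4).
    destruct (A1 n) as [C1 B1], (A2 n) as [C2 B2], (A3 n) as [C3 B3], (A4 n) as [C4 B4].
    assert (P1 := bnd_pos _ _ _ _ _ Rle_0_1 B1). assert (P2 := bnd_pos _ _ _ _ _ Rle_0_1 B2).
    assert (P3 := bnd_pos _ _ _ _ _ Rle_0_1 B3). assert (P4 := bnd_pos _ _ _ _ _ Rle_0_1 B4).
    exists (C1 + C2 + C3 + C4). split; [lra|].
    split4; (eapply bnd_weak; [|eauto]); lra.
  - exists (Rabs C). split; [apply Rabs_pos|]. intros I HI.
    destruct (HC I HI) as (H0 & H1 & H2 & H3 & H4).
    rewrite Rabs_right by lra. auto.
Qed.

Lemma FF_OO lam a b : (forall I, (I < N)%nat -> OO Om 0 (fun _ th => k I th)) ->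
  In4 Om N 0 0 0 0 a -> In4 Om N 0 0 0 0 b -> In4 Om N lam lam lam lam (sub_state a b) ->
  In4 Om N lam lam lam lam (sub_state (hyp_rhs N k dp0 a) (hyp_rhs N k dp0 b)).
Proof.
  intros Hk Ha Hb Hd I HI.
  assert (M : forall n, exists C, bnd Om n 1 lam C (sv (sub_state (hyp_rhs N k dp0 a) (hyp_rhs N k dp0 b)) I) /\
     bnd Om n 1 lam C (sx (sub_state (hyp_rhs N k dp0 a) (hyp_rhs N k dp0 b)) I) /\
     bnd Om n 1 lam C (sz (sub_state (hyp_rhs N k dp0 a) (hyp_rhs N k dp0 b)) I) /\
     bnd Om n 1 lam C (sy (sub_state (hyp_rhs N k dp0 a) (hyp_rhs N k dp0 b)) I)).
  { intros n. destruct (In4_B4 0 n a Ha) as (Ca & Pa & Ba). destruct (In4_B4 0 n b Hb) as (Cb & Pb & Bb).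
    destruct (In4_B4 lam n _ Hd) as (Cd & Pd & Bd).
    assert (exists K, 0 <= K /\ forall I, (I < N)%nat -> bnd Om n 1 0 K (fun _ th => k I th) /\
       bnd Om n 1 0 K (fun _ th => 1 - k I th)) as (K & HK & BK).
    { destruct (In4_B4 0 n (mkstate (fun I _ th => k I th) (fun I _ th => 1 - k I th)
        (fun I _ th => k I th) (fun I _ th => k I th))) as (K & HK & BK).
      - intros J HJ. split4; simpl; auto.
        apply (OO_minus 0 (fun _ _ => 1) (fun _ th => k J th)); auto. apply OO_const.
      - exists K; split; auto. intros J HJ. destruct (BK J HJ) as (X1 & X2 & _); auto. }
    assert (W : forall u C D, C <= D -> B4 Om N n 1 0 C u -> B4 Om N n 1 0 D u).
    { intros u C D HCD H J HJ. destruct (H J HJ) as (?&?&?&?). split4; eapply bnd_weak; eauto. }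
    destruct (FF_diff N k dp0 n 1 (Ca + Cb) K lam Cd a b ltac:(lra) BK
       (W a Ca (Ca + Cb) ltac:(lra) Ba) (W b Cb (Ca + Cb) ltac:(lra) Bb) Bd I HI) as (D1 & D2 & D3 & D4).
    set (c1 := 2 * ((Ca + Cb) * Cd)) in *.
    set (c3 := K * Cd + 4 * ((INR N + 1) * ((Ca + Cb) * Cd))) in *.
    assert (0 <= c1) by (apply bnd_pos in D1; lra). assert (0 <= c3) by (apply bnd_pos in D3; lra).
    exists (c1 + Cd + c3).
    split4; [apply bnd_weak with c1|apply bnd_weak with Cd|apply bnd_weak with c3|apply bnd_weak with c3];
      auto; lra. }
  split4; intros n; destruct (M n) as (C & M1 & M2 & M3 & M4); exists C; auto.
Qed.

End Bounds.

(** * Solving the Fuchsian system near a point *)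

Section Existence.
Context (c r0 : R) (Hr0 : 0 < r0 <= 1).
Context (N : nat) (k dp0 : nat -> R -> R) (u0 : state).
Context (Hk : forall I, (I < N)%nat -> OO (triangle c r0) 0 (fun _ th => k I th)).
Context (Hkb : forall I t th, (I < N)%nat -> triangle c r0 t th -> / 2 < k I th < 5 / 6).
Context (Hu0 : forall I t th, sv u0 I t th = 0) (Cu0 : admissible (triangle c r0) N u0).
Context (Du0 : forall I, (I < N)%nat -> hasD (triangle c r0) (sx u0 I) (fun _ th => dp0 I th) /\
  hasD (triangle c r0) (sz u0 I) (fun _ _ => 0) /\ hasD (triangle c r0) (sy u0 I) (fun _ _ => 0)).

Local Instance good0 : good (triangle c r0) := tri_good c r0 (proj2 Hr0).

Lemma OO_tk {Om} {HOm : good Om} I : (I < N)%nat -> (forall t th, Om t th -> triangle c r0 t th) ->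
  OO Om (/ 4) (fun t th => Rpower t (k I th)) /\
  OO Om (/ 8) (fun t th => Rpower t (1 - k I th)) /\
  OO Om (- 1) (fun t th => Rpower t (- k I th)) /\
  OO Om (- 1) (fun t th => Rpower t (- (1 - k I th))).
Proof.
  intros HI Hs.
  assert (Hk' : OO Om 0 (fun _ th => k I th)) by (apply (OO_sub Hs); auto).
  assert (Hk1 : OO Om 0 (fun _ th => 1 - k I th)).
  { apply (OO_minus 0 (fun _ _ => 1) (fun _ th => k I th)); auto. apply OO_const. }
  split4.
  - apply (OO_tpow (k I) (/ 4) (/ 4)); auto; [lra|]. intros t th Ht.
    specialize (Hkb I t th HI (Hs _ _ Ht)); lra.
  - apply (OO_tpow (fun th => 1 - k I th) (/ 8) (/ 24)); auto; [lra|]. intros t th Ht.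
    specialize (Hkb I t th HI (Hs _ _ Ht)); lra.
  - apply (OO_tpow (fun th => - k I th) (- 1) (/ 6)); [apply (OO_opp 0 (fun _ th => k I th)); auto|lra|].
    intros t th Ht. specialize (Hkb I t th HI (Hs _ _ Ht)); lra.
  - apply (OO_tpow (fun th => - (1 - k I th)) (- 1) (/ 6)); [apply (OO_opp 0 (fun _ th => 1 - k I th)); auto|lra|].
    intros t th Ht. specialize (Hkb I t th HI (Hs _ _ Ht)); lra.
Qed.

Lemma hyp_In4 {Om} {HOm : good Om} u : (forall t th, Om t th -> triangle c r0 t th) -> admissible Om N u ->
  In4 Om N (/ 8) (/ 8) (/ 8) (/ 8) (hyp k u).
Proof.
  intros Hs Cu I HI. destruct (Cu I HI) as (C1 & C2 & C3 & C4).
  destruct (OO_tk I HI Hs) as (T1 & T2 & _ & _). split4; simpl; auto.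
  - eapply OO_mult; [apply OO_id|exact C2|lra].
  - eapply OO_mult; [exact T1|exact C3|lra].
  - eapply OO_mult; [exact T2|exact C4|lra].
Qed.

(* Riemann invariants: the index (true, s, I) stands for V + X or V - X,
   and (false, s, I) for Z + Y or Z - Y, according to the sign s. *)
Definition riemann_idx : Type := (bool * bool * nat)%type.
Definition valid_idx (i : riemann_idx) : Prop := (snd i < N)%nat.
(** From DV = t X' + ... and DX = t V' + ..., the sum V + X satisfies (D - t d/dtheta)(V + X) = ...,
    so the sign + belongs to speed -1. *)
Definition speed (i : riemann_idx) : R := if snd (fst i) then - 1 else 1.

Definition of_riemann (w : riemann_idx -> R -> R -> R) : state := mkstate
  (fun I t th => / 2 * (w (true, true, I) t th + w (true, false, I) t th))
  (fun I t th => / 2 * (w (true, true, I) t th - w (true, false, I) t th))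
  (fun I t th => / 2 * (w (false, true, I) t th + w (false, false, I) t th))
  (fun I t th => / 2 * (w (false, true, I) t th - w (false, false, I) t th)).

Definition riemann (u : state) (i : riemann_idx) : R -> R -> R :=
  match i with
  | (true, true, j) => fun t th => sv u j t th + sx u j t th
  | (true, false, j) => fun t th => sv u j t th - sx u j t th
  | (false, true, j) => fun t th => sz u j t th + sy u j t th
  | (false, false, j) => fun t th => sz u j t th - sy u j t th
  end.

(** If U solves the hyperbolic system up to the defect E, then U + W solves it exactly when the
    source for W is F(U + W) - F(U) - E. *)
Definition remainder_rhs (U E : state) (w : riemann_idx -> R -> R -> R) : state :=
  sub_state (sub_state (hyp_rhs N k dp0 (add_state U (of_riemann w))) (hyp_rhs N k dp0 U)) E.

Lemma remainder_exists U E : In4 (triangle c r0) N (/ 8) (/ 8) (/ 8) (/ 8) U ->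
  In4 (triangle c r0) N 4 4 4 4 E ->
  exists r w, 0 < r <= r0 /\ forall i, valid_idx i -> OO (triangle c r) 4 (w i) /\
    OO (triangle c r) 4 (riemann (remainder_rhs U E w) i) /\
    eq_on (triangle c r) (w i) (J (speed i) (riemann (remainder_rhs U E w) i)).
Proof.
  intros HU HE.
  destruct (In4_B4 N (/ 8) 0 U HU) as (CU & PU & BU).
  destruct (In4_B4 N 4 0 E HE) as (C1 & P1 & BE).
  assert (HN : 0 <= INR N) by apply pos_INR.
  (* With (N + 1) kap = 1/8 the quadratic part of the z and y rows has Lipschitz constant 1/2. The
     linear part adds 1, and a Riemann invariant combines two rows, which gives the contraction
     constant 3 < 4. *)
  set (kap := / (8 * (INR N + 1))).
  assert (Hkap : 0 < kap) by (apply Rinv_0_lt_compat; lra).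
  assert (Hkap8 : kap <= / 8) by (apply Rinv_le_contravar; lra).
  assert (HkapN : (INR N + 1) * kap = / 8) by (unfold kap; field; lra).
  (* The ball must satisfy C0 <= (4 - 3) rho. The source at w = 0 is - E, whose Riemann invariants
     are bounded by C0 = 2 (C1 + 1) once [e] is small. *)
  set (rho := 2 * C1 + 2).
  (* The radius comes from sup bounds alone: U below kap/4, and the ball of radius rho below kap/2
     once the weight t^4 is dropped. It therefore does not depend on the order n. *)
  destruct (small_Rpower CU (/ 8) (kap / 4)) as (eta1 & He1 & Hs1); [lra|lra|].
  destruct (small_Rpower rho 4 (kap / 2)) as (eta2 & He2 & Hs2); [lra|lra|].
  set (r := Rmin r0 (Rmin (eta1 / 2) (eta2 / 2))).
  assert (Hr : 0 < r) by (repeat apply Rmin_pos; lra).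
  assert (Hrr0 : r <= r0) by apply Rmin_l.
  assert (Hre : r <= Rmin (eta1 / 2) (eta2 / 2)) by apply Rmin_r.
  assert (Hr1 : r <= eta1 / 2) by (eapply Rle_trans; [apply Hre|apply Rmin_l]).
  assert (Hr2 : r <= eta2 / 2) by (eapply Rle_trans; [apply Hre|apply Rmin_r]).
  pose proof (tri_good c r ltac:(lra)) as HOm.
  assert (Hsub : forall t th, triangle c r t th -> triangle c r0 t th) by (intros; eapply tri_sub; eauto).
  assert (HU' : In4 (triangle c r) N (/ 8) (/ 8) (/ 8) (/ 8) U).
  { intros I HI. destruct (HU I HI) as (?&?&?&?). split4; apply (OO_sub Hsub); auto. }
  assert (HE' : In4 (triangle c r) N 4 4 4 4 E).
  { intros I HI. destruct (HE I HI) as (?&?&?&?). split4; apply (OO_sub Hsub); auto. }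
  assert (Hk' : forall I, (I < N)%nat -> OO (triangle c r) 0 (fun _ th => k I th)).
  { intros I HI. apply (OO_sub Hsub); auto. }
  assert (Hunp : forall w, (forall i, valid_idx i -> OO (triangle c r) 4 (w i)) -> In4 (triangle c r) N 4 4 4 4 (of_riemann w)).
  { intros w Hw I HI. split4; simpl; apply (OO_scal 4 (/ 2)); (apply OO_minus || apply OO_plus); apply Hw; exact HI. }
  assert (Hunb : forall n e mu C w, 0 <= e ->
     (forall i, valid_idx i -> bnd (triangle c r) n e mu C (w i)) -> B4 (triangle c r) N n e mu C (of_riemann w)).
  { intros n e mu C w He Hw I HI.
    replace C with (Rabs (/ 2) * (C + C)) by (rewrite Rabs_right by lra; field).
    split4; simpl; apply (bnd_scal n e mu (C + C) (/ 2)); (apply bnd_minus || apply bnd_plus); apply Hw; exact HI. }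
  exists r.
  assert (HG : forall w, (forall i, valid_idx i -> OO (triangle c r) 4 (w i)) -> forall i, valid_idx i ->
     OO (triangle c r) 4 (riemann (remainder_rhs U E w) i)).
  { intros w Hw i Hi.
    assert (HR : In4 (triangle c r) N 4 4 4 4 (remainder_rhs U E w)).
    { assert (HF : In4 (triangle c r) N 4 4 4 4 (sub_state (hyp_rhs N k dp0 (add_state U (of_riemann w))) (hyp_rhs N k dp0 U))).
      { pose proof (Hunp w Hw) as Hw'. apply FF_OO; auto.
        - intros I HI. destruct (HU' I HI) as (?&?&?&?). destruct (Hw' I HI) as (?&?&?&?).
          split4; simpl; apply OO_plus; (eapply OO_weak; [|eauto]); lra.
        - eapply In4_weak; [| | | |apply HU']; lra.
        - intros I HI. destruct (Hw' I HI) as (W1&W2&W3&W4).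
          split4; [eapply OO_ext; [|exact W1]|eapply OO_ext; [|exact W2]|eapply OO_ext; [|exact W3]|eapply OO_ext; [|exact W4]];
            intros t th _; simpl; ring. }
      intros I HI. destruct (HF I HI) as (?&?&?&?). destruct (HE' I HI) as (?&?&?&?).
      split4; apply OO_minus; auto. }
    destruct i as [[b s] I]. unfold valid_idx in Hi; simpl in Hi.
    destruct (HR I Hi) as (R1 & R2 & R3 & R4).
    destruct b, s; simpl; (apply OO_minus || apply OO_plus); auto. }
  enough (exists w, forall i, valid_idx i -> OO (triangle c r) 4 (w i) /\
    eq_on (triangle c r) (w i) (J (speed i) (riemann (remainder_rhs U E w) i))) as [w Hw].
  { exists w; split; [lra|]. intros i Hi. split; [apply Hw; auto|split; [|apply Hw; auto]].
    apply HG; auto. intros; apply Hw; auto. }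
  apply (picard valid_idx speed (fun w => riemann (remainder_rhs U E w)) 4 3 (2 * C1 + 2) rho).
  - intros [[b []] I]; unfold speed; simpl; [rewrite Rabs_left; lra|rewrite Rabs_R1; lra].
  - lra.
  - lra.
  - lra.
  - unfold rho; lra.
  - exact HG.
  - intros n.
    destruct (In4_B4 N (/ 8) n U HU') as (MU & PMU & BMU).
    destruct (In4_B4 N 4 n E HE') as (ME & PME & BME).
    destruct (In4_B4 (Om := triangle c r) N 0 n (mkstate (fun I _ th => k I th) (fun I _ th => 1 - k I th)
        (fun I _ th => k I th) (fun I _ th => k I th))) as (MK & PMK & BMK).
    { intros J HJ. split4; simpl; auto.
      apply (OO_minus 0 (fun _ _ => 1) (fun _ th => k J th)); auto. apply OO_const. }
    set (M := MU + ME + MK + 1).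
    (* With this weight [e] times each bound of order n is at most kap/4. Hence U is bounded by
       kap/4 + kap/4 in order n, and adding w, which is at most kap/2, stays within kap. *)
    set (e := kap / (4 * M)).
    assert (HM : 1 <= M) by (unfold M; lra).
    assert (He : 0 < e) by (apply Rdiv_lt_0_compat; lra).
    assert (HeM : e * M = kap / 4) by (unfold e; field; lra).
    assert (He1' : e <= 1) by nra.
    assert (HeU : e * MU <= kap / 4) by (rewrite <- HeM; unfold M; nra).
    assert (HeE : e * ME <= kap / 4) by (rewrite <- HeM; unfold M; nra).
    assert (HeK : e * MK <= kap / 4) by (rewrite <- HeM; unfold M; nra).
    exists e. split; [lra|].
    assert (EB : B4 (triangle c r) N n e 4 (C1 + 1) E).
    { intros I HI. destruct (BE I HI) as (E1 & E2 & E3 & E4). destruct (BME I HI) as (F1 & F2 & F3 & F4).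
      split4; (apply bnd_weak with (C1 + e * ME); [lra|]); apply bnd_small_e; auto; try lra; apply (bnd_sub Hsub); auto. }
    assert (UB : B4 (triangle c r) N n e 0 (kap / 2) U).
    { assert (Q : forall f, bnd (triangle c r0) 0 1 (/ 8) CU f -> bnd (triangle c r) n 1 (/ 8) MU f ->
         bnd (triangle c r) n e 0 (kap / 2) f).
      { intros f X1 X2. apply bnd_weak with (kap / 4 + e * MU); [lra|].
        apply bnd_small_e; [lra| |eapply bnd_exp_weak; [|eauto]; lra].
        apply (bnd_sub Hsub) in X1.
        apply (bnd_exp_tri c r 0 ltac:(lra) 1 (/ 8) 0) in X1; [|lra].
        rewrite Rminus_0_r in X1. eapply bnd_weak; [|exact X1]. apply Hs1; lra. }
      intros I HI. destruct (BU I HI) as (E1 & E2 & E3 & E4). destruct (BMU I HI) as (F1 & F2 & F3 & F4).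
      split4; apply Q; auto. }
    assert (KB : forall I, (I < N)%nat -> bnd (triangle c r) n e 0 1 (fun _ th => k I th) /\
       bnd (triangle c r) n e 0 1 (fun _ th => 1 - k I th)).
    { intros I HI. destruct (BMK I HI) as (F1 & F2 & _ & _). simpl in F1, F2.
      (* Both k and 1 - k lie below 5/6, and e MK <= kap/4 <= 1/32 keeps the norm of order n below
         1. *)
      split; (apply bnd_weak with (5 / 6 + e * MK); [lra|]); (apply bnd_small_e; [lra| |auto]);
        (split; [eapply bnd_sm; eauto|split; [lra|]]); intros t th Ht;
        (rewrite (Rpower_0_1 t th Ht), Rmult_1_r); pose proof (Hkb I t th HI (Hsub _ _ Ht));
        rewrite Rabs_right; lra. }
    split.
    + assert (E0 : add_state U (of_riemann (fun _ _ _ => 0)) = U).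
      { destruct U as [a1 a2 a3 a4]. unfold add_state, of_riemann; simpl.
        f_equal; repeat (apply functional_extensionality; intro); ring. }
      unfold remainder_rhs. rewrite E0. intros [[b s] I] Hi. unfold valid_idx in Hi; simpl in Hi.
      destruct (EB I Hi) as (E1 & E2 & E3 & E4).
      replace (2 * C1 + 2) with ((C1 + 1) + (C1 + 1)) by ring.
      assert (Q : forall f g, bnd (triangle c r) n e 4 (C1 + 1) f -> bnd (triangle c r) n e 4 (C1 + 1) g ->
         bnd (triangle c r) n e 4 (C1 + 1 + (C1 + 1)) (fun t th => - (f t th + g t th)) /\
         bnd (triangle c r) n e 4 (C1 + 1 + (C1 + 1)) (fun t th => - (f t th - g t th))).
      { intros f g X Y. split; apply bnd_opp; [apply bnd_plus|apply bnd_minus]; auto. }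
      destruct b, s; simpl;
        [eapply bnd_ext; [|apply (proj1 (Q _ _ E1 E2))]|eapply bnd_ext; [|apply (proj2 (Q _ _ E1 E2))]
        |eapply bnd_ext; [|apply (proj1 (Q _ _ E3 E4))]|eapply bnd_ext; [|apply (proj2 (Q _ _ E3 E4))]];
        intros t th _; simpl; ring.
    + intros w w' d Hd Hw i Hi.
      assert (WB : forall v, (forall i, valid_idx i -> bnd (triangle c r) n e 4 rho (v i)) ->
         B4 (triangle c r) N n e 0 kap (add_state U (of_riemann v))).
      { intros v Hv.
        assert (Hv0 : B4 (triangle c r) N n e 0 (kap / 2) (of_riemann v)).
        { apply Hunb; [lra|]. intros j Hj. pose proof (Hv j Hj) as X.
          apply (bnd_exp_tri c r n ltac:(lra) e 4 0) in X; [|lra].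
          rewrite Rminus_0_r in X. eapply bnd_weak; [|exact X]. apply Hs2; lra. }
        intros I HI. destruct (Hv0 I HI) as (?&?&?&?). destruct (UB I HI) as (?&?&?&?).
        replace kap with (kap / 2 + kap / 2) by field. split4; apply bnd_plus; auto. }
      assert (DB : B4 (triangle c r) N n e 4 d (sub_state (add_state U (of_riemann w)) (add_state U (of_riemann w')))).
      { assert (X : B4 (triangle c r) N n e 4 d (of_riemann (fun i t th => w i t th - w' i t th))).
        { apply Hunb; [lra|]. intros j Hj. apply Hw; auto. }
        intros I HI. destruct (X I HI) as (X1&X2&X3&X4).
        split4; [eapply bnd_ext; [|exact X1]|eapply bnd_ext; [|exact X2]|eapply bnd_ext; [|exact X3]|eapply bnd_ext; [|exact X4]];
            intros t th _; simpl; ring. }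
      destruct i as [[b s] I]. unfold valid_idx in Hi; simpl in Hi.
      destruct (FF_diff N k dp0 n e kap 1 4 d _ _ ltac:(lra) KB
        (WB w (fun j Hj => proj1 (Hw j Hj))) (WB w' (fun j Hj => proj1 (proj2 (Hw j Hj)))) DB I Hi)
        as (D1 & D2 & D3 & D4).
      assert (Hb1 : 2 * (kap * d) + d <= 3 * d) by nra.
      assert (Hb2 : (1 * d + 4 * ((INR N + 1) * (kap * d))) + (1 * d + 4 * ((INR N + 1) * (kap * d))) <= 3 * d).
      { rewrite <- (Rmult_assoc (INR N + 1)), HkapN. lra. }
      destruct b, s; simpl; [eapply bnd_weak; [apply Hb1|]|eapply bnd_weak; [apply Hb1|]
        |eapply bnd_weak; [apply Hb2|]|eapply bnd_weak; [apply Hb2|]].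
      * eapply bnd_ext; [|apply (bnd_plus _ _ _ _ _ _ _ D1 D2)]. intros t th _; simpl; ring.
      * eapply bnd_ext; [|apply (bnd_minus _ _ _ _ _ _ _ D1 D2)]. intros t th _; simpl; ring.
      * eapply bnd_ext; [|apply (bnd_plus _ _ _ _ _ _ _ D3 D4)]. intros t th _; simpl; ring.
      * eapply bnd_ext; [|apply (bnd_minus _ _ _ _ _ _ _ D3 D4)]. intros t th _; simpl; ring.
Qed.

Lemma FF_onst (Om : R -> R -> Prop) a b : eq_state Om N a b -> eq_state Om N (hyp_rhs N k dp0 a) (hyp_rhs N k dp0 b).
Proof.
  intros H I HI. destruct (H I HI) as (H1 & H2 & H3 & H4).
  assert (S1 : forall t th, Om t th -> SS N (sv a) I t th = SS N (sv b) I t th).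
  { intros t th Ht. unfold SS. rewrite H1 by auto. f_equal. apply sumI_ext. intros J HJ.
    apply (proj1 (H J HJ)); auto. }
  assert (S2 : forall t th, Om t th -> SS N (sx a) I t th = SS N (sx b) I t th).
  { intros t th Ht. unfold SS. rewrite H2 by auto. f_equal. apply sumI_ext. intros J HJ.
    apply (proj1 (proj2 (H J HJ))); auto. }
  split4; intros t th Ht; simpl; rewrite ?S1, ?S2, ?H2, ?H3, ?H4; auto.
Qed.

(** Undoes the diagonalisation: half the sum and half the difference of two transport equations of
    opposite speed form the coupled pair again. *)
Lemma half_sum_hasD {Om} {HOm : good Om} (wp wm f g : R -> R -> R) : sm Om wp -> sm Om wm ->
  hasD Om wp (fun t th => f t th + g t th + t * dth wp t th) ->
  hasD Om wm (fun t th => f t th - g t th - t * dth wm t th) ->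
  hasD Om (fun t th => / 2 * (wp t th + wm t th))
     (fun t th => t * dth (fun t th => / 2 * (wp t th - wm t th)) t th + f t th) /\
  hasD Om (fun t th => / 2 * (wp t th - wm t th))
     (fun t th => t * dth (fun t th => / 2 * (wp t th + wm t th)) t th + g t th).
Proof.
  intros Sp Sm Hp Hm.
  split.
  - eapply hasD_on; [intros t th _; reflexivity| |exact (hasD_scal (/ 2) _ _ (hasD_plus _ _ _ _ Hp Hm))].
    intros t th Ht; cbv beta.
    rewrite (dth_scal (/ 2) (fun t th => wp t th - wm t th) t th Ht), (dth_minus wp wm Sp Sm t th Ht). field.
  - eapply hasD_on; [intros t th _; reflexivity| |exact (hasD_scal (/ 2) _ _ (hasD_minus _ _ _ _ Hp Hm))].
    intros t th Ht; cbv beta.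
    rewrite (dth_scal (/ 2) (fun t th => wp t th + wm t th) t th Ht), (dth_plus wp wm Sp Sm t th Ht). field.
Qed.

Lemma hasD_sub (Om : R -> R -> Prop) f g : (forall t th, Om t th -> triangle c r0 t th) ->
  hasD (triangle c r0) f g -> hasD Om f g.
Proof. intros Hs H t th Ht. auto. Qed.

Theorem reduced_exists : exists r u, 0 < r <= r0 /\ admissible (triangle c r) N u /\ fixed_point (triangle c r) N k u0 u.
Proof.
  (* The last two iterates differ at the rate 31/8, and [src_near] raises this to the rate 4 for
     their right-hand sides. *)
  set (ua := iterate N k u0 32). set (up := iterate N k u0 31).
  assert (Ca : admissible (triangle c r0) N ua) by (apply iterate_admissible; auto).
  assert (Cp : admissible (triangle c r0) N up) by (apply iterate_admissible; auto).
  assert (Hn : Near (triangle c r0) N 4 (fuchs_rhs N k ua) (fuchs_rhs N k up)).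
  { replace 4 with (INR 31 / 8 + / 8) by (simpl; field).
    apply src_near; auto. apply iterate_near; auto. }
  assert (Eua : ua = add_state u0 (J_state (fuchs_rhs N k up))) by reflexivity.
  clearbody ua up.
  assert (Hua : eq_state (triangle c r0) N ua (add_state u0 (J_state (fuchs_rhs N k up)))) by (rewrite <- Eua; apply onst_refl).
  set (U := hyp k ua).
  assert (HU : In4 (triangle c r0) N (/ 8) (/ 8) (/ 8) (/ 8) U) by (apply hyp_In4; auto).
  (* The defect of [ua]: its D-derivative contains [fuchs_rhs] at [up] instead of [ua]. The weights
     are those of [hyp]. *)
  set (E := mkstate (fun I t th => sv (fuchs_rhs N k up) I t th - sv (fuchs_rhs N k ua) I t th)
     (fun I t th => t * (sx (fuchs_rhs N k up) I t th - sx (fuchs_rhs N k ua) I t th))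
     (fun I t th => Rpower t (k I th) * (sz (fuchs_rhs N k up) I t th - sz (fuchs_rhs N k ua) I t th))
     (fun I t th => Rpower t (1 - k I th) * (sy (fuchs_rhs N k up) I t th - sy (fuchs_rhs N k ua) I t th))).
  assert (HE : In4 (triangle c r0) N 4 4 4 4 E).
  { intros I HI. destruct (Hn I HI) as (N1 & N2 & N3 & N4).
    destruct (OO_tk (Om := triangle c r0) I HI (fun t th H => H)) as (T1 & T2 & _ & _).
    assert (Q : forall f g, OO (triangle c r0) 4 (fun t th => f t th - g t th) ->
       OO (triangle c r0) 4 (fun t th => g t th - f t th)).
    { intros f g H. eapply OO_ext; [|apply (OO_opp _ _ H)]. intros t th _; simpl; ring. }
    split4; unfold E; cbn [sv sx sz sy].
    - apply Q. eapply OO_weak; [|exact N1]. lra.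
    - eapply OO_mult; [apply OO_id|apply Q; exact N2|lra].
    - eapply OO_mult; [apply T1|apply Q; exact N3|lra].
    - eapply OO_mult; [apply T2|apply Q; exact N4|lra]. }
  destruct (remainder_exists U E HU HE) as (r & w & Hr & Hw).
  pose proof (tri_good c r ltac:(lra)) as HOm.
  assert (Hsub : forall t th, triangle c r t th -> triangle c r0 t th) by (intros; eapply tri_sub; [|eauto]; lra).
  assert (Hk' : forall I, (I < N)%nat -> OO (triangle c r) 0 (fun _ th => k I th)).
  { intros I HI. apply (OO_sub Hsub); auto. }
  assert (Ca' : admissible (triangle c r) N ua) by (apply (Cls_sub Hsub); auto).
  set (W := of_riemann w). set (Rh := remainder_rhs U E w) in *.
  assert (HW : In4 (triangle c r) N 4 4 4 4 W).
  { intros I HI. split4; simpl; apply (OO_scal 4 (/ 2)); (apply OO_minus || apply OO_plus); apply Hw; exact HI. }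
  assert (Dw : forall i, valid_idx i -> hasD (triangle c r) (w i)
     (fun t th => riemann Rh i t th - speed i * (t * dth (w i) t th))).
  { intros i Hi. destruct (Hw i Hi) as (H1 & H2 & H3).
    assert (Hc : Rabs (speed i) <= 1).
    { destruct i as [[b []] j]; unfold speed; simpl; [rewrite Rabs_left; lra|rewrite Rabs_R1; lra]. }
    assert (H2' : OO (triangle c r) (/ 16) (riemann Rh i)) by (eapply OO_weak; [|exact H2]; lra).
    intros t th Ht. eapply is_derive_on; [exact H3|exact Ht|].
    evar_last; [apply (J_dt (speed i) Hc _ H2' t th Ht)|].
    rewrite <- (J_dth_on (speed i) Hc _ H2' t th Ht), <- (dth_ext _ _ H3 t th Ht).
    destruct (good_pos _ _ Ht). field. lra. }
  assert (DW : forall I, (I < N)%nat ->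
    hasD (triangle c r) (sv W I) (fun t th => t * dth (sx W I) t th + sv Rh I t th) /\
    hasD (triangle c r) (sx W I) (fun t th => t * dth (sv W I) t th + sx Rh I t th) /\
    hasD (triangle c r) (sz W I) (fun t th => t * dth (sy W I) t th + sz Rh I t th) /\
    hasD (triangle c r) (sy W I) (fun t th => t * dth (sz W I) t th + sy Rh I t th)).
  { intros I HI.
    assert (S : forall b s, sm (triangle c r) (w (b, s, I))) by (intros b s; eapply OO_sm; apply Hw; exact HI).
    assert (Q : forall b s, hasD (triangle c r) (w (b, s, I))
       (fun t th => riemann Rh (b, s, I) t th - speed (b, s, I) * (t * dth (w (b, s, I)) t th)))
      by (intros b s; apply Dw; exact HI).
    destruct (half_sum_hasD (w (true, true, I)) (w (true, false, I)) (sv Rh I) (sx Rh I)) as [P1 P2]; auto.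
    { eapply hasD_on; [intros t th _; reflexivity| |apply (Q true true)].
      intros t th _. cbn [riemann speed fst snd]. unfold speed; cbn [fst snd]. ring. }
    { eapply hasD_on; [intros t th _; reflexivity| |apply (Q true false)].
      intros t th _. cbn [riemann speed fst snd]. unfold speed; cbn [fst snd]. ring. }
    destruct (half_sum_hasD (w (false, true, I)) (w (false, false, I)) (sz Rh I) (sy Rh I)) as [P3 P4]; auto.
    { eapply hasD_on; [intros t th _; reflexivity| |apply (Q false true)].
      intros t th _. cbn [riemann speed fst snd]. unfold speed; cbn [fst snd]. ring. }
    { eapply hasD_on; [intros t th _; reflexivity| |apply (Q false false)].
      intros t th _. cbn [riemann speed fst snd]. unfold speed; cbn [fst snd]. ring. } }
  (* The correction is found in the scaled unknowns. Dividing by t, t^k and t^(1-k) costs at most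
     one power of t, so the rate 4 becomes 3. *)
  set (u := mkstate (fun I t th => sv ua I t th + sv W I t th)
    (fun I t th => sx ua I t th + Rpower t (- 1) * sx W I t th)
    (fun I t th => sz ua I t th + Rpower t (- k I th) * sz W I t th)
    (fun I t th => sy ua I t th + Rpower t (- (1 - k I th)) * sy W I t th)).
  assert (HD : In4 (triangle c r) N 3 3 3 3 (mkstate (sv W) (fun I t th => Rpower t (- 1) * sx W I t th)
     (fun I t th => Rpower t (- k I th) * sz W I t th)
     (fun I t th => Rpower t (- (1 - k I th)) * sy W I t th))).
  { intros I HI. destruct (HW I HI) as (W1 & W2 & W3 & W4).
    destruct (OO_tk (Om := triangle c r) I HI Hsub) as (_ & _ & T3 & T4). split4; simpl.
    - eapply OO_weak; [|exact W1]; lra.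
    - eapply OO_mult; [apply OO_Rp|exact W2|lra].
    - eapply OO_mult; [apply T3|exact W3|lra].
    - eapply OO_mult; [apply T4|exact W4|lra]. }
  assert (Cu : admissible (triangle c r) N u).
  { intros I HI. destruct (HD I HI) as (W1 & W2 & W3 & W4). cbn [sv sx sz sy] in W1, W2, W3, W4.
    destruct (Ca' I HI) as (A1 & A2 & A3 & A4).
    split4; cbn [sv sx sz sy u]; apply OO_plus; auto;
      [eapply OO_weak; [|exact W1]|eapply OO_weak; [|exact W2]|eapply OO_weak; [|exact W3]|eapply OO_weak; [|exact W4]]; lra. }
  assert (Hhyp : eq_state (triangle c r) N (hyp k u) (add_state U W)).
  { intros I HI. split4; intros t th Ht; simpl; auto; destruct (good_pos _ _ Ht) as [H0 _].
    - rewrite Rpower_m1 by auto. field. lra.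
    - rewrite Rpower_Ropp. field. apply Rgt_not_eq, Rpower_pos.
    - rewrite Rpower_Ropp. field. apply Rgt_not_eq, Rpower_pos. }
  exists r, u. split; [lra|split; [exact Cu|]].
  apply (FP_intro N k dp0) with (om := / 16).
  - auto.
  - intros I HI. destruct (Du0 I HI) as (?&?&?). refine (conj _ (conj _ _)); apply (hasD_sub _ _ _ Hsub); auto.
  - lra.
  - apply src_In16; auto. intros J t th HJ Ht. apply (Hkb J t th HJ); auto.
  - intros I HI. destruct (HD I HI) as (W1 & W2 & W3 & W4). cbn [sv sx sz sy] in W1, W2, W3, W4.
    destruct (In4_JJsrc N k Hk Hkb up Cp I HI) as (B1 & B2 & B3 & B4). cbn [sv sx sz sy J_state] in B1, B2, B3, B4.
    assert (Q : forall a b f g h, / 16 <= a -> / 16 <= b -> OO (triangle c r0) a g -> OO (triangle c r) b h ->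
       (forall t th, f t th = g t th + h t th) -> OO (triangle c r) (/ 16) f).
    { intros a b f g h Ha Hb Hg Hh Hf. eapply OO_ext; [intros t th _; symmetry; apply Hf|].
      apply OO_plus; [eapply OO_weak; [exact Ha|apply (OO_sub Hsub); auto]|eapply OO_weak; [exact Hb|auto]]. }
    split4; [eapply Q; [| |exact B1|exact W1|]|eapply Q; [| |exact B2|exact W2|]
      |eapply Q; [| |exact B3|exact W3|]|eapply Q; [| |exact B4|exact W4|]]; try lra;
      intros t th; cbn [sv sx sz sy u]; rewrite Eua; cbn [sv sx sz sy add_state J_state]; ring.
  - intros I HI.
    destruct (step_hasD (Om := triangle c r0) N dp0 u0 Hu0 Du0 ua (fuchs_rhs N k up)
      Hua (src_In16 N k Hk Hkb up Cp) I HI) as (A1 & A2 & A3 & A4).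
    apply (hasD_sub _ _ _ Hsub) in A1, A2, A3, A4.
    destruct (DW I HI) as (W1 & W2 & W3 & W4).
    destruct (Hhyp I HI) as (P1 & P2 & P3 & P4).
    destruct (FF_onst (triangle c r) _ _ Hhyp I HI) as (F1 & F2 & F3 & F4).
    destruct (HU I HI) as (SU1 & SU2 & SU3 & SU4). destruct (HW I HI) as (SW1 & SW2 & SW3 & SW4).
    apply (OO_sub Hsub), OO_sm in SU1, SU2, SU3, SU4. apply OO_sm in SW1, SW2, SW3, SW4.
    (* The identities for [u] and for [ua] express F(U + W) and F(U) through [fuchs_rhs]. Inserted
       into the equation for W, they leave the rows of the Fuchsian system for [u]. *)
    assert (Z : forall t th, triangle c r t th ->
      t * (dth (sx U I) t th + dth (sx W I) t th) + sv (hyp_rhs N k dp0 (add_state U W)) I t th = sv (fuchs_rhs N k u) I t th /\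
      t * (dth (sv U I) t th + dth (sv W I) t th) + sx (hyp_rhs N k dp0 (add_state U W)) I t th
        = t * (sx u I t th + sx (fuchs_rhs N k u) I t th + dp0 I th) /\
      t * (dth (sy U I) t th + dth (sy W I) t th) + sz (hyp_rhs N k dp0 (add_state U W)) I t th
        = k I th * (sz U I t th + sz W I t th) + Rpower t (k I th) * sz (fuchs_rhs N k u) I t th /\
      t * (dth (sz U I) t th + dth (sz W I) t th) + sy (hyp_rhs N k dp0 (add_state U W)) I t th
        = (1 - k I th) * (sy U I t th + sy W I t th) + Rpower t (1 - k I th) * sy (fuchs_rhs N k u) I t th).
    { intros t th Ht. pose proof (hyp_identities N k dp0 Hk' u I t th HI Ht Cu) as Id.
      rewrite F1, F2, F3, F4, P3, P4 in Id by auto.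
      rewrite (dth_ext _ _ P1 t th Ht), (dth_ext _ _ P2 t th Ht),
        (dth_ext _ _ P3 t th Ht), (dth_ext _ _ P4 t th Ht) in Id.
      cbn [sv sx sz sy add_state] in Id.
      rewrite (dth_plus (sv U I) (sv W I) SU1 SW1 t th Ht), (dth_plus (sx U I) (sx W I) SU2 SW2 t th Ht),
        (dth_plus (sz U I) (sz W I) SU3 SW3 t th Ht), (dth_plus (sy U I) (sy W I) SU4 SW4 t th Ht) in Id.
      exact Id. }
    assert (Za : forall t th, triangle c r t th ->
      t * dth (sx U I) t th + sv (hyp_rhs N k dp0 U) I t th = sv (fuchs_rhs N k ua) I t th /\
      t * dth (sv U I) t th + sx (hyp_rhs N k dp0 U) I t th
        = t * (sx ua I t th + sx (fuchs_rhs N k ua) I t th + dp0 I th) /\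
      t * dth (sy U I) t th + sz (hyp_rhs N k dp0 U) I t th
        = k I th * sz U I t th + Rpower t (k I th) * sz (fuchs_rhs N k ua) I t th /\
      t * dth (sz U I) t th + sy (hyp_rhs N k dp0 U) I t th
        = (1 - k I th) * sy U I t th + Rpower t (1 - k I th) * sy (fuchs_rhs N k ua) I t th).
    { intros t th Ht. apply (hyp_identities N k dp0 Hk' ua I t th HI Ht Ca'). }
    assert (X : forall t th, triangle c r t th -> t <> 0).
    { intros t th Ht. destruct (good_pos _ _ Ht). lra. }
    split4.
    + eapply hasD_on; [intros t th _; reflexivity| |apply (hasD_plus _ _ _ _ A1 W1)].
      intros t th Ht. destruct (Z t th Ht) as (Z1 & _). destruct (Za t th Ht) as (Y1 & _).
      unfold Rh, remainder_rhs. cbn [sv sx sz sy sub_state]. fold W. unfold E. cbn [sv sx sz sy]. lra.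
    + eapply hasD_on; [intros t th _; reflexivity| |apply (hasD_plus _ _ _ _ A2
        (hasD_mult _ _ _ _ (hasD_tpow (fun _ => - 1)) W2))].
      intros t th Ht. destruct (Z t th Ht) as (_ & Z1 & _). destruct (Za t th Ht) as (_ & Y1 & _).
      unfold Rh, remainder_rhs. cbn [sv sx sz sy sub_state]. fold W. unfold E. cbn [sv sx sz sy].
      pose proof (X t th Ht). destruct (good_pos _ _ Ht) as [H0 _].
      change (sx u I t th) with (sx ua I t th + Rpower t (- 1) * sx W I t th) in Z1.
      rewrite Rpower_m1 in * by auto.
      set (FT := sx (hyp_rhs N k dp0 (add_state U W)) I t th) in *. set (FU := sx (hyp_rhs N k dp0 U) I t th) in *.
      replace FT with (t * (sx ua I t th + / t * sx W I t th + sx (fuchs_rhs N k u) I t th + dp0 I th)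
         - t * (dth (sv U I) t th + dth (sv W I) t th)) by lra.
      replace FU with (t * (sx ua I t th + sx (fuchs_rhs N k ua) I t th + dp0 I th) - t * dth (sv U I) t th) by lra.
      field; auto.
    + eapply hasD_on; [intros t th _; reflexivity| |apply (hasD_plus _ _ _ _ A3
        (hasD_mult _ _ _ _ (hasD_tpow (fun th => - k I th)) W3))].
      intros t th Ht. destruct (Z t th Ht) as (_ & _ & Z1 & _). destruct (Za t th Ht) as (_ & _ & Y1 & _).
      unfold Rh, remainder_rhs. cbn [sv sx sz sy sub_state]. fold W. unfold E. cbn [sv sx sz sy].
      rewrite !Rpower_Ropp. pose proof (Rpower_pos t (k I th)) as Ha. set (a := Rpower t (k I th)) in *.
      set (FT := sz (hyp_rhs N k dp0 (add_state U W)) I t th) in *. set (FU := sz (hyp_rhs N k dp0 U) I t th) in *.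
      replace FT with (k I th * (sz U I t th + sz W I t th) + a * sz (fuchs_rhs N k u) I t th
         - t * (dth (sy U I) t th + dth (sy W I) t th)) by lra.
      replace FU with (k I th * sz U I t th + a * sz (fuchs_rhs N k ua) I t th - t * dth (sy U I) t th) by lra.
      field; lra.
    + eapply hasD_on; [intros t th _; reflexivity| |apply (hasD_plus _ _ _ _ A4
        (hasD_mult _ _ _ _ (hasD_tpow (fun th => - (1 - k I th))) W4))].
      intros t th Ht. destruct (Z t th Ht) as (_ & _ & _ & Z1). destruct (Za t th Ht) as (_ & _ & _ & Y1).
      unfold Rh, remainder_rhs. cbn [sv sx sz sy sub_state]. fold W. unfold E. cbn [sv sx sz sy].
      rewrite !Rpower_Ropp. pose proof (Rpower_pos t (1 - k I th)) as Ha. set (a := Rpower t (1 - k I th)) in *.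
      set (FT := sy (hyp_rhs N k dp0 (add_state U W)) I t th) in *. set (FU := sy (hyp_rhs N k dp0 U) I t th) in *.
      replace FT with ((1 - k I th) * (sy U I t th + sy W I t th) + a * sy (fuchs_rhs N k u) I t th
         - t * (dth (sz U I) t th + dth (sz W I) t th)) by lra.
      replace FU with ((1 - k I th) * sy U I t th + a * sy (fuchs_rhs N k ua) I t th - t * dth (sz U I) t th) by lra.
      field; lra.
Qed.

End Existence.

Definition isDt (Om : R -> R -> Prop) (f g : R -> R -> R) : Prop :=
  forall t th, Om t th -> is_derive (fun s => f s th) t (g t th).

(** * Regularity in t *)

Section TimeRegularity.
Context {Om : R -> R -> Prop} {HOm : good Om}.

Lemma c2_pt1 (f : R -> R -> R) x y : continuity_2d_pt f x y -> continuous (fun u => f u y) x.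
Proof.
  intros H. apply continuity_pt_filterlim. intros eps He.
  destruct (H (mkposreal _ He)) as [d Hd]. exists d; split; [apply cond_pos|].
  intros v [_ Hv]. apply Hd; auto. rewrite Rminus_diag, Rabs_R0; apply cond_pos.
Qed.

Lemma c2_swap (f : R -> R -> R) x y : continuity_2d_pt f x y -> continuity_2d_pt (fun a b => f b a) y x.
Proof.
  intros H eps. destruct (H eps) as [d Hd]. exists d. intros u v Hu Hv. apply Hd; auto.
Qed.

(* Differentiating f(t,.) = f(t1,.) + int_t1^t g(s,.) ds under the integral. *)
Lemma isDt_dth f g : sm Om f -> sm Om g -> isDt Om f g -> isDt Om (dth f) (dth g).
Proof.
  intros Hf Hg Hd t th Ht. destruct (good_open _ _ Ht) as [d Hdd].
  set (e := d / 2). assert (He : 0 < e < d) by (unfold e; pose proof (cond_pos d); lra).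
  assert (HOm' : forall s x, Rabs (s - t) <= e -> Rabs (x - th) <= e -> Om s x).
  { intros s x H1 H2. apply Hdd; lra. }
  assert (HRin : forall s x, Rabs (s - t) <= e -> Rabs (x - th) <= e ->
    RInt (fun s => g s x) (t - e) s = f s x - f (t - e) x).
  { intros s x H1 H2. apply Rabs_le_between in H1. apply is_RInt_unique.
    apply (is_RInt_derive (fun s => f s x) (fun s => g s x)).
    - intros y Hy. rewrite Rmin_left, Rmax_right in Hy by lra. apply Hd, HOm'; auto.
      apply Rabs_le_between; lra.
    - intros y Hy. rewrite Rmin_left, Rmax_right in Hy by lra.
      apply (c2_pt1 g). apply (@sm_c Om); auto. apply HOm'; auto. apply Rabs_le_between; lra. }
  assert (HRd : forall s, Rabs (s - t) <= e ->
    dth f s th = dth f (t - e) th + RInt (fun s => dth g s th) (t - e) s).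
  { intros s H1. pose proof (proj1 (Rabs_le_between _ _) H1) as H1'.
    assert (Hth : Rabs (th - th) <= e) by (rewrite Rminus_diag, Rabs_R0; lra).
    assert (He2 : Rabs (t - e - t) <= e) by (rewrite Rabs_left; lra).
    assert (Hpar : is_derive (fun x => RInt (fun s => g s x) (t - e) s) th
        (RInt (fun s => dth g s th) (t - e) s)).
    { apply (is_derive_RInt_param (fun x s => g s x) (t - e) s th).
      - exists (mkposreal e (proj1 He)). intros x Hx y Hy.
        rewrite Rmin_left, Rmax_right in Hy by lra. apply (@sm_ex Om); auto.
        apply HOm'; [apply Rabs_le_between; lra|]. left. apply Hx.
      - intros y Hy. rewrite Rmin_left, Rmax_right in Hy by lra.
        apply (c2_swap (dth g)). apply (@sm_c Om); [apply sm_dth; auto|].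
        apply HOm'; auto. apply Rabs_le_between; lra.
      - exists (mkposreal e (proj1 He)). intros x Hx. apply @ex_RInt_continuous.
        intros y Hy. rewrite Rmin_left, Rmax_right in Hy by lra.
        apply (c2_pt1 g). apply (@sm_c Om); auto. apply HOm'; [apply Rabs_le_between; lra|].
        left. apply Hx. }
    pose proof (sm_is f Hf _ _ (HOm' _ _ H1 Hth)) as D1.
    pose proof (sm_is f Hf _ _ (HOm' _ _ He2 Hth)) as D2.
    assert (D3 : is_derive (fun x => f s x - f (t - e) x) th (RInt (fun s => dth g s th) (t - e) s)).
    { eapply is_derive_ext_loc; [|exact Hpar].
      exists (mkposreal e (proj1 He)). intros x Hx. apply HRin; auto. left; apply Hx. }
    pose proof (is_derive_unique _ _ _ D3) as E3.
    pose proof (is_derive_minus _ _ _ _ _ D1 D2) as D4.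
    pose proof (is_derive_unique _ _ _ D4) as E4.
    assert (E5 : RInt (fun s => dth g s th) (t - e) s = dth f s th - dth f (t - e) th).
    { rewrite <- E3. exact E4. }
    lra. }
  assert (Hloc : locally t (fun s => dth f (t - e) th + RInt (fun s => dth g s th) (t - e) s = dth f s th)).
  { exists (mkposreal e (proj1 He)). intros s Hs. symmetry. apply HRd. left; apply Hs. }
  eapply is_derive_ext_loc; [exact Hloc|].
  evar_last; [apply @is_derive_plus; [apply is_derive_const|apply @is_derive_RInt with (a := t - e)]|].
  - exists (mkposreal e (proj1 He)). intros s Hs. apply @RInt_correct.
    assert (Hs' : Rabs (s - t) < e) by apply Hs. apply Rabs_lt_between in Hs'.
    apply @ex_RInt_continuous. intros y Hy. rewrite Rmin_left, Rmax_right in Hy by lra.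
    apply (c2_pt1 (dth g)). apply (@sm_c Om); [apply sm_dth; auto|].
    apply HOm'; [apply Rabs_le_between; lra|rewrite Rminus_diag, Rabs_R0; lra].
  - apply (c2_pt1 (dth g)). apply (@sm_c Om); [apply sm_dth; auto|auto].
  - unfold plus, zero; simpl. ring.
Qed.

(** The t-derivative is an existential witness rather than [dt f]: the equations deliver it as an
    explicit expression, to which the closure properties apply directly. *)
Fixpoint Ct (n : nat) (f : R -> R -> R) : Prop :=
  match n with
  | O => sm Om f
  | S m => sm Om f /\ exists g, isDt Om f g /\ Ct m g
  end.

Lemma Ct_sm n f : Ct n f -> sm Om f.
Proof. destruct n; [auto|intros [H _]; auto]. Qed.

Lemma isDt_on f f' g : eq_on Om f f' -> isDt Om f g -> isDt Om f' g.
Proof. intros H Hd t th Ht. eapply is_derive_on; [apply on_sym; exact H|auto|auto]. Qed.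

Lemma Ct_ext n f g : eq_on Om f g -> Ct n f -> Ct n g.
Proof.
  intros H. destruct n as [|n]; [apply sm_ext; auto|].
  intros (H1 & h & H2 & H3). split; [eapply sm_ext; eauto|]. exists h; split; auto.
  eapply isDt_on; eauto.
Qed.

Lemma Ct_pred n : forall f, Ct (S n) f -> Ct n f.
Proof.
  induction n as [|n IH]; intros f (H1 & h & H2 & H3); [auto|].
  split; auto. exists h; split; auto.
Qed.

Lemma isDt_plus f g f' g' : isDt Om f f' -> isDt Om g g' ->
  isDt Om (fun t th => f t th + g t th) (fun t th => f' t th + g' t th).
Proof. intros H1 H2 t th Ht. apply @is_derive_plus; auto. Qed.

Lemma isDt_mult f g f' g' : isDt Om f f' -> isDt Om g g' ->
  isDt Om (fun t th => f t th * g t th) (fun t th => f' t th * g t th + f t th * g' t th).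
Proof.
  intros H1 H2 t th Ht.
  apply (is_derive_mult (fun s => f s th) (fun s => g s th)); auto. intros; apply Rmult_comm.
Qed.

Lemma Ct_plus n : forall f g, Ct n f -> Ct n g -> Ct n (fun t th => f t th + g t th).
Proof.
  induction n as [|n IH]; intros f g; [apply sm_plus|].
  intros (H1 & h & H2 & H3) (H1' & h' & H2' & H3').
  split; [apply sm_plus; auto|]. eexists; split; [apply isDt_plus; eauto|auto].
Qed.

Lemma Ct_mult n : forall f g, Ct n f -> Ct n g -> Ct n (fun t th => f t th * g t th).
Proof.
  induction n as [|n IH]; intros f g; [apply sm_mult|].
  intros Hf Hg. pose proof (Ct_pred _ _ Hf). pose proof (Ct_pred _ _ Hg).
  destruct Hf as (H1 & h & H2 & H3), Hg as (H1' & h' & H2' & H3').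
  split; [apply sm_mult; auto|].
  exists (fun t th => h t th * g t th + f t th * h' t th); split; [apply isDt_mult; auto|].
  apply Ct_plus; apply IH; auto.
Qed.

Lemma Ct_th n (g : R -> R) : sm Om (fun _ th => g th) -> Ct n (fun _ th => g th).
Proof.
  revert g; induction n as [|n IH]; intros g H; [auto|]. split; auto.
  exists (fun _ _ => 0). split; [intros t th _; apply @is_derive_const|].
  apply (IH (fun _ => 0)). apply sm_const.
Qed.

Lemma Ct_const n c : Ct n (fun _ _ => c).
Proof. apply (Ct_th n (fun _ => c)), sm_const. Qed.

Lemma Ct_scal n c f : Ct n f -> Ct n (fun t th => c * f t th).
Proof. intros. apply (Ct_mult n (fun _ _ => c)); auto. apply Ct_const. Qed.

Lemma Ct_opp n f : Ct n f -> Ct n (fun t th => - f t th).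
Proof.
  intros H. eapply Ct_ext; [|apply (Ct_scal n (- 1)); apply H]. intros t th _; simpl; ring.
Qed.

Lemma Ct_minus n f g : Ct n f -> Ct n g -> Ct n (fun t th => f t th - g t th).
Proof. intros; apply (Ct_plus n f (fun t th => - g t th)); auto using Ct_opp. Qed.

Lemma Ct_exp n : forall f, Ct n f -> Ct n (fun t th => exp (f t th)).
Proof.
  induction n as [|n IH]; intros f; [apply sm_exp|].
  intros Hf. pose proof (Ct_pred _ _ Hf). destruct Hf as (H1 & h & H2 & H3).
  split; [apply sm_exp; auto|]. exists (fun t th => h t th * exp (f t th)). split.
  - intros t th Ht. apply (is_derive_comp exp (fun s => f s th)); [apply is_derive_exp|]. apply H2; auto.
  - apply Ct_mult; auto.
Qed.

Lemma sm_inv_t : sm Om (fun t _ => / t).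
Proof.
  apply (sm_t (fun t => / t)). intros t th Ht. destruct (good_pos _ _ Ht).
  apply continuity_pt_inv; [apply derivable_continuous_pt, derivable_pt_id|lra].
Qed.

Lemma Ct_inv_t n : Ct n (fun t _ => / t).
Proof.
  induction n as [|n IH]; [apply sm_inv_t|]. split; [apply sm_inv_t|].
  exists (fun t _ => (- 1) * (/ t * / t)). split.
  - intros t th Ht. destruct (good_pos _ _ Ht). evar_last; [apply is_derive_inv; [apply is_derive_id|lra]|].
    unfold one; simpl. field. lra.
  - apply Ct_scal, Ct_mult; auto.
Qed.

Lemma Ct_id n : Ct n (fun t _ => t).
Proof.
  assert (sm Om (fun t _ => t)).
  { apply (sm_t (fun t => t)). intros t th Ht. apply derivable_continuous_pt, derivable_pt_id. }
  destruct n as [|n]; [auto|]. split; auto. exists (fun _ _ => 1). split; [|apply Ct_const].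
  intros t th Ht. apply @is_derive_id.
Qed.

Lemma Ct_ln n : Ct n (fun t _ => ln t).
Proof.
  destruct n as [|n]; [apply sm_ln|]. split; [apply sm_ln|]. exists (fun t _ => / t).
  split; [|apply Ct_inv_t]. intros t th Ht. apply is_derive_ln. eapply good_pos; eauto.
Qed.

Lemma Ct_tpow n a : sm Om (fun _ th => a th) -> Ct n (fun t th => Rpower t (a th)).
Proof.
  intros. unfold Rpower. apply (Ct_exp n (fun t th => a th * ln t)).
  apply (Ct_mult n (fun _ th => a th) (fun t _ => ln t)); [apply Ct_th; auto|apply Ct_ln].
Qed.

Lemma Ct_dth n : forall f, Ct n f -> Ct n (dth f).
Proof.
  induction n as [|n IH]; intros f; [apply sm_dth|].
  intros (H1 & h & H2 & H3). split; [apply sm_dth; auto|]. exists (dth h); split; auto.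
  apply isDt_dth; auto. eapply Ct_sm; eauto.
Qed.

(** Since D (J f) = f, integration gains one t-derivative; this drives the bootstrap in t. *)
Lemma Ct_J0 n f : OO Om (/ 16) f -> Ct n f -> Ct (S n) (J 0 f).
Proof.
  intros Hf H. split; [apply J_sm; auto using Rabs_0_le_1|]. exists (fun t th => f t th * / t). split.
  - exact (hasD_J0 f Hf).
  - apply (Ct_mult n f (fun t _ => / t)); auto. apply Ct_inv_t.
Qed.

Lemma Ct_SS n N f I : (I < N)%nat -> (forall J, (J < N)%nat -> Ct n (f J)) -> Ct n (SS N f I).
Proof.
  intros HI H. apply (Ct_plus n (fun t th => sumI N (fun J => f J t th)) (f I)); auto.
  apply (sumI_closed (Ct n)); auto; [apply Ct_const|apply Ct_plus].
Qed.

Lemma Ct_dt f : (forall n, Ct n f) -> (forall t th, Om t th -> ex_derive (fun s => f s th) t) /\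
  forall n, Ct n (dt f).
Proof.
  intros H. split.
  - intros t th Ht. destruct (H 1%nat) as (_ & g & Hg & _). eexists; apply Hg; auto.
  - intros n. destruct (H (S n)) as (_ & g & Hg & Cg).
    apply (Ct_ext n g); auto. intros t th Ht. symmetry. apply is_derive_unique, Hg; auto.
Qed.

Lemma Ct_iterD f w : (forall n, Ct n f) -> forall n, Ct n (iterD w f).
Proof.
  intros H. induction w as [|[] w IH]; simpl; auto.
  - apply (Ct_dt _ IH).
  - intros n. apply Ct_dth; auto.
Qed.

Lemma Ct_smooth_rect T a b f : (forall t th, 0 < t < T -> a < th < b -> Om t th) ->
  (forall n, Ct n f) -> smooth_rect T a b f.
Proof.
  intros Hs H w t th Ht Hth. specialize (Hs t th Ht Hth). pose proof (Ct_iterD f w H) as Hw.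
  split; [apply (Ct_dt _ Hw); auto|]. split.
  - apply (@sm_ex Om); auto. apply (Hw 0%nat).
  - apply (continuity_2d_pt_filterlim (iterD w f)). apply (@sm_c Om); auto. apply (Hw 0%nat).
Qed.

Lemma hasD_Dop f g : hasD Om f g -> eq_on Om (Dop f) g.
Proof.
  intros H t th Ht. destruct (good_pos _ _ Ht). unfold Dop, dt.
  transitivity (t * (g t th / t)); [f_equal; exact (is_derive_unique _ _ _ (H t th Ht))|field; lra].
Qed.

Lemma Dop_ext f g : eq_on Om f g -> eq_on Om (Dop f) (Dop g).
Proof.
  intros H t th Ht. unfold Dop, dt. f_equal. apply Derive_ext_loc.
  apply (on_loc_t _ _ _ _ H Ht).
Qed.

Lemma OO_regular T a b s f : (forall t th, 0 < t < T -> a < th < b -> Om t th) -> 0 < s ->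
  (forall n, Ct n f) -> OO Om s f -> regular T a b f.
Proof.
  intros Hsub Hs Hc Hf. split; [apply Ct_smooth_rect; auto|].
  (* The extension to t = 0 is by the value 0, because every theta-derivative is O(t^s) with s >
     0. *)
  intros n. exists (fun t th => if Rlt_dec 0 t then dthn n f t th else 0). split.
  - intros t th Ht Hth. destruct (Rlt_dec 0 t); [auto|lra].
  - intros t th Ht Hth.
    apply filterlim_locally. intros eps. destruct (Rlt_dec 0 t) as [H0|H0].
    + assert (HO : Om t th) by (apply Hsub; lra).
      assert (Hcont : continuity_2d_pt (dthn n f) t th).
      { apply (@sm_c Om); auto. apply sm_dthn. eapply OO_sm; eauto. }
      destruct (Hcont eps) as [d Hd].
      assert (Hm : 0 < Rmin d t) by (apply Rmin_pos; [apply cond_pos|auto]).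
      exists (mkposreal _ Hm). intros [x y] [Hx Hy] _. simpl in *.
      assert (Hx' : Rabs (x - t) < Rmin d t) by exact Hx.
      assert (Hy' : Rabs (y - th) < Rmin d t) by exact Hy.
      pose proof (Rmin_l d t). pose proof (Rmin_r d t).
      destruct (Rlt_dec 0 x) as [X|X]; [apply Hd; lra|].
      apply Rabs_lt_between in Hx'. lra.
    + assert (t = 0) by lra. subst t.
      destruct (OO_dthn_bound _ _ Hf n) as (C & HC & Hb).
      destruct (small_Rpower C s (eps / 2) Hs) as (eta & He & Heta); [pose proof (cond_pos eps); lra|].
      exists (mkposreal _ He). intros [x y] [Hx Hy] [Dx Dy]. simpl in *.
      change (Rabs ((if Rlt_dec 0 x then dthn n f x y else 0) - 0) < eps).
      rewrite Rminus_0_r. pose proof (cond_pos eps).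
      destruct (Rlt_dec 0 x) as [X|X]; [|rewrite Rabs_R0; lra].
      assert (Hx' : Rabs (x - 0) < eta) by exact Hx. rewrite Rminus_0_r, Rabs_right in Hx' by lra.
      eapply Rle_lt_trans; [apply Hb; apply Hsub; lra|].
      specialize (Heta x ltac:(lra)). lra.
Qed.

Lemma OO_lim0 T s f th : 0 < T -> (forall t, 0 < t < T -> Om t th) -> 0 < s -> OO Om s f ->
  filterlim (fun t => f t th) (at_right 0) (locally 0).
Proof.
  intros HT Hsub Hs Hf. apply filterlim_locally. intros eps. pose proof (cond_pos eps).
  destruct (OO_0 _ _ Hf) as (C & HC & Hb).
  destruct (small_Rpower C s (eps / 2) Hs) as (eta & He & Heta); [lra|].
  assert (Hm : 0 < Rmin eta T) by (apply Rmin_pos; auto).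
  exists (mkposreal _ Hm). intros x Hx Hx0.
  assert (Hx' : Rabs (x - 0) < Rmin eta T) by exact Hx. rewrite Rminus_0_r, Rabs_right in Hx' by lra.
  pose proof (Rmin_l eta T). pose proof (Rmin_r eta T).
  change (Rabs (f x th - 0) < eps). rewrite Rminus_0_r.
  eapply Rle_lt_trans; [apply Hb; apply Hsub; lra|].
  specialize (Heta x ltac:(lra)). lra.
Qed.

End TimeRegularity.
Arguments Ct Om n f : clear implicits.

(** * Recovering the metric functions *)

Section Data.
Context (N : nat) (p0 p1 q0 q1 : nat -> R -> R).

Definition kk : nat -> R -> R := kI N p0.
Definition Sp1 (I : nat) (th : R) : R := sumI N (fun J => p1 J th) + p1 I th.
Definition dp0 (I : nat) : R -> R := Derive (p0 I).

(** The unknowns of the leading terms P = p0 ln t + p1 and Q = q0 + t^(2k) q1, where y keeps only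
    the contribution of q0'. *)
Definition base : state := mkstate (fun _ _ _ => 0)
  (fun I t th => dp0 I th * ln t + Derive (p1 I) th)
  (fun I _ th => 2 * kk I th * q1 I th * exp (- Sp1 I th))
  (fun I _ th => Derive (q0 I) th * exp (- Sp1 I th)).

Context (Hdata : forall I, (I < N)%nat ->
  smooth1 (p0 I) /\ smooth1 (p1 I) /\ smooth1 (q0 I) /\ smooth1 (q1 I)).
Context (Hkb : forall I th, (I < N)%nat -> / 2 < kk I th < 5 / 6).
Context {Om : R -> R -> Prop} {HOm : good Om}.

Lemma smooth_p0 I : (I < N)%nat -> smooth1 (p0 I).
Proof. intros HI; exact (proj1 (Hdata I HI)). Qed.

Lemma smooth_p1 I : (I < N)%nat -> smooth1 (p1 I).
Proof. intros HI; exact (proj1 (proj2 (Hdata I HI))). Qed.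

Lemma OO_kk I : (I < N)%nat -> OO Om 0 (fun _ th => kk I th).
Proof.
  intros HI. apply (OO_SS N 0 (fun J _ th => p0 J th) I HI).
  intros J HJ. apply OO_smooth1, smooth_p0; auto.
Qed.

Lemma Hkb' : forall I t th, (I < N)%nat -> Om t th -> / 2 < kk I th < 5 / 6.
Proof. auto. Qed.

Lemma OO_Sp1 I : (I < N)%nat -> OO Om 0 (fun _ th => Sp1 I th).
Proof.
  intros HI. apply (OO_SS N 0 (fun J _ th => p1 J th) I HI).
  intros J HJ. apply OO_smooth1, smooth_p1; auto.
Qed.

Lemma OO_exp0 f : OO Om 0 f -> OO Om 0 (fun t th => exp (f t th)).
Proof.
  intros H. eapply OO_ext; [|apply (OO_plus 0 _ _ (OO_exp_minus_1 0 f (Rle_refl 0) H) (OO_const 1))].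
  intros t th _; simpl; ring.
Qed.

Lemma OO_mult0 f g : OO Om 0 f -> OO Om 0 g -> OO Om 0 (fun t th => f t th * g t th).
Proof. intros Hf Hg. eapply OO_mult; eauto; lra. Qed.

Lemma OO_expSp1 I : (I < N)%nat -> OO Om 0 (fun _ th => exp (- Sp1 I th)).
Proof. intros HI. apply (OO_exp0 (fun _ th => - Sp1 I th)). apply (OO_opp 0 (fun _ th => Sp1 I th)), OO_Sp1; auto. Qed.

Lemma base_Cls : admissible Om N base.
Proof.
  intros I HI. destruct (Hdata I HI) as (H1 & H2 & H3 & H4). split4; simpl.
  - apply OO_zero.
  - apply OO_plus.
    + apply (OO_mult 0 (- / 16) (- / 16) (fun _ th => dp0 I th) (fun t _ => ln t)); [|apply OO_ln; lra|lra].
      apply (OO_smooth1 (dp0 I)), smooth1_Derive; auto.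
    + eapply OO_weak; [|apply (OO_smooth1 (Derive (p1 I))), smooth1_Derive; auto]. lra.
  - apply (OO_mult0 (fun _ th => 2 * kk I th * q1 I th) (fun _ th => exp (- Sp1 I th))); [|apply OO_expSp1; auto].
    apply (OO_mult0 (fun _ th => 2 * kk I th) (fun _ th => q1 I th)); [|apply OO_smooth1; auto].
    apply (OO_scal 0 2 (fun _ th => kk I th)), OO_kk; auto.
  - apply (OO_mult0 (fun _ th => Derive (q0 I) th) (fun _ th => exp (- Sp1 I th))); [|apply OO_expSp1; auto].
    apply (OO_smooth1 (Derive (q0 I))), smooth1_Derive; auto.
Qed.

Lemma base_D I : (I < N)%nat -> hasD Om (sx base I) (fun _ th => dp0 I th) /\
  hasD Om (sz base I) (fun _ _ => 0) /\ hasD Om (sy base I) (fun _ _ => 0).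
Proof.
  intros HI. split; [|split].
  - eapply hasD_on; [intros t th _; reflexivity| |apply (hasD_plus _ _ _ _
      (hasD_mult _ _ _ _ (hasD_th (dp0 I)) hasD_ln) (hasD_th (Derive (p1 I))))].
    intros t th _; simpl; ring.
  - apply (hasD_th (fun th => 2 * kk I th * q1 I th * exp (- Sp1 I th))).
  - apply (hasD_th (fun th => Derive (q0 I) th * exp (- Sp1 I th))).
Qed.

Lemma base_Ct n I : (I < N)%nat -> Ct Om n (sx base I) /\ Ct Om n (sz base I) /\ Ct Om n (sy base I).
Proof.
  intros HI. destruct (base_Cls I HI) as (_ & _ & H3 & H4). destruct (Hdata I HI) as (S1 & S2 & _).
  split; [|split]; simpl.
  - apply Ct_plus.
    + apply (Ct_mult n (fun _ th => dp0 I th) (fun t _ => ln t)); [|apply Ct_ln].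
      apply (Ct_th n (dp0 I)). eapply OO_sm, (OO_smooth1 (dp0 I)), smooth1_Derive; auto.
    + apply (Ct_th n (Derive (p1 I))). eapply OO_sm, (OO_smooth1 (Derive (p1 I))), smooth1_Derive; auto.
  - apply (Ct_th n (fun th => 2 * kk I th * q1 I th * exp (- Sp1 I th))). eapply OO_sm; apply H3.
  - apply (Ct_th n (fun th => Derive (q0 I) th * exp (- Sp1 I th))). eapply OO_sm; apply H4.
Qed.

Context (u : state) (Cu : admissible Om N u) (Fu : fixed_point Om N kk base u).

Lemma u_D I : (I < N)%nat -> hasD Om (sv u I) (sv (fuchs_rhs N kk u) I) /\
    hasD Om (sx u I) (fun t th => dp0 I th + sx (fuchs_rhs N kk u) I t th) /\
    hasD Om (sz u I) (sz (fuchs_rhs N kk u) I) /\ hasD Om (sy u I) (sy (fuchs_rhs N kk u) I).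
Proof.
  intros HI. apply (step_hasD N dp0 base (fun _ _ _ => eq_refl) base_D u (fuchs_rhs N kk u) Fu); auto.
  apply (src_In16 N kk OO_kk Hkb' u Cu).
Qed.

Lemma u_near I : (I < N)%nat -> OO Om (3 / 16) (sv u I) /\
  OO Om (/ 16) (fun t th => sx u I t th - sx base I t th) /\
  OO Om (/ 16) (fun t th => sz u I t th - sz base I t th) /\
  OO Om (/ 16) (fun t th => sy u I t th - sy base I t th).
Proof.
  intros HI. destruct (In4_JJsrc N kk OO_kk Hkb' u Cu I HI) as (A1 & A2 & A3 & A4).
  destruct (Fu I HI) as (F1 & F2 & F3 & F4).
  split4; [eapply OO_ext; [|exact A1]|eapply OO_ext; [|exact A2]|eapply OO_ext; [|exact A3]|eapply OO_ext; [|exact A4]];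
    intros t th Ht; rewrite ?F1, ?F2, ?F3, ?F4 by auto; simpl; ring.
Qed.

Lemma src_Ct n : (forall I, (I < N)%nat -> Ct Om n (sv u I) /\ Ct Om n (sx u I) /\ Ct Om n (sz u I) /\ Ct Om n (sy u I)) ->
  forall I, (I < N)%nat -> Ct Om n (sv (fuchs_rhs N kk u) I) /\ Ct Om n (sx (fuchs_rhs N kk u) I) /\
    Ct Om n (sz (fuchs_rhs N kk u) I) /\ Ct Om n (sy (fuchs_rhs N kk u) I).
Proof.
  intros H I HI. destruct (H I HI) as (H1 & H2 & H3 & H4).
  assert (Sv : Ct Om n (SS N (sv u) I)) by (apply Ct_SS; auto; intros; apply H; auto).
  assert (Sx : Ct Om n (SS N (sx u) I)) by (apply Ct_SS; auto; intros; apply H; auto).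
  assert (Tb : Ct Om n (fun t th => Rpower t (2 - 2 * kk I th))).
  { apply (Ct_tpow n (fun th => 2 - 2 * kk I th)).
    apply (sm_minus (fun _ _ => 2) (fun _ th => 2 * kk I th)); [apply sm_const|].
    apply (sm_scal 2 (fun _ th => kk I th)). eapply OO_sm, OO_kk; auto. }
  assert (T2 : Ct Om n (fun t th => Rpower t (2 * kk I th))).
  { apply (Ct_tpow n (fun th => 2 * kk I th)).
    apply (sm_scal 2 (fun _ th => kk I th)). eapply OO_sm, OO_kk; auto. }
  assert (KL : Ct Om n (fun t th => Derive (kk I) th * ln t)).
  { apply (Ct_mult n (fun _ th => Derive (kk I) th) (fun t _ => ln t)); [|apply Ct_ln].
    apply (Ct_th n (Derive (kk I))). apply (sm_dth (fun _ th => kk I th)). eapply OO_sm, OO_kk; auto. }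
  split4; simpl.
  - apply Ct_minus.
    + apply (Ct_mult n (fun t th => t * t)); [|apply Ct_dth; auto].
      apply (Ct_mult n (fun t _ => t) (fun t _ => t)); apply Ct_id.
    + apply (Ct_scal n (/ 2)). apply Ct_minus; repeat (apply Ct_mult; auto).
  - apply Ct_dth; auto.
  - apply Ct_minus; [apply Ct_plus|]; repeat apply Ct_mult; auto.
    apply Ct_minus; [apply Ct_dth; auto|apply Ct_mult; auto].
  - apply Ct_plus; [apply Ct_minus|]; repeat apply Ct_mult; auto.
    apply Ct_plus; [apply Ct_dth; auto|apply Ct_mult; auto].
Qed.

(** The right-hand side contains no t-derivatives, so it inherits those of the state, and the
    integral equation then returns the state with one more. *)
Lemma u_Ct n : forall I, (I < N)%nat ->
  Ct Om n (sv u I) /\ Ct Om n (sx u I) /\ Ct Om n (sz u I) /\ Ct Om n (sy u I).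
Proof.
  induction n as [|n IH]; intros I HI.
  - destruct (Cu I HI) as (C1 & C2 & C3 & C4). split4; eapply OO_sm; eauto.
  - destruct (src_Ct n IH I HI) as (S1 & S2 & S3 & S4).
    destruct (src_In16 N kk OO_kk Hkb' u Cu I HI) as (A1 & A2 & A3 & A4).
    destruct (Fu I HI) as (F1 & F2 & F3 & F4). destruct (base_Ct (S n) I HI) as (B2 & B3 & B4).
    split4.
    + apply (Ct_ext (S n) (fun t th => (fun _ _ => 0) t th + J 0 (sv (fuchs_rhs N kk u) I) t th)); [apply on_sym; exact F1|].
      apply Ct_plus; [apply Ct_const|apply Ct_J0; auto].
    + apply (Ct_ext (S n) (fun t th => sx base I t th + J 0 (sx (fuchs_rhs N kk u) I) t th)); [apply on_sym; exact F2|].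
      apply Ct_plus; [auto|apply Ct_J0; auto].
    + apply (Ct_ext (S n) (fun t th => sz base I t th + J 0 (sz (fuchs_rhs N kk u) I) t th)); [apply on_sym; exact F3|].
      apply Ct_plus; [auto|apply Ct_J0; auto].
    + apply (Ct_ext (S n) (fun t th => sy base I t th + J 0 (sy (fuchs_rhs N kk u) I) t th)); [apply on_sym; exact F4|].
      apply Ct_plus; [auto|apply Ct_J0; auto].
Qed.

Definition PP (I : nat) : R -> R -> R := fun t th => p0 I th * ln t + p1 I th + J 0 (sv u I) t th.
(** The bounded part of the exponent: P + P_I = k ln t + [Lam]. *)
Definition Lam (I : nat) : R -> R -> R := SS N (fun i t th => p1 i th + J 0 (sv u i) t th) I.
(** The function DQ expressed through z, that is t^k e^(P + P_I) z. *)
Definition hh (I : nat) : R -> R -> R :=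
  fun t th => Rpower t (2 * kk I th) * (exp (Lam I t th) * sz u I t th).
Definition QQ (I : nat) : R -> R -> R := fun t th => q0 I th + J 0 (hh I) t th.

Lemma sv_J I : (I < N)%nat -> OO Om (/ 16) (sv u I).
Proof. intros HI. eapply OO_weak; [|apply Cu; auto]. lra. Qed.

Lemma SS_PP I t th : SS N PP I t th = kk I th * ln t + Lam I t th.
Proof.
  unfold SS, PP, Lam, SS, kk, kI.
  rewrite (sumI_ext N (fun i => p0 i th * ln t + p1 i th + J 0 (sv u i) t th)
    (fun i => ln t * p0 i th + 1 * (p1 i th + J 0 (sv u i) t th))) by (intros; ring).
  rewrite sumI_lin. ring.
Qed.

Lemma Lam_split I t th : Lam I t th = Sp1 I th + SS N (fun i => J 0 (sv u i)) I t th.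
Proof. unfold Lam, SS, Sp1. rewrite sumI_plus. ring. Qed.

Lemma OO_Lam I : (I < N)%nat -> OO Om 0 (Lam I).
Proof.
  intros HI. apply OO_SS; auto. intros J HJ. apply OO_plus.
  - apply OO_smooth1, smooth_p1; auto.
  - eapply OO_weak; [|apply (J_OO 0 Rabs_0_le_1 (/ 8)); [lra|apply Cu; auto]]. lra.
Qed.

Lemma hasD_PP I : (I < N)%nat -> hasD Om (PP I) (fun t th => p0 I th + sv u I t th).
Proof.
  intros HI. eapply hasD_on; [intros t th _; reflexivity| |apply (hasD_plus _ _ _ _ (hasD_plus _ _ _ _
    (hasD_mult _ _ _ _ (hasD_th (p0 I)) hasD_ln) (hasD_th (p1 I))) (hasD_J0 _ (sv_J I HI)))].
  intros t th _; simpl; ring.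
Qed.

Lemma sm_th g : smooth1 g -> sm Om (fun _ th => g th).
Proof. intros; eapply OO_sm, OO_smooth1; auto. Qed.

Lemma PP_sm I : (I < N)%nat -> sm Om (PP I).
Proof.
  intros HI. destruct (Hdata I HI) as (S1 & S2 & _).
  apply sm_plus; [apply sm_plus|apply (J_sm 0 Rabs_0_le_1), sv_J; auto].
  - apply (sm_mult (fun _ th => p0 I th) (fun t _ => ln t)); [apply sm_th; auto|apply sm_ln].
  - apply sm_th; auto.
Qed.

(** A compatibility condition, since x was constructed independently of P. It holds because the x
    row integrates v': both sides equal p0' ln t + p1' + J (v'). *)
Lemma dth_PP I : (I < N)%nat -> eq_on Om (dth (PP I)) (sx u I).
Proof.
  intros HI t th Ht. destruct (Hdata I HI) as (S1 & S2 & _).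
  destruct (Fu I HI) as (_ & F2 & _). rewrite F2 by auto. simpl. apply is_derive_unique.
  apply @is_derive_plus; [apply @is_derive_plus|].
  - evar_last; [apply (is_derive_scal_l (p0 I) th (Derive (p0 I) th) (ln t)), Derive_correct, smooth1_ex; auto|].
    unfold scal; simpl; unfold mult; simpl. reflexivity.
  - apply Derive_correct, smooth1_ex; auto.
  - apply (J_dth 0 Rabs_0_le_1); auto. apply sv_J; auto.
Qed.

Lemma hasD_Lam I : (I < N)%nat -> hasD Om (Lam I) (SS N (sv u) I).
Proof.
  intros HI. apply hasD_SS; auto. intros J HJ.
  eapply hasD_on; [intros t th _; reflexivity| |apply (hasD_plus _ _ _ _ (hasD_th (p1 J)) (hasD_J0 _ (sv_J J HJ)))].
  intros t th _; simpl; ring.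
Qed.

Lemma dth_Lam I : (I < N)%nat -> eq_on Om (dth (Lam I))
  (fun t th => SS N (sx u) I t th - Derive (kk I) th * ln t).
Proof.
  intros HI t th Ht.
  assert (E : eq_on Om (Lam I) (fun t th => SS N PP I t th - kk I th * ln t)).
  { intros s x _. rewrite SS_PP. ring. }
  rewrite (dth_ext _ _ E t th Ht).
  assert (S1 : sm Om (SS N PP I)).
  { apply (sm_plus (fun t th => sumI N (fun J => PP J t th)) (PP I)); [|apply PP_sm; auto].
    apply (sumI_closed (sm Om)); [apply sm_const|apply sm_plus|apply PP_sm]. }
  assert (S2 : sm Om (fun t th => kk I th * ln t)).
  { apply (sm_mult (fun _ th => kk I th) (fun t _ => ln t)); [eapply OO_sm, OO_kk; auto|apply sm_ln]. }
  rewrite (dth_minus _ _ S1 S2 t th Ht), (dth_SS N PP I t th HI Ht PP_sm).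
  f_equal.
  - unfold SS. rewrite dth_PP by auto. f_equal. apply sumI_ext. intros J HJ. apply dth_PP; auto.
  - apply Derive_scal_l.
Qed.

Lemma OO_hh I : (I < N)%nat -> OO Om (3 / 4) (hh I).
Proof.
  intros HI. eapply OO_mult; [apply (OO_t2k N kk OO_kk Hkb' I HI)| |].
  - apply OO_mult0; [apply OO_exp0, OO_Lam; auto|apply Cu; auto].
  - lra.
Qed.

Lemma hasD_QQ I : (I < N)%nat -> hasD Om (QQ I) (hh I).
Proof.
  intros HI. assert (H : OO Om (/ 16) (hh I)) by (eapply OO_weak; [|apply OO_hh; auto]; lra).
  eapply hasD_on; [intros t th _; reflexivity| |apply (hasD_plus _ _ _ _ (hasD_th (q0 I)) (hasD_J0 _ H))].
  intros t th _; simpl; ring.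
Qed.

Lemma exp_Lam_near I : (I < N)%nat -> OO Om (/ 16) (fun t th => exp (Lam I t th) - exp (Sp1 I th)).
Proof.
  intros HI. apply (OO_ext (/ 16) (fun t th => exp (Sp1 I th) * (exp (SS N (fun i => J 0 (sv u i)) I t th) - 1))).
  - intros t th _. rewrite Lam_split, exp_plus. ring.
  - apply (OO_mult 0 (/ 16) (/ 16) (fun _ th => exp (Sp1 I th))); [apply (OO_exp0 (fun _ th => Sp1 I th)), OO_Sp1; auto| |lra].
    apply OO_exp_minus_1; [lra|]. apply OO_SS; auto. intros J HJ.
    apply (J_OO 0 Rabs_0_le_1); [lra|apply sv_J; auto].
Qed.

(** The compatibility of y with Q. By the y row, e^Lam y - q0' has D-derivative [dth (hh I)], and it
    vanishes at t = 0, so [J0_unique] identifies it with the theta-derivative of the integral in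
    [QQ]. *)
Lemma dth_QQ I : (I < N)%nat -> eq_on Om (dth (QQ I)) (fun t th => exp (Lam I t th) * sy u I t th).
Proof.
  intros HI. destruct (Hdata I HI) as (_ & _ & S3 & _).
  assert (H : OO Om (/ 16) (hh I)) by (eapply OO_weak; [|apply OO_hh; auto]; lra).
  destruct (Cu I HI) as (C1 & C2 & C3 & C4). destruct (u_D I HI) as (D1 & D2 & D3 & D4).
  assert (SL : sm Om (Lam I)) by (eapply OO_sm, OO_Lam; auto).
  assert (Sk2 : sm Om (fun _ th => 2 * kk I th)).
  { apply (sm_scal 2 (fun _ th => kk I th)). eapply OO_sm, OO_kk; auto. }
  assert (E : eq_on Om (fun t th => exp (Lam I t th) * sy u I t th - Derive (q0 I) th) (J 0 (dth (hh I)))).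
  { apply J0_unique.
    - apply OO_dth; auto.
    - apply (hasD_on (fun t th => exp (Lam I t th) * sy u I t th - Derive (q0 I) th) (fun t th => exp (Lam I t th) * sy u I t th - Derive (q0 I) th) _ 
        (fun t th => SS N (sv u) I t th * exp (Lam I t th) * sy u I t th
          + exp (Lam I t th) * sy (fuchs_rhs N kk u) I t th - 0)); [intros t th _; reflexivity| |].
      + intros t th Ht. unfold hh.
        rewrite (dth_mult (fun t th => Rpower t (2 * kk I th)) (fun t th => exp (Lam I t th) * sz u I t th)
          (sm_tpow (fun th => 2 * kk I th) Sk2) (sm_mult _ _ (sm_exp _ SL) (OO_sm _ _ C3)) t th Ht).
        rewrite (dth_tpow (fun th => 2 * kk I th) Sk2 t th Ht).
        rewrite (dth_mult (fun t th => exp (Lam I t th)) (sz u I) (sm_exp _ SL) (OO_sm _ _ C3) t th Ht).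
        rewrite (dth_exp _ SL t th Ht), (dth_Lam I HI t th Ht), Derive_scal. simpl. ring.
      + apply hasD_minus; [apply hasD_mult; [apply hasD_exp, hasD_Lam; auto|auto]|].
        apply (hasD_th (Derive (q0 I))).
    - apply (tends0_OO (/ 16)); [lra|].
      destruct (u_near I HI) as (_ & _ & _ & N4).
      apply (OO_ext (/ 16) (fun t th => (exp (Lam I t th) - exp (Sp1 I th)) * sy u I t th
         + exp (Sp1 I th) * (sy u I t th - sy base I t th))).
      + intros t th _. simpl. rewrite exp_Ropp. field. apply Rgt_not_eq, exp_pos.
      + apply OO_plus.
        * eapply OO_mult; [apply exp_Lam_near; auto|exact C4|lra].
        * apply (OO_mult 0 (/ 16) (/ 16) (fun _ th => exp (Sp1 I th))); [|exact N4|lra].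
          apply (OO_exp0 (fun _ th => Sp1 I th)), OO_Sp1; auto. }
  intros t th Ht. specialize (E t th Ht). cbv beta in E.
  replace (exp (Lam I t th) * sy u I t th) with (Derive (q0 I) th + J 0 (dth (hh I)) t th) by lra.
  apply is_derive_unique. apply @is_derive_plus; [apply Derive_correct, smooth1_ex; auto|].
  apply (J_dth 0 Rabs_0_le_1); auto.
Qed.

Theorem recovered_equations I t th : (I < N)%nat -> Om t th ->
  Dop (Dop (PP I)) t th - t ^ 2 * dth (dth (PP I)) t th
    = - / 2 * exp (- 2 * SS N PP I t th) * ((Dop (QQ I) t th) ^ 2 - (t * dth (QQ I) t th) ^ 2) /\
  Dop (Dop (QQ I)) t th - t ^ 2 * dth (dth (QQ I)) t th
    = 2 * (Dop (SS N PP I) t th * Dop (QQ I) t th - t ^ 2 * dth (SS N PP I) t th * dth (QQ I) t th).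
Proof.
  intros HI Ht. destruct (good_pos _ _ Ht) as [H0 _].
  destruct (Cu I HI) as (C1 & C2 & C3 & C4). destruct (u_D I HI) as (D1 & D2 & D3 & D4).
  assert (SL : sm Om (Lam I)) by (eapply OO_sm, OO_Lam; auto).
  pose proof (hasD_Dop _ _ (hasD_PP I HI)) as E1.
  assert (E2 : Dop (Dop (PP I)) t th = sv (fuchs_rhs N kk u) I t th).
  { rewrite (Dop_ext _ _ E1 t th Ht).
    rewrite (hasD_Dop _ _ (hasD_plus _ _ _ _ (hasD_th (p0 I)) D1) t th Ht). ring. }
  pose proof (hasD_Dop _ _ (hasD_QQ I HI)) as E3.
  assert (E4 : Dop (Dop (QQ I)) t th = 2 * kk I th * Rpower t (2 * kk I th) * (exp (Lam I t th) * sz u I t th)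
     + Rpower t (2 * kk I th) * (SS N (sv u) I t th * exp (Lam I t th) * sz u I t th
         + exp (Lam I t th) * sz (fuchs_rhs N kk u) I t th)).
  { rewrite (Dop_ext _ _ E3 t th Ht).
    exact (hasD_Dop _ _ (hasD_mult _ _ _ _ (hasD_tpow (fun th => 2 * kk I th))
      (hasD_mult _ _ _ _ (hasD_exp _ _ (hasD_Lam I HI)) D3)) t th Ht). }
  assert (E5 : dth (dth (QQ I)) t th = (SS N (sx u) I t th - Derive (kk I) th * ln t) * exp (Lam I t th) * sy u I t th
     + exp (Lam I t th) * dth (sy u I) t th).
  { rewrite (dth_ext _ _ (dth_QQ I HI) t th Ht).
    rewrite (dth_mult (fun t th => exp (Lam I t th)) (sy u I) (sm_exp _ SL) (OO_sm _ _ C4) t th Ht).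
    rewrite (dth_exp _ SL t th Ht), (dth_Lam I HI t th Ht). ring. }
  assert (E6 : Dop (SS N PP I) t th = kk I th + SS N (sv u) I t th).
  { rewrite (hasD_Dop _ _ (hasD_SS N PP (fun J t th => p0 J th + sv u J t th) I HI hasD_PP) t th Ht).
    unfold SS, kk, kI. rewrite sumI_plus. ring. }
  assert (E7 : dth (SS N PP I) t th = SS N (sx u) I t th).
  { rewrite (dth_SS N PP I t th HI Ht PP_sm). unfold SS. rewrite dth_PP by auto. f_equal.
    apply sumI_ext. intros J HJ. apply dth_PP; auto. }
  rewrite E2, E4, E5, E6, E7, (dth_ext _ _ (dth_PP I HI) t th Ht), E3, (dth_QQ I HI t th Ht) by auto.
  rewrite SS_PP. unfold hh.
  (* All derivatives are now expressed through the state. Writing e^(-2(P + P_I)) as t^(-2k) e^(-2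
     Lam) clears the weights, and both equations become rational identities. *)
  assert (E8 : exp (- 2 * (kk I th * ln t + Lam I t th))
     = / Rpower t (2 * kk I th) * / (exp (Lam I t th) * exp (Lam I t th))).
  { rewrite <- exp_plus. unfold Rpower. rewrite <- !exp_Ropp, <- exp_plus. f_equal. ring. }
  assert (E9 : Rpower t (2 - 2 * kk I th) = t * t * / Rpower t (2 * kk I th)).
  { replace (2 - 2 * kk I th) with (1 + 1 + - (2 * kk I th)) by ring.
    rewrite !Rpower_plus, Rpower_Ropp, Rpower_1 by auto. ring. }
  rewrite E8. simpl. rewrite E9.
  pose proof (Rpower_pos t (2 * kk I th)) as Pa. set (a := Rpower t (2 * kk I th)) in *.
  pose proof (exp_pos (Lam I t th)) as PL. set (L := exp (Lam I t th)) in *.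
  split; field; lra.
Qed.

End Data.

(** * Reciprocals and choices over finitely many indices *)

Section Inverse.
Context {Om : R -> R -> Prop} {HOm : good Om}.

Lemma dth_inv f : sm Om f -> (forall t th, Om t th -> f t th <> 0) ->
  eq_on Om (dth (fun t th => / f t th)) (fun t th => - (dth f t th * (/ f t th * / f t th))).
Proof.
  intros Hf H0 t th Ht. apply is_derive_unique.
  evar_last; [apply is_derive_inv; [apply (sm_is _ Hf t th Ht)|auto]|]. simpl. field; auto.
Qed.

Lemma sm_inv f : sm Om f -> (forall t th, Om t th -> f t th <> 0) -> sm Om (fun t th => / f t th).
Proof.
  intros Hf H0 n; induction n as [|n IH].
  - intros t th Ht. apply continuity_2d_pt_inv; [apply (@sm_c Om)|]; auto.
  - split.
    + intros t th Ht. split; [apply continuity_2d_pt_inv; [apply (@sm_c Om)|]; auto|].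
      apply ex_derive_inv; [apply (@sm_ex Om); auto|auto].
    + eapply smn_ext; [apply on_sym, dth_inv; auto|].
      apply (smn_ext n (fun t th => (-1) * (dth f t th * (/ f t th * / f t th)))); [intros t th _; ring|].
      apply (smn_mult n (fun _ _ => -1)); [apply (sm_const (-1) n)|].
      apply smn_mult; [apply (Hf (S n))|apply smn_mult; auto].
Qed.

Lemma OO_inv m0 f : 0 < m0 -> OO Om 0 f -> (forall t th, Om t th -> m0 <= f t th) ->
  OO Om 0 (fun t th => / f t th).
Proof.
  intros Hc Hf Hb. assert (Hs := OO_sm _ _ Hf).
  assert (H0 : forall t th, Om t th -> f t th <> 0) by (intros t th Ht; specialize (Hb t th Ht); lra).
  intros n; induction n as [|n [C IH]].
  - exists (/ m0). split; [apply sm_inv; auto|].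
    assert (0 < / m0) by (apply Rinv_0_lt_compat; auto). split; [lra|].
    intros t th Ht. rewrite (Rpower_0_1 t th Ht), Rmult_1_r.
    specialize (Hb t th Ht). rewrite Rabs_right; [apply Rinv_le_contravar; auto|].
    left. apply Rinv_0_lt_compat. lra.
  - destruct (OO_dth _ _ Hf n) as [D HD].
    exists (C + 1 * (D * (C * C))), C, (D * (C * C)). repeat split; auto; [|lra].
    eapply bnd_ext; [apply on_sym, dth_inv; auto|]. apply bnd_opp.
    rewrite <- (Rplus_0_l 0). apply bnd_mult; [lra|auto|].
    rewrite <- (Rplus_0_l 0). apply bnd_mult; auto; lra.
Qed.

End Inverse.

Lemma argmax N (a : nat -> R) : (0 < N)%nat -> exists j, (j < N)%nat /\ forall i, (i < N)%nat -> a i <= a j.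
Proof.
  induction N as [|N IH]; [lia|]. intros _.
  destruct N as [|N].
  - exists 0%nat. split; [lia|]. intros i Hi. replace i with 0%nat by lia. lra.
  - destruct IH as (j & Hj & H); [lia|].
    destruct (Rle_dec (a j) (a (S N))) as [L|L].
    + exists (S N). split; [lia|]. intros i Hi. destruct (Nat.eq_dec i (S N)) as [->|]; [lra|].
      eapply Rle_trans; [apply H; lia|auto].
    + exists j. split; [lia|]. intros i Hi. destruct (Nat.eq_dec i (S N)) as [->|]; [lra|]. apply H; lia.
Qed.

Lemma fin_delta N (Q : nat -> R -> Prop) c :
  (forall J, (J < N)%nat -> exists d, 0 < d /\ forall th, Rabs (th - c) < d -> Q J th) ->
  exists d, 0 < d /\ forall J th, (J < N)%nat -> Rabs (th - c) < d -> Q J th.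
Proof.
  induction N as [|N IH]; intros H; [exists 1; split; [lra|lia]|].
  destruct IH as (d & Hd & Hd'); [intros; apply H; lia|].
  destruct (H N) as (e & He & He'); [lia|].
  exists (Rmin d e). split; [apply Rmin_pos; auto|]. intros J th HJ Hth.
  pose proof (Rmin_l d e). pose proof (Rmin_r d e).
  destruct (Nat.eq_dec J N) as [->|]; [apply He'; lra|apply Hd'; [lia|lra]].
Qed.

(** * The asymptotic expansion *)

Section Expansion.
Context (N : nat) (p0 p1 q0 q1 : nat -> R -> R) (eps : nat -> R) (c : R).
Context (HN : (0 < N)%nat).
Context (Hdata : forall I, (I < N)%nat ->
  smooth1 (p0 I) /\ smooth1 (p1 I) /\ smooth1 (q0 I) /\ smooth1 (q1 I)).
Context (Hkb : forall I th, (I < N)%nat -> / 2 < kk N p0 I th < 5 / 6).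
Context (Heps : forall I J th, (I < N)%nat -> (J < N)%nat ->
  2 * (kk N p0 I th + kk N p0 J th) - 3 < eps J /\
  eps J < Rmin (2 * kk N p0 I th - 1) (2 - 2 * kk N p0 I th)).

Notation k := (kk N p0).

(** The rate [m] will be that of v and of the error of y. The remainder of P_J contains t^(2k) z^2,
    of order nearly 1, and t^(2-2k) times the error of y. So 2 - 2 k_J + eps_J must stay below 1,
    which is eps_J < 2 k_J - 1, and eps_J below m. As y involves all v_I, m must lie below every 2 -
    2 k_I, which is where eps_J < 2 - 2 k_I for all pairs enters. The last inequality follows from
    eps_J > 4 k_J - 3 and k_J > 1/2. *)
Lemma margins : exists m s, 0 < s /\ / 4 <= m < 1 /\ forall J, (J < N)%nat ->
  eps J + 4 * s <= m /\ m + 2 * s <= 2 - 2 * k J c /\ (2 - 2 * k J c) + eps J + 4 * s <= 1 /\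
  0 < (2 - 2 * k J c) + eps J.
Proof.
  destruct (argmax N eps HN) as (j & Hj & Mj).
  destruct (argmax N (fun J => k J c) HN) as (i & Hi & Mi).
  destruct (argmax N (fun J => eps J - 2 * k J c) HN) as (l & Hl & Ml).
  (* The rate m is the midpoint between A and the smallest 2 - 2 k_J at [c], attained at index i.
     The floor 1/4 keeps m in the range of [J_OO] also when the eps_J are small or negative. *)
  set (A := Rmax (eps j) (/ 4)).
  assert (HA : A < 2 - 2 * k i c).
  { unfold A. apply Rmax_lub_lt.
    - eapply Rlt_le_trans; [apply (Heps i j c Hi Hj)|apply Rmin_r].
    - specialize (Hkb i c Hi). lra. }
  assert (HA1 : eps j <= A) by apply Rmax_l. assert (HA2 : / 4 <= A) by apply Rmax_r.
  set (g1 := 2 - 2 * k i c - A). set (g2 := 1 - (2 - 2 * k l c + eps l)).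
  assert (Hg1 : 0 < g1) by (unfold g1; lra).
  assert (Hg2 : 0 < g2).
  { unfold g2. destruct (Heps l l c Hl Hl) as [_ H]. pose proof (Rmin_l (2 * k l c - 1) (2 - 2 * k l c)). lra. }
  exists (A + g1 / 2), (Rmin (g1 / 8) (g2 / 4)).
  pose proof (Rmin_l (g1 / 8) (g2 / 4)). pose proof (Rmin_r (g1 / 8) (g2 / 4)).
  pose proof (Hkb i c Hi).
  split; [apply Rmin_pos; lra|]. split; [unfold g1 in *; lra|].
  intros J HJ. specialize (Mj J HJ). specialize (Mi J HJ). specialize (Ml J HJ). cbv beta in *.
  destruct (Heps J J c HJ HJ) as [H' _]. pose proof (Hkb J c HJ).
  repeat split; unfold g1, g2 in *; lra.
Qed.

Lemma k_near d : 0 < d -> exists r, 0 < r /\ forall J th, (J < N)%nat -> Rabs (th - c) < r ->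
  Rabs (k J th - k J c) < d.
Proof.
  intros Hd. apply (fin_delta N (fun J th => Rabs (k J th - k J c) < d)). intros J HJ.
  assert (Hc : continuity_pt (k J) c).
  { apply derivable_continuous_pt, ex_derive_Reals_0. unfold kk, kI. eexists.
    apply @is_derive_plus.
    - apply (sumI_is_derive N p0 (fun J => Derive (p0 J) c)). intros i Hi.
      apply Derive_correct, smooth1_ex, (smooth_p0 N p0 p1 q0 q1 Hdata); auto.
    - apply Derive_correct, smooth1_ex, (smooth_p0 N p0 p1 q0 q1 Hdata); auto. }
  destruct (Hc d Hd) as (e & He & H). exists e. split; auto. intros th Hth.
  destruct (Req_dec th c) as [->|Hne]; [rewrite Rminus_diag, Rabs_R0; auto|].
  apply H. split; [split; [exact Logic.I|auto]|exact Hth].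
Qed.

Context {Om : R -> R -> Prop} {HOm : good Om}.
Context (m s : R) (Hs : 0 < s) (Hm : / 4 <= m < 1).
Context (Hms : forall J, (J < N)%nat ->
  eps J + 4 * s <= m /\ m + 2 * s <= 2 - 2 * k J c /\ (2 - 2 * k J c) + eps J + 4 * s <= 1 /\
  0 < (2 - 2 * k J c) + eps J).
Context (Hnear : forall J t th, (J < N)%nat -> Om t th -> Rabs (k J th - k J c) < Rmin (s / 8) (/ 256)).
Context (u : state) (Cu : admissible Om N u) (Fu : fixed_point Om N k (base N p0 p1 q0 q1) u).

Notation HOOk := (OO_kk N p0 p1 q0 q1 Hdata).

Lemma near1 J t th : (J < N)%nat -> Om t th -> - (s / 8) < k J th - k J c < s / 8 /\
  - / 256 < k J th - k J c < / 256.
Proof.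
  intros HJ Ht. pose proof (Hnear J t th HJ Ht) as H.
  pose proof (Rmin_l (s / 8) (/ 256)). pose proof (Rmin_r (s / 8) (/ 256)).
  apply Rabs_lt_between in H. lra.
Qed.

Lemma OO_affine a b I : (I < N)%nat -> OO Om 0 (fun _ th => a + b * k I th).
Proof. intros HI. apply (OO_affine_k N k HOOk); auto. Qed.

Lemma OO_tb1 I : (I < N)%nat -> OO Om (2 - 2 * k I c - s) (fun t th => Rpower t (2 - 2 * k I th)).
Proof.
  intros HI. apply (OO_tpow (fun th => 2 - 2 * k I th) _ (s / 2)); [|lra|].
  - eapply OO_ext; [|apply (OO_affine 2 (-2) I HI)]. intros t th _; ring.
  - intros t th Ht. destruct (near1 I t th HI Ht). lra.
Qed.

Lemma OO_tbm I : (I < N)%nat -> OO Om m (fun t th => Rpower t (2 - 2 * k I th)).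
Proof.
  intros HI. eapply OO_weak; [|apply OO_tb1; auto]. specialize (Hms I HI). lra.
Qed.

Lemma OO_t2k1 I e : (I < N)%nat -> 0 < e -> OO Om (1 - e) (fun t th => Rpower t (2 * k I th)).
Proof.
  intros HI He. apply (OO_tpow (fun th => 2 * k I th) _ e); [|lra|].
  - eapply OO_ext; [|apply (OO_affine 0 2 I HI)]. intros t th _; ring.
  - intros t th Ht. specialize (Hkb I th HI). lra.
Qed.

Lemma OO_kln1 I e : (I < N)%nat -> 0 < e -> OO Om (- e) (fun t th => Derive (k I) th * ln t).
Proof.
  intros HI He. apply (OO_mult 0 (- e) (- e) (fun _ th => Derive (k I) th) (fun t _ => ln t)); [|apply OO_ln; auto|lra].
  apply (OO_dth 0 (fun _ th => k I th)), HOOk; auto.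
Qed.

Lemma OO_x I e : (I < N)%nat -> 0 < e -> OO Om (- e) (sx u I).
Proof.
  intros HI He. destruct (Hdata I HI) as (S1 & S2 & _).
  destruct (u_near N p0 p1 q0 q1 Hdata Hkb u Cu Fu I HI) as (_ & N2 & _).
  apply (OO_ext (- e) (fun t th => (sx u I t th - sx (base N p0 p1 q0 q1) I t th) + sx (base N p0 p1 q0 q1) I t th)).
  { intros t th _; ring. }
  apply OO_plus; [eapply OO_weak; [|exact N2]; lra|]. simpl. apply OO_plus.
  - apply (OO_mult 0 (- e) (- e) (fun _ th => dp0 p0 I th) (fun t _ => ln t)); [|apply OO_ln; lra|lra].
    apply (OO_smooth1 (dp0 p0 I)), smooth1_Derive; auto.
  - eapply OO_weak; [|apply (OO_smooth1 (Derive (p1 I))), smooth1_Derive; auto]. lra.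
Qed.

(** One more pass through the v row, now with the exponents at [c]: the worst term is t^(2-2k) y^2,
    which is O(t^m). The uniform rate 5/16 would be too weak for the larger admissible eps_I. *)
Lemma OO_v I : (I < N)%nat -> OO Om m (sv u I).
Proof.
  intros HI. destruct (Cu I HI) as (C1 & C2 & C3 & C4). destruct (Fu I HI) as (F1 & _).
  apply (OO_ext m (J 0 (sv (fuchs_rhs N k u) I))); [intros t th Ht; rewrite F1 by auto; simpl; ring|].
  apply (J_OO 0 Rabs_0_le_1); [lra|]. simpl. apply OO_minus.
  - eapply OO_mult; [apply OO_tt|apply OO_dth; exact C2|lra].
  - apply (OO_scal m (/ 2)). apply OO_minus.
    + eapply OO_mult; [apply (OO_t2k1 I (1 - m)); auto; lra|apply (OO_mult0 _ _ C3 C3)|lra].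
    + eapply OO_mult; [apply OO_tbm; auto|apply (OO_mult0 _ _ C4 C4)|lra].
Qed.

Lemma OO_y I : (I < N)%nat -> OO Om m (fun t th => sy u I t th - sy (base N p0 p1 q0 q1) I t th).
Proof.
  intros HI. destruct (Cu I HI) as (C1 & C2 & C3 & C4). destruct (Fu I HI) as (_ & _ & _ & F4).
  apply (OO_ext m (J 0 (sy (fuchs_rhs N k u) I))); [intros t th Ht; rewrite F4 by auto; simpl; ring|].
  assert (T : OO Om ((1 + m) / 2) (fun t th => Rpower t (2 * k I th))).
  { replace ((1 + m) / 2) with (1 - (1 - m) / 2) by field. apply OO_t2k1; auto; lra. }
  assert (Hm2 : 0 < (1 - m) / 2) by lra.
  apply (J_OO 0 Rabs_0_le_1); [lra|]. simpl. apply OO_plus; [apply OO_minus|].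
  - eapply OO_mult; [exact T| |].
    + apply (OO_plus (- ((1 - m) / 2))).
      * eapply OO_weak; [|apply OO_dth; exact C3]. lra.
      * eapply OO_mult; [apply (OO_kln1 I _ HI Hm2)|exact C3|lra].
    + lra.
  - eapply OO_mult; [apply (OO_SS N m (sv u) I HI OO_v)|exact C4|lra].
  - eapply OO_mult; [exact T| |].
    + eapply (OO_mult (- ((1 - m) / 2)) 0); [|exact C3|apply Rle_refl].
      apply OO_SS; auto. intros J HJ. apply OO_x; auto.
    + lra.
Qed.

Notation al := (alphaI N p0 p1 q0).

Lemma OO_alpha I : (I < N)%nat -> OO Om 0 (fun _ th => al I th).
Proof.
  intros HI. destruct (Hdata I HI) as (S1 & S2 & S3 & S4).
  assert (D : OO Om 0 (fun _ th => Derive (q0 I) th * / (2 - 2 * k I th))).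
  { apply (OO_mult0 (fun _ th => Derive (q0 I) th) (fun _ th => / (2 - 2 * k I th))).
    - apply (OO_smooth1 (Derive (q0 I))), smooth1_Derive; auto.
    - apply (OO_inv (/ 3) (fun _ th => 2 - 2 * k I th)); [lra| |].
      + eapply OO_ext; [|apply (OO_affine 2 (-2) I HI)]. intros t th _; ring.
      + intros t th _. specialize (Hkb I th HI). lra. }
  pose proof (OO_expSp1 N p0 p1 q0 q1 Hdata I HI) as X.
  apply (OO_ext 0 (fun _ th => / 2 * ((Derive (q0 I) th * / (2 - 2 * k I th)) * (Derive (q0 I) th * / (2 - 2 * k I th))
     * (exp (- Sp1 N p1 I th) * exp (- Sp1 N p1 I th))))).
  - intros t th _. unfold alphaI. simpl. rewrite <- exp_plus. unfold Rdiv, kk, Sp1.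
    replace (- 2 * (p1 I th + sumI N (fun J => p1 J th)))
      with (- (sumI N (fun J => p1 J th) + p1 I th) + - (sumI N (fun J => p1 J th) + p1 I th)) by ring.
    ring.
  - apply (OO_scal 0 (/ 2)
      (fun _ th => ((Derive (q0 I) th * / (2 - 2 * k I th)) * (Derive (q0 I) th * / (2 - 2 * k I th)))
        * (exp (- Sp1 N p1 I th) * exp (- Sp1 N p1 I th)))).
    apply (OO_mult0 (fun _ th => (Derive (q0 I) th * / (2 - 2 * k I th)) * (Derive (q0 I) th * / (2 - 2 * k I th)))
      (fun _ th => exp (- Sp1 N p1 I th) * exp (- Sp1 N p1 I th))).
    + exact (OO_mult0 _ _ D D).
    + exact (OO_mult0 _ _ X X).
Qed.

(** The origin of alpha: integrating the leading term t^(2-2k) y^2 / 2 of D^2 P twice against dt/t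
    divides it by (2 - 2k)^2. The argument 0 stands for any time, since [sy] of [base] does not
    depend on t. *)
Lemma alpha_eq I th : (I < N)%nat -> (2 - 2 * k I th) * ((2 - 2 * k I th) * al I th)
  = / 2 * (sy (base N p0 p1 q0 q1) I 0 th * sy (base N p0 p1 q0 q1) I 0 th).
Proof.
  intros HI. specialize (Hkb I th HI). unfold alphaI. simpl.
  replace (exp (- 2 * (p1 I th + sumI N (fun J => p1 J th))))
    with (exp (- Sp1 N p1 I th) * exp (- Sp1 N p1 I th)) by (rewrite <- exp_plus; f_equal; unfold Sp1; ring).
  change (kI N p0 I th) with (k I th). field. lra.
Qed.

Lemma Pexp I : (I < N)%nat -> OO Om (2 - 2 * k I c + eps I + 3 * s)
  (fun t th => J 0 (sv u I) t th - al I th * Rpower t (2 - 2 * k I th)).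
Proof.
  intros HI. destruct (Cu I HI) as (C1 & C2 & C3 & C4). destruct (Hms I HI) as (M1 & M2 & M3 & M4).
  pose proof (Hkb I c HI) as HIc.
  destruct (u_D N p0 p1 q0 q1 Hdata Hkb u Cu Fu I HI) as (D1 & _).
  set (b := sy (base N p0 p1 q0 q1) I).
  (* What is left of the v row without its leading term: t^2 x', the term t^(2k) z^2, and t^(2-2k)
     times the difference of y^2 from its leading value. *)
  set (Rs := fun t th => sv (fuchs_rhs N k u) I t th - / 2 * (Rpower t (2 - 2 * k I th) * (b t th * b t th))).
  assert (Sb : OO Om 0 b) by (apply (base_Cls N p0 p1 q0 q1 Hdata); auto).
  pose proof (OO_y I HI) as Hy. fold b in Hy.
  (* The exponent wanted here is only known to be positive. The separate rate 1/16 is what makes the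
     integrals converge; the bound with the wanted exponent then passes through [J_bnd]. *)
  assert (HR : OO Om (2 - 2 * k I c + eps I + 3 * s) Rs /\ OO Om (/ 16) Rs).
  { assert (X : forall nu, nu <= 1 - s -> nu <= 2 - 2 * k I c - s + m -> OO Om nu Rs).
    { intros nu H1 H2.
      apply (OO_ext nu (fun t th => (t * t * dth (sx u I) t th
        - / 2 * (Rpower t (2 * k I th) * (sz u I t th * sz u I t th)))
        + / 2 * (Rpower t (2 - 2 * k I th) * (sy u I t th * sy u I t th - b t th * b t th)))).
      - intros t th _. unfold Rs; simpl. ring.
      - apply OO_plus; [apply OO_minus|].
        + eapply OO_mult; [apply OO_tt|apply OO_dth; exact C2|lra].
        + apply (OO_scal nu (/ 2)). eapply OO_mult; [apply (OO_t2k1 I s); auto|apply (OO_mult0 _ _ C3 C3)|lra].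
        + apply (OO_scal nu (/ 2)). eapply OO_mult; [apply OO_tb1; auto| |].
          * eapply (OO_mult_diff m 0 0 m m); [exact Hy|exact C4|exact Sb|exact Hy|lra|lra].
          * lra. }
    split; apply X; lra. }
  destruct HR as [HR1 HR2].
  assert (Sal : sm Om (fun _ th => al I th)) by (eapply OO_sm, OO_alpha; auto).
  assert (E1 : eq_on Om (fun t th => sv u I t th - (2 - 2 * k I th) * al I th * Rpower t (2 - 2 * k I th)) (J 0 Rs)).
  { apply J0_unique; [exact HR2| |].
    - eapply hasD_on; [intros t th _; reflexivity| |apply (hasD_minus _ _ _ _ D1
        (hasD_mult _ _ _ _ (hasD_th (fun th => (2 - 2 * k I th) * al I th)) (hasD_tpow (fun th => 2 - 2 * k I th))))].
      intros t th _. unfold Rs. pose proof (alpha_eq I th HI) as AE. change (sy _ I 0 th) with (b t th) in AE.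
      rewrite <- (Rmult_assoc (/ 2)), (Rmult_comm (/ 2)), Rmult_assoc, <- AE. ring.
    - apply (tends0_OO (/ 16)); [lra|]. apply OO_minus; [eapply OO_weak; [|exact C1]; lra|].
      eapply (OO_mult 0 (5 / 16) (/ 16) (fun _ th => (2 - 2 * k I th) * al I th));
        [|apply (OO_tb N k HOOk (Hkb' N p0 Hkb)); auto|lra].
      apply (OO_mult0 (fun _ th => 2 - 2 * k I th) (fun _ th => al I th)); [|apply OO_alpha; auto].
      eapply OO_ext; [|apply (OO_affine 2 (-2) I HI)]. intros t th _; ring. }
  assert (C1' : OO Om (/ 16) (sv u I)) by (eapply OO_weak; [|exact C1]; lra).
  assert (HJR : OO Om (/ 16) (J 0 Rs)) by (apply (J_OO 0 Rabs_0_le_1); auto; lra).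
  assert (E2 : eq_on Om (fun t th => J 0 (sv u I) t th - al I th * Rpower t (2 - 2 * k I th)) (J 0 (J 0 Rs))).
  { apply J0_unique; [exact HJR| |].
    - eapply hasD_on; [intros t th _; reflexivity| |apply (hasD_minus _ _ _ _ (hasD_J0 _ C1')
        (hasD_mult _ _ _ _ (hasD_th (al I)) (hasD_tpow (fun th => 2 - 2 * k I th))))].
      intros t th Ht. rewrite <- E1 by auto. ring.
    - apply (tends0_OO (/ 16)); [lra|]. apply OO_minus; [apply (J_OO 0 Rabs_0_le_1); auto; lra|].
      eapply (OO_mult 0 (5 / 16) (/ 16) (fun _ th => al I th)); [apply OO_alpha; auto|
        apply (OO_tb N k HOOk (Hkb' N p0 Hkb)); auto|lra]. }
  eapply OO_ext; [apply on_sym, E2|].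
  assert (Hnu : 0 < 2 - 2 * k I c + eps I + 3 * s) by lra.
  assert (Jp : forall f, OO Om (/ 16) f -> OO Om (2 - 2 * k I c + eps I + 3 * s) f ->
     OO Om (2 - 2 * k I c + eps I + 3 * s) (J 0 f)).
  { intros f H1 H2 n. destruct (H2 n) as [C HC]. eexists. apply (J_bnd 0 Rabs_0_le_1); eauto. }
  apply Jp; auto.
Qed.

Lemma Qexp I : (I < N)%nat -> OO Om (2 * k I c + / 32 + / 64)
  (fun t th => J 0 (hh N p0 p1 u I) t th - Rpower t (2 * k I th) * q1 I th).
Proof.
  intros HI. destruct (Cu I HI) as (C1 & C2 & C3 & C4). destruct (Hdata I HI) as (S1 & S2 & S3 & S4).
  pose proof (Hkb I c HI) as HIc.
  destruct (u_near N p0 p1 q0 q1 Hdata Hkb u Cu Fu I HI) as (_ & _ & N3 & _).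
  set (g := fun t th => exp (Lam N p1 u I t th) * sz u I t th - 2 * k I th * q1 I th).
  assert (Hg : OO Om (/ 16) g).
  { apply (OO_ext (/ 16) (fun t th => (exp (Lam N p1 u I t th) - exp (Sp1 N p1 I th)) * sz u I t th
         + exp (Sp1 N p1 I th) * (sz u I t th - sz (base N p0 p1 q0 q1) I t th))).
      + intros t th _. unfold g; simpl. rewrite exp_Ropp. field. apply Rgt_not_eq, exp_pos.
      + apply OO_plus.
        * eapply OO_mult; [apply (exp_Lam_near N p0 p1 q0 q1 Hdata u Cu); auto|exact C3|lra].
        * apply (OO_mult 0 (/ 16) (/ 16) (fun _ th => exp (Sp1 N p1 I th))); [|exact N3|lra].
          apply (OO_exp0 (fun _ th => Sp1 N p1 I th)), (OO_Sp1 N p0 p1 q0 q1 Hdata); auto. }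
  assert (T : OO Om (2 * k I c - / 64) (fun t th => Rpower t (2 * k I th))).
  { apply (OO_tpow (fun th => 2 * k I th) _ (/ 128)); [|lra|].
    - eapply OO_ext; [|apply (OO_affine 0 2 I HI)]. intros t th _; ring.
    - intros t th Ht. destruct (near1 I t th HI Ht). lra. }
  (* The budget is - 1/64 + 1/16 = 1/32 + 1/64. Dividing by t^(2k) in [kappa_of] costs another 1/64,
     so kappa keeps the rate 1/32. *)
  assert (Htg : OO Om (2 * k I c + / 32 + / 64) (fun t th => Rpower t (2 * k I th) * g t th)).
  { eapply OO_mult; [exact T|exact Hg|lra]. }
  assert (Hh : OO Om (/ 16) (hh N p0 p1 u I)).
  { eapply OO_weak; [|apply (OO_hh N p0 p1 q0 q1 Hdata Hkb u Cu); auto]; lra. }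
  eapply OO_ext; [|apply (J_OO 0 Rabs_0_le_1 (2 * k I c + / 32 + / 64) _ ltac:(lra) Htg)].
  apply on_sym, J0_unique.
  - eapply OO_weak; [|exact Htg]. lra.
  - eapply hasD_on; [intros t th _; reflexivity| |apply (hasD_minus _ _ _ _ (hasD_J0 _ Hh)
      (hasD_mult _ _ _ _ (hasD_tpow (fun th => 2 * k I th)) (hasD_th (q1 I))))].
    intros t th _. unfold g, hh. ring.
  - apply (tends0_OO (/ 16)); [lra|]. apply OO_minus; [apply (J_OO 0 Rabs_0_le_1); auto; lra|].
    eapply (OO_mult _ 0 _ _ (fun _ th => q1 I th)); [exact T|apply OO_smooth1; auto|lra].
Qed.

Definition pi_of (I : nat) : R -> R -> R := fun t th =>
  Rpower t (- (2 - 2 * k I th + eps I)) * (J 0 (sv u I) t th - al I th * Rpower t (2 - 2 * k I th)).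
Definition kappa_of (I : nat) : R -> R -> R := fun t th =>
  Rpower t (- (2 * k I th)) * (J 0 (hh N p0 p1 u I) t th - Rpower t (2 * k I th) * q1 I th).

Lemma OO_pi I : (I < N)%nat -> OO Om s (pi_of I).
Proof.
  intros HI. eapply (OO_mult (- (2 - 2 * k I c + eps I) - s)); [|apply Pexp; auto|lra].
  apply (OO_tpow (fun th => - (2 - 2 * k I th + eps I)) _ (s / 2)); [|lra|].
  - eapply OO_ext; [|apply (OO_affine (- 2 - eps I) 2 I HI)]. intros t th _; ring.
  - intros t th Ht. destruct (near1 I t th HI Ht). lra.
Qed.

Lemma OO_kappa I : (I < N)%nat -> OO Om (/ 32) (kappa_of I).
Proof.
  intros HI. eapply (OO_mult (- (2 * k I c) - / 64)); [|apply Qexp; auto|lra].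
  apply (OO_tpow (fun th => - (2 * k I th)) _ (/ 128)); [|lra|].
  - eapply OO_ext; [|apply (OO_affine 0 (-2) I HI)]. intros t th _; ring.
  - intros t th Ht. destruct (near1 I t th HI Ht). lra.
Qed.

Lemma Ct_pi I n : (I < N)%nat -> Ct Om n (pi_of I).
Proof.
  intros HI. destruct (Cu I HI) as (C1 & _).
  assert (C1' : OO Om (/ 16) (sv u I)) by (eapply OO_weak; [|exact C1]; lra).
  apply Ct_mult; [|apply Ct_minus].
  - apply (Ct_tpow n (fun th => - (2 - 2 * k I th + eps I))).
    eapply sm_ext; [|eapply OO_sm, (OO_affine (- 2 - eps I) 2 I HI)]. intros t th _; ring.
  - apply Ct_pred, Ct_J0; auto. apply (u_Ct N p0 p1 q0 q1 Hdata Hkb u Cu Fu n I HI).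
  - apply (Ct_mult n (fun _ th => al I th)).
    + apply (Ct_th n (al I)). eapply OO_sm, OO_alpha; auto.
    + apply (Ct_tpow n (fun th => 2 - 2 * k I th)).
      eapply sm_ext; [|eapply OO_sm, (OO_affine 2 (-2) I HI)]. intros t th _; ring.
Qed.

Lemma Ct_kappa I n : (I < N)%nat -> Ct Om n (kappa_of I).
Proof.
  intros HI. destruct (Hdata I HI) as (S1 & S2 & S3 & S4).
  assert (Hh : OO Om (/ 16) (hh N p0 p1 u I)).
  { eapply OO_weak; [|apply (OO_hh N p0 p1 q0 q1 Hdata Hkb u Cu); auto]; lra. }
  assert (T : Ct Om n (fun t th => Rpower t (2 * k I th))).
  { apply (Ct_tpow n (fun th => 2 * k I th)).
    eapply sm_ext; [|eapply OO_sm, (OO_affine 0 2 I HI)]. intros t th _; ring. }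
  apply Ct_mult; [|apply Ct_minus].
  - apply (Ct_tpow n (fun th => - (2 * k I th))).
    eapply sm_ext; [|eapply OO_sm, (OO_affine 0 (-2) I HI)]. intros t th _; ring.
  - apply Ct_pred, Ct_J0; auto. apply Ct_mult; auto. apply Ct_mult.
    + apply Ct_exp. apply Ct_SS; auto. intros J HJ. apply Ct_plus.
      * apply (Ct_th n (p1 J)). apply sm_th, (smooth_p1 N p0 p1 q0 q1 Hdata); auto.
      * apply Ct_pred, Ct_J0; [eapply OO_weak; [|apply Cu; auto]; lra|].
        apply (u_Ct N p0 p1 q0 q1 Hdata Hkb u Cu Fu n J HJ).
    + apply (u_Ct N p0 p1 q0 q1 Hdata Hkb u Cu Fu n I HI).
  - apply Ct_mult; auto. apply (Ct_th n (q1 I)). apply sm_th; auto.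
Qed.

Lemma Pform_eq I t th : Pform N p0 p1 q0 eps pi_of I t th = PP p0 p1 u I t th.
Proof.
  unfold Pform, PP, pi_of. fold (kk N p0 I th). rewrite Rpower_Ropp. field.
  apply Rgt_not_eq, Rpower_pos.
Qed.

Lemma Qform_eq I t th : Qform N p0 q0 q1 kappa_of I t th = QQ N p0 p1 q0 u I t th.
Proof.
  unfold Qform, QQ, kappa_of. fold (kk N p0 I th). rewrite Rpower_Ropp. field.
  apply Rgt_not_eq, Rpower_pos.
Qed.

Lemma expansion_of_reduced T a b : 0 < T -> a < b ->
  (forall t th, 0 < t < T -> a < th < b -> Om t th) ->
  expansion_solution N p0 p1 q0 q1 eps T a b pi_of kappa_of.
Proof.
  intros HT Hab Hsub. split; [auto|split; [auto|split]].
  - intros I HI. split; [|split].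
    + apply (OO_regular T a b s); auto; [intros n; apply Ct_pi; auto|apply OO_pi; auto].
    + apply (OO_regular T a b (/ 32)); auto; [lra|intros n; apply Ct_kappa; auto|apply OO_kappa; auto].
    + intros th Hth. split; [apply (OO_lim0 (Om := Om) T s)|apply (OO_lim0 (Om := Om) T (/ 32))]; auto; try lra;
        [apply OO_pi; auto|apply OO_kappa; auto].
  - assert (EP : Pform N p0 p1 q0 eps pi_of = PP p0 p1 u).
    { repeat (apply functional_extensionality; intro). apply Pform_eq. }
    assert (EQ : Qform N p0 q0 q1 kappa_of = QQ N p0 p1 q0 u).
    { repeat (apply functional_extensionality; intro). apply Qform_eq. }
    rewrite EP, EQ. intros I t th HI Ht Hth.
    exact (recovered_equations N p0 p1 q0 q1 Hdata Hkb u Cu Fu I t th HI (Hsub t th Ht Hth)).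
Qed.

End Expansion.

Theorem expansion_exists N p0 p1 q0 q1 eps c : (0 < N)%nat ->
  (forall I, (I < N)%nat -> smooth1 (p0 I) /\ smooth1 (p1 I) /\ smooth1 (q0 I) /\ smooth1 (q1 I)) ->
  (forall I th, (I < N)%nat -> / 2 < kI N p0 I th < 5 / 6) ->
  (forall I J th, (I < N)%nat -> (J < N)%nat ->
    2 * (kI N p0 I th + kI N p0 J th) - 3 < eps J /\
    eps J < Rmin (2 * kI N p0 I th - 1) (2 - 2 * kI N p0 I th)) ->
  exists T a b pi kappa, a < c < b /\ expansion_solution N p0 p1 q0 q1 eps T a b pi kappa.
Proof.
  intros HN Hdata Hkb Heps.
  destruct (margins N p0 eps c HN Hkb Heps) as (m & s & Hs & Hm & Hms).
  destruct (k_near N p0 p1 q0 q1 c Hdata (Rmin (s / 8) (/ 256))) as (d & Hd & Hkn); [apply Rmin_pos; lra|].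
  set (r0 := Rmin d 1). assert (Hr0 : 0 < r0 <= 1).
  { unfold r0; split; [apply Rmin_pos; lra|apply Rmin_r]. }
  assert (Hr0d : r0 <= d) by apply Rmin_l.
  pose proof (tri_good c r0 (proj2 Hr0)) as G0.
  assert (Hex : exists r u, 0 < r <= r0 /\ admissible (triangle c r) N u /\ fixed_point (triangle c r) N (kk N p0) (base N p0 p1 q0 q1) u).
  { apply (reduced_exists c r0 Hr0 N (kk N p0) (dp0 p0) (base N p0 p1 q0 q1)).
  - intros I HI. apply (OO_kk N p0 p1 q0 q1 Hdata); auto.
  - intros I t th HI _. apply Hkb; auto.
  - reflexivity.
  - apply (base_Cls N p0 p1 q0 q1 Hdata).
  - intros I HI. apply (base_D N p0 p1 q0 q1 I); auto. }
  destruct Hex as (r & u & Hr & Cu & Fu).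
  pose proof (tri_good c r ltac:(lra)) as G1.
    (* The rectangle t < r/2, |theta - c| < r/2 fits into the triangle. *)
    exists (r / 2), (c - r / 2), (c + r / 2), (pi_of N p0 p1 q0 eps u), (kappa_of N p0 p1 q1 u).
    split; [lra|].
    apply (expansion_of_reduced N p0 p1 q0 q1 eps c Hdata Hkb (Om := triangle c r) m s); auto; try lra.
    + intros J t th HJ [H1 H2]. apply Hkn; auto. lra.
    + intros t th Ht Hth. split; [lra|].
      assert (Rabs (th - c) < r / 2) by (apply Rabs_lt_between; lra). lra.
Qed.

(** * Uniqueness for the Fuchsian system *)

Section Characteristics.
Context {Om : R -> R -> Prop} {HOm : good Om}.

Lemma char_derive f g c a s : sm Om f -> sm Om g -> isDt Om f g -> Om s (a + c * s) ->
  is_derive (fun s => f s (a + c * s)) s (g s (a + c * s) + c * dth f s (a + c * s)).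
Proof.
  intros Hf Hg Hd Hs. apply is_derive_Reals.
  replace (g s (a + c * s) + c * dth f s (a + c * s))
    with (g s (a + c * s) * 1 + dth f s (a + c * s) * c) by ring.
  apply (derivable_pt_lim_comp_2d f (fun s => s) (fun s => a + c * s)).
  - apply filterdiff_differentiable_pt_lim.
    apply (is_derive_filterdiff f s (a + c * s) g).
    + apply (locally_2d_locally (fun u v => is_derive (fun z => f z v) u (g u v)) s (a + c * s)).
      generalize (good_open _ _ Hs). apply locally_2d_impl, locally_2d_forall. intros u v Huv; apply Hd; auto.
    + apply (sm_is f Hf _ _ Hs).
    + apply (continuity_2d_pt_filterlim g). apply (@sm_c Om); auto.
  - apply derivable_pt_lim_id.
  - apply is_derive_Reals. auto_derive; auto; ring.
Qed.

(** Along a characteristic the equation becomes an ordinary one with source g/s, and f tends to 0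
    there because it is O(t^mu). So [est_decay] gives the same factor 1/mu as for [J], without
    representing f as an integral. *)
Lemma char_est f g c C mu : Rabs c <= 1 -> 0 < mu -> OO Om mu f -> Ct Om 1 f ->
  hasD Om f (fun t th => g t th - c * (t * dth f t th)) ->
  (forall t th, Om t th -> Rabs (g t th) <= C * Rpower t mu) ->
  forall t th, Om t th -> Rabs (f t th) <= C / mu * Rpower t mu.
Proof.
  intros Hc Hmu Hf (Sf & f' & Hf' & Sf') Hd Hb t th Ht. destruct (good_pos _ _ Ht) as [H0 H1].
  assert (HOm' : forall s, 0 < s <= t -> Om s (th - c * t + c * s)).
  { intros s Hs. apply (good_cone t th); auto.
    replace (th - c * t + c * s - th) with (c * (s - t)) by ring.
    rewrite Rabs_mult, (Rabs_left1 (s - t)) by lra. nra. }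
  replace (f t th) with (f t (th - c * t + c * t)) by (f_equal; ring).
  apply (est_decay (fun s => f s (th - c * t + c * s)) (fun s => g s (th - c * t + c * s) / s)); auto.
  - intros s Hs. pose proof (HOm' s Hs) as HOs. split.
    + evar_last; [apply (char_derive f f' c (th - c * t) s Sf Sf' Hf' HOs)|].
      set (x := th - c * t + c * s) in *.
      assert (E : f' s x = (g s x - c * (s * dth f s x)) / s).
      { rewrite <- (is_derive_unique _ _ _ (Hf' s x HOs)). apply is_derive_unique, Hd; auto. }
      rewrite E. field. lra.
    + unfold Rdiv. rewrite Rabs_mult, (Rabs_right (/ s)) by (left; apply Rinv_0_lt_compat; lra).
      apply Rmult_le_compat_r; [left; apply Rinv_0_lt_compat; lra|]. apply Hb; auto.
  - intros eps He. destruct (OO_0 _ _ Hf) as (D & HD & Hbd).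
    destruct (small_Rpower D mu eps Hmu He) as (eta & Heta & Hs).
    exists eta; split; auto. intros s Hs1 Hs2. eapply Rle_trans; [apply Hbd, HOm'; lra|apply Hs; auto].
Qed.

End Characteristics.

Section Uniqueness.
Context (N : nat) (p0 p1 q0 q1 : nat -> R -> R).
Context (Hdata : forall I, (I < N)%nat ->
  smooth1 (p0 I) /\ smooth1 (p1 I) /\ smooth1 (q0 I) /\ smooth1 (q1 I)).
Context (Hkb : forall I th, (I < N)%nat -> / 2 < kk N p0 I th < 5 / 6).

Notation k := (kk N p0).
Notation HOOk := (OO_kk N p0 p1 q0 q1 Hdata).

Lemma hyp_D {Om} {HOm : good Om} u : admissible Om N u -> fixed_point Om N k (base N p0 p1 q0 q1) u ->
  forall I, (I < N)%nat ->
  hasD Om (sv (hyp k u) I) (fun t th => t * dth (sx (hyp k u) I) t th + sv (hyp_rhs N k (dp0 p0) (hyp k u)) I t th) /\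
  hasD Om (sx (hyp k u) I) (fun t th => t * dth (sv (hyp k u) I) t th + sx (hyp_rhs N k (dp0 p0) (hyp k u)) I t th) /\
  hasD Om (sz (hyp k u) I) (fun t th => t * dth (sy (hyp k u) I) t th + sz (hyp_rhs N k (dp0 p0) (hyp k u)) I t th) /\
  hasD Om (sy (hyp k u) I) (fun t th => t * dth (sz (hyp k u) I) t th + sy (hyp_rhs N k (dp0 p0) (hyp k u)) I t th).
Proof.
  intros Cu Fu I HI. destruct (u_D N p0 p1 q0 q1 Hdata Hkb u Cu Fu I HI) as (D1 & D2 & D3 & D4).
  split4.
  - eapply hasD_on; [intros t th _; reflexivity| |exact D1].
    intros t th Ht. apply (hyp_identities N k (dp0 p0) HOOk u I t th HI Ht Cu).
  - eapply hasD_on; [intros t th _; reflexivity| |apply (hasD_mult _ _ _ _ hasD_id D2)].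
    intros t th Ht. destruct (hyp_identities N k (dp0 p0) HOOk u I t th HI Ht Cu) as (_ & E & _). 
    rewrite E. ring.
  - eapply hasD_on; [intros t th _; reflexivity| |apply (hasD_mult _ _ _ _ (hasD_tpow (k I)) D3)].
    intros t th Ht. destruct (hyp_identities N k (dp0 p0) HOOk u I t th HI Ht Cu) as (_ & _ & E & _).
    rewrite E. cbn [sz hyp]. ring.
  - eapply hasD_on; [intros t th _; reflexivity| |apply (hasD_mult _ _ _ _ (hasD_tpow (fun th => 1 - k I th)) D4)].
    intros t th Ht. destruct (hyp_identities N k (dp0 p0) HOOk u I t th HI Ht Cu) as (_ & _ & _ & E).
    rewrite E. cbn [sy hyp]. ring.
Qed.

Lemma hyp_Ct {Om} {HOm : good Om} u : admissible Om N u -> fixed_point Om N k (base N p0 p1 q0 q1) u ->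
  forall n I, (I < N)%nat -> Ct Om n (sv (hyp k u) I) /\ Ct Om n (sx (hyp k u) I) /\
    Ct Om n (sz (hyp k u) I) /\ Ct Om n (sy (hyp k u) I).
Proof.
  intros Cu Fu n I HI. destruct (u_Ct N p0 p1 q0 q1 Hdata Hkb u Cu Fu n I HI) as (C1 & C2 & C3 & C4).
  assert (Sk : sm Om (fun _ th => k I th)) by (eapply OO_sm, HOOk; auto).
  split4; cbn [sv sx sz sy hyp].
  - auto.
  - apply (Ct_mult n (fun t _ => t)); auto. apply Ct_id.
  - apply Ct_mult; auto. apply (Ct_tpow n (k I)); auto.
  - apply Ct_mult; auto. apply (Ct_tpow n (fun th => 1 - k I th)).
    apply (sm_minus (fun _ _ => 1) (fun _ th => k I th)); auto. apply sm_const.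
Qed.

Theorem reduced_unique c r u w : 0 < r <= 1 ->
  admissible (triangle c r) N u -> fixed_point (triangle c r) N k (base N p0 p1 q0 q1) u ->
  admissible (triangle c r) N w -> fixed_point (triangle c r) N k (base N p0 p1 q0 q1) w ->
  exists r', 0 < r' <= r /\ eq_state (triangle c r') N u w.
Proof.
  intros Hr Cu Fu Cw Fw. pose proof (tri_good c r (proj2 Hr)) as HOm0.
  set (U := hyp k u). set (V := hyp k w).
  assert (HU : In4 (triangle c r) N (/ 8) (/ 8) (/ 8) (/ 8) U).
  { apply (hyp_In4 c r N k HOOk (Hkb' N p0 Hkb) u); auto. }
  assert (HV : In4 (triangle c r) N (/ 8) (/ 8) (/ 8) (/ 8) V).
  { apply (hyp_In4 c r N k HOOk (Hkb' N p0 Hkb) w); auto. }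
  assert (HD : In4 (triangle c r) N 4 4 4 4 (sub_state U V)).
  { pose proof (FP_near N k HOOk (Hkb' N p0 Hkb) _ u w Cu Cw Fu Fw 32) as Hn.
    replace (INR 32 / 8) with 4 in Hn by (simpl; field).
    intros I HI. destruct (Hn I HI) as (N1 & N2 & N3 & N4).
    destruct (OO_tk c r N k HOOk (Hkb' N p0 Hkb) I HI (fun t th H => H)) as (T1 & T2 & _).
    split4; cbn [sv sx sz sy sub_state U V hyp].
    - eapply OO_weak; [|exact N1]; lra.
    - apply (OO_ext 4 (fun t th => t * (sx u I t th - sx w I t th))); [intros t th _; unfold U, V; simpl; ring|].
      eapply OO_mult; [apply OO_id|exact N2|lra].
    - apply (OO_ext 4 (fun t th => Rpower t (k I th) * (sz u I t th - sz w I t th))); [intros t th _; unfold U, V; simpl; ring|].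
      eapply OO_mult; [exact T1|exact N3|lra].
    - apply (OO_ext 4 (fun t th => Rpower t (1 - k I th) * (sy u I t th - sy w I t th))); [intros t th _; unfold U, V; simpl; ring|].
      eapply OO_mult; [exact T2|exact N4|lra]. }
  destruct (In4_B4 N (/ 8) 0 U HU) as (CU & PU & BU).
  destruct (In4_B4 N (/ 8) 0 V HV) as (CV & PV & BV).
  destruct (In4_B4 N 4 0 _ HD) as (CD & PD & BD).
  assert (HN : 0 <= INR N) by apply pos_INR.
  set (kap := / (8 * (INR N + 1))).
  assert (Hkap : 0 < kap) by (apply Rinv_0_lt_compat; lra).
  assert (Hkap8 : kap <= / 8) by (apply Rinv_le_contravar; lra).
  assert (HkapN : (INR N + 1) * kap = / 8) by (unfold kap; field; lra).
  destruct (small_Rpower (CU + CV) (/ 8) kap) as (eta & He & Hs); [lra|auto|].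
  set (r' := Rmin r (eta / 2)).
  assert (Hr' : 0 < r') by (apply Rmin_pos; lra).
  assert (Hrr : r' <= r) by apply Rmin_l. assert (Hre : r' <= eta / 2) by apply Rmin_r.
  pose proof (tri_good c r' ltac:(lra)) as HOm.
  assert (Hsub : forall t th, triangle c r' t th -> triangle c r t th) by (intros; eapply tri_sub; eauto).
  exists r'. split; [lra|].
  assert (Q : forall X C, C <= CU + CV -> B4 (triangle c r) N 0 1 (/ 8) C X -> B4 (triangle c r') N 0 1 0 kap X).
  { intros X C HC HX I HI. destruct (HX I HI) as (X1 & X2 & X3 & X4).
    assert (P : forall f, bnd (triangle c r) 0 1 (/ 8) C f -> bnd (triangle c r') 0 1 0 kap f).
    { intros f Hf. apply (bnd_sub Hsub) in Hf.
      apply (bnd_exp_tri c r' 0 ltac:(lra) 1 (/ 8) 0) in Hf; [|lra].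
      rewrite Rminus_0_r in Hf. eapply bnd_weak; [|exact Hf].
      specialize (Hs r' ltac:(lra)). pose proof (Rpower_pos r' (/ 8)). nra. }
    split4; apply P; auto. }
  assert (BU' := Q U CU ltac:(lra) BU). assert (BV' := Q V CV ltac:(lra) BV).
  assert (KB : forall I, (I < N)%nat -> bnd (triangle c r') 0 1 0 1 (fun _ th => k I th) /\
       bnd (triangle c r') 0 1 0 1 (fun _ th => 1 - k I th)).
  { intros I HI. assert (Sk : sm (triangle c r') (fun _ th => k I th)) by (eapply OO_sm, HOOk; auto).
    split; (split; [|split; [lra|]]); auto;
      try (intros t th Ht; rewrite (Rpower_0_1 t th Ht), Rmult_1_r; pose proof (Hkb I th HI);
        rewrite Rabs_right; lra).
    apply (sm_minus (fun _ _ => 1) (fun _ th => k I th)); auto. apply sm_const. }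
  set (om := fun i => riemann (sub_state U V) i).
  set (g := fun i => riemann (sub_state (hyp_rhs N k (dp0 p0) U) (hyp_rhs N k (dp0 p0) V)) i).
  assert (Hom : forall i, valid_idx N i -> OO (triangle c r') 4 (om i) /\ Ct (triangle c r') 1 (om i) /\
     hasD (triangle c r') (om i) (fun t th => g i t th - speed i * (t * dth (om i) t th))).
  { intros [[b s] I] Hi. unfold valid_idx in Hi; simpl in Hi.
    destruct (HD I Hi) as (H1 & H2 & H3 & H4). apply (OO_sub Hsub) in H1, H2, H3, H4.
    assert (Cu' : admissible (triangle c r') N u) by (apply (Cls_sub Hsub); auto).
    assert (Cw' : admissible (triangle c r') N w) by (apply (Cls_sub Hsub); auto).
    assert (R : forall x, fixed_point (triangle c r) N k (base N p0 p1 q0 q1) x -> fixed_point (triangle c r') N k (base N p0 p1 q0 q1) x).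
    { intros x Hx J HJ. destruct (Hx J HJ) as (X1 & X2 & X3 & X4). split4; intros t th Ht; auto. }
    destruct (hyp_D u Cu' (R u Fu) I Hi) as (A1 & A2 & A3 & A4).
    destruct (hyp_D w Cw' (R w Fw) I Hi) as (B1 & B2 & B3 & B4).
    destruct (hyp_Ct u Cu' (R u Fu) 1 I Hi) as (K1 & K2 & K3 & K4).
    destruct (hyp_Ct w Cw' (R w Fw) 1 I Hi) as (L1 & L2 & L3 & L4).
    fold U in A1, A2, A3, A4, K1, K2, K3, K4. fold V in B1, B2, B3, B4, L1, L2, L3, L4.
    (* The pairs (V, X) and (Z, Y) have the same structure. The sign e selects the invariant f1 + e
       g1, which travels with speed - e. *)
    assert (M : forall e f f1 f2 g1 g2 a1 a2 b1 b2, e = 1 \/ e = -1 ->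
       Ct (triangle c r') 1 f1 -> Ct (triangle c r') 1 f2 -> Ct (triangle c r') 1 g1 -> Ct (triangle c r') 1 g2 ->
       hasD (triangle c r') f1 (fun t th => t * dth g1 t th + a1 t th) ->
       hasD (triangle c r') f2 (fun t th => t * dth g2 t th + a2 t th) ->
       hasD (triangle c r') g1 (fun t th => t * dth f1 t th + b1 t th) ->
       hasD (triangle c r') g2 (fun t th => t * dth f2 t th + b2 t th) ->
       (forall t th, f t th = (f1 t th - f2 t th) + e * (g1 t th - g2 t th)) ->
       Ct (triangle c r') 1 f /\
       hasD (triangle c r') f (fun t th => (a1 t th - a2 t th) + e * (b1 t th - b2 t th) - (- e) * (t * dth f t th))).
    { intros e f f1 f2 g1 g2 a1 a2 b1 b2 Hee F1 F2 G1 G2 D1 D2 D3 D4 Ef.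
      assert (E : f = fun t th => (f1 t th - f2 t th) + e * (g1 t th - g2 t th)).
      { apply functional_extensionality; intros t; apply functional_extensionality; intros th; auto. }
      rewrite E. split.
      - apply Ct_plus; [apply Ct_minus; auto|]. apply (Ct_scal 1 e); apply Ct_minus; auto.
      - eapply hasD_on; [intros t th _; reflexivity| |apply (hasD_plus _ _ _ _ (hasD_minus _ _ _ _ D1 D2)
          (hasD_scal e _ _ (hasD_minus _ _ _ _ D3 D4)))].
        intros t th Ht. apply Ct_sm in F1, F2, G1, G2.
        rewrite (dth_plus (fun t th => f1 t th - f2 t th) (fun t th => e * (g1 t th - g2 t th))
           (sm_minus _ _ F1 F2) (sm_scal e _ (sm_minus _ _ G1 G2)) t th Ht).
        rewrite (dth_scal e (fun t th => g1 t th - g2 t th) t th Ht).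
        rewrite (dth_minus f1 f2 F1 F2 t th Ht), (dth_minus g1 g2 G1 G2 t th Ht).
        destruct Hee as [-> | ->]; ring. }
    unfold om, g. destruct b, s; cbn [riemann]; cbn [sv sx sz sy sub_state] in *.
    - split; [apply OO_plus; auto|].
      destruct (M 1 (fun t th => sv U I t th - sv V I t th + (sx U I t th - sx V I t th)) _ _ _ _ _ _ _ _ (or_introl eq_refl) K1 L1 K2 L2 A1 B1 A2 B2) as [M1 M2]; [intros; ring|].
      split; [exact M1|]. eapply hasD_on; [intros t th _; reflexivity| |exact M2].
      intros t th _. unfold speed; cbn [fst snd]. ring.
    - split; [apply OO_minus; auto|].
      destruct (M (-1) (fun t th => sv U I t th - sv V I t th - (sx U I t th - sx V I t th)) _ _ _ _ _ _ _ _ (or_intror eq_refl) K1 L1 K2 L2 A1 B1 A2 B2) as [M1 M2]; [intros; ring|].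
      split; [exact M1|]. eapply hasD_on; [intros t th _; reflexivity| |exact M2].
      intros t th _. unfold speed; cbn [fst snd]. ring.
    - split; [apply OO_plus; auto|].
      destruct (M 1 (fun t th => sz U I t th - sz V I t th + (sy U I t th - sy V I t th)) _ _ _ _ _ _ _ _ (or_introl eq_refl) K3 L3 K4 L4 A3 B3 A4 B4) as [M1 M2]; [intros; ring|].
      split; [exact M1|]. eapply hasD_on; [intros t th _; reflexivity| |exact M2].
      intros t th _. unfold speed; cbn [fst snd]. ring.
    - split; [apply OO_minus; auto|].
      destruct (M (-1) (fun t th => sz U I t th - sz V I t th - (sy U I t th - sy V I t th)) _ _ _ _ _ _ _ _ (or_intror eq_refl) K3 L3 K4 L4 A3 B3 A4 B4) as [M1 M2]; [intros; ring|].
      split; [exact M1|]. eapply hasD_on; [intros t th _; reflexivity| |exact M2].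
      intros t th _. unfold speed; cbn [fst snd]. ring. }
  assert (Hun : forall I t th, sv (of_riemann om) I t th = sv (sub_state U V) I t th /\
     sx (of_riemann om) I t th = sx (sub_state U V) I t th /\
     sz (of_riemann om) I t th = sz (sub_state U V) I t th /\ sy (of_riemann om) I t th = sy (sub_state U V) I t th).
  { intros I t th. unfold om. split4; cbn [sv sx sz sy of_riemann riemann]; field. }
  assert (Hsp : forall i, Rabs (speed i) <= 1).
  { intros [[b []] j]; unfold speed; simpl; [rewrite Rabs_left; lra|rewrite Rabs_R1; lra]. }
  (* Each round bounds the source by 3 d t^4 through [FF_diff] and gains 1/4 from the integration,
     so the constant shrinks by 3/4. The initial value 2 CD accounts for the two components in an
     invariant. *)
  assert (Hit : forall n i, valid_idx N i -> forall t th, triangle c r' t th ->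
     Rabs (om i t th) <= 2 * CD * (3 / 4) ^ n * Rpower t 4).
  { induction n as [|n IH].
    - intros [[b s] I] Hi t th Ht. unfold valid_idx in Hi; simpl in Hi. destruct (BD I Hi) as (X1 & X2 & X3 & X4).
      destruct X1 as (_ & _ & X1), X2 as (_ & _ & X2), X3 as (_ & _ & X3), X4 as (_ & _ & X4).
      specialize (X1 t th (Hsub _ _ Ht)). specialize (X2 t th (Hsub _ _ Ht)).
      specialize (X3 t th (Hsub _ _ Ht)). specialize (X4 t th (Hsub _ _ Ht)).
      unfold om. cbn [pow]. apply Rabs_le_between in X1. apply Rabs_le_between in X2.
      apply Rabs_le_between in X3. apply Rabs_le_between in X4.
      destruct b, s; cbn [riemann]; apply Rabs_le_between; lra.
    - set (d := 2 * CD * (3 / 4) ^ n) in *.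
      assert (Hd : 0 <= d) by (unfold d; apply Rmult_le_pos; [lra|apply pow_le; lra]).
      assert (DB : B4 (triangle c r') N 0 1 4 d (sub_state U V)).
      { intros I HI.
        assert (OB : forall b s, bnd (triangle c r') 0 1 4 d (om (b, s, I))).
        { intros b s. destruct (Hom (b, s, I) HI) as (H1 & _). split; [eapply OO_sm; eauto|split; [auto|]].
          apply IH; exact HI. }
        assert (P : forall b, bnd (triangle c r') 0 1 4 d (fun t th => / 2 * (om (b, true, I) t th + om (b, false, I) t th)) /\
           bnd (triangle c r') 0 1 4 d (fun t th => / 2 * (om (b, true, I) t th - om (b, false, I) t th))).
        { intros b. replace d with (Rabs (/ 2) * (d + d)) by (rewrite Rabs_right by lra; field).
          split; apply (bnd_scal 0 1 4 (d + d) (/ 2)); [apply bnd_plus|apply bnd_minus]; auto. }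
        split4; [eapply bnd_ext; [|apply (proj1 (P true))]|eapply bnd_ext; [|apply (proj2 (P true))]
          |eapply bnd_ext; [|apply (proj1 (P false))]|eapply bnd_ext; [|apply (proj2 (P false))]];
          intros t th _; destruct (Hun I t th) as (E1 & E2 & E3 & E4);
          [exact E1|exact E2|exact E3|exact E4]. }
      intros i Hi t th Ht. destruct (Hom i Hi) as (H1 & H2 & H3).
      replace (2 * CD * (3 / 4) ^ S n) with (3 * d / 4) by (unfold d; simpl; field).
      apply (char_est (om i) (g i) (speed i) (3 * d) 4); auto; [lra|].
      clear t th Ht. intros t th Ht.
      destruct i as [[b s] I]. unfold valid_idx in Hi; simpl in Hi.
      destruct (FF_diff N k (dp0 p0) 0 1 kap 1 4 d U V ltac:(lra) KB BU' BV' DB I Hi) as (D1 & D2 & D3 & D4).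
      destruct D1 as (_ & _ & D1), D2 as (_ & _ & D2), D3 as (_ & _ & D3), D4 as (_ & _ & D4).
      specialize (D1 t th Ht). specialize (D2 t th Ht). specialize (D3 t th Ht). specialize (D4 t th Ht).
      rewrite <- (Rmult_assoc (INR N + 1)), HkapN in D3, D4.
      pose proof (Rpower_pos t 4) as PR. set (R4 := Rpower t 4) in *.
      assert (Hkd : kap * d * R4 <= / 8 * d * R4).
      { apply Rmult_le_compat_r; [lra|]. apply Rmult_le_compat_r; auto. }
      assert (0 <= d * R4) by (apply Rmult_le_pos; lra).
      apply Rabs_le_between in D1. apply Rabs_le_between in D2.
      apply Rabs_le_between in D3. apply Rabs_le_between in D4.
      unfold g. destruct b, s; cbn [riemann]; apply Rabs_le_between; lra. }
  assert (Hz : forall i, valid_idx N i -> forall t th, triangle c r' t th -> om i t th = 0).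
  { intros i Hi t th Ht. apply cond_eq. intros e Hee. rewrite Rminus_0_r.
    destruct (pow_small (2 * CD * Rpower t 4) (3 / 4) e ltac:(lra) Hee) as [n Hn].
    eapply Rle_lt_trans; [apply (Hit n i Hi t th Ht)|]. lra. }
  intros I HI.
  assert (HZ : forall t th, triangle c r' t th -> sv U I t th = sv V I t th /\ sx U I t th = sx V I t th /\
     sz U I t th = sz V I t th /\ sy U I t th = sy V I t th).
  { intros t th Ht. destruct (Hun I t th) as (E1 & E2 & E3 & E4).
    cbn [sv sx sz sy of_riemann sub_state] in E1, E2, E3, E4.
    rewrite !(fun b s => Hz (b, s, I) HI t th Ht) in E1, E2, E3, E4. split4; lra. }
  split4; intros t th Ht; destruct (HZ t th Ht) as (Z1 & Z2 & Z3 & Z4); unfold U, V in *;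
    cbn [sv sx sz sy hyp] in *; destruct (good_pos _ _ Ht).
  - auto.
  - apply Rmult_eq_reg_l with t; auto; lra.
  - apply Rmult_eq_reg_l in Z3; auto. apply Rgt_not_eq, Rpower_pos.
  - apply Rmult_eq_reg_l in Z4; auto. apply Rgt_not_eq, Rpower_pos.
Qed.

End Uniqueness.

(** * Bounds implied by regularity *)

Lemma box_bounded (f : R -> R -> R) a b c d : a <= b -> c <= d ->
  (forall x y, a <= x <= b -> c <= y <= d -> continuity_2d_pt f x y) ->
  exists M, 0 <= M /\ forall x y, a <= x <= b -> c <= y <= d -> Rabs (f x y) <= M.
Proof.
  intros Hab Hcd Hf.
  destruct (uniform_continuity_2d f a b c d Hf (mkposreal 1 Rlt_0_1)) as [e He]. simpl in He.
  pose proof (cond_pos e) as Pe. set (h := e / 2).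
  assert (Hh : 0 < h < e) by (unfold h; lra).
  (* Moving towards the corner in diagonal steps shorter than the modulus of uniform continuity
     changes f by less than 1 per step, and the number of steps is bounded. *)
  assert (Hn : forall n x y, a <= x <= b -> c <= y <= d -> x - a <= INR n * h -> y - c <= INR n * h ->
     Rabs (f x y) <= Rabs (f a c) + INR n).
  { induction n as [|n IH]; intros x y Hx Hy H1 H2.
    - simpl in *. replace x with a by lra. replace y with c by lra. lra.
    - rewrite S_INR in *. assert (0 <= INR n * h) by (apply Rmult_le_pos; [apply pos_INR|lra]).
      set (x' := Rmax (x - h) a). set (y' := Rmax (y - h) c).
      assert (Hx' : a <= x' <= x) by (unfold x'; split; [apply Rmax_r|apply Rmax_lub; lra]).
      assert (Hy' : c <= y' <= y) by (unfold y'; split; [apply Rmax_r|apply Rmax_lub; lra]).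
      assert (x - h <= x') by apply Rmax_l. assert (y - h <= y') by apply Rmax_l.
      assert (Rabs (f x' y') <= Rabs (f a c) + INR n).
      { apply IH; try lra.
        - unfold x'. assert (x - h - a <= INR n * h) by lra. unfold Rmax. destruct (Rle_dec (x - h) a); lra.
        - unfold y'. assert (y - h - c <= INR n * h) by lra. unfold Rmax. destruct (Rle_dec (y - h) c); lra. }
      assert (Rabs (f x y - f x' y') < 1).
      { apply He; try lra; rewrite Rabs_right; lra. }
      replace (f x y) with ((f x y - f x' y') + f x' y') by ring.
      eapply Rle_trans; [apply Rabs_triang|]. lra. }
  destruct (INR_unbounded ((b - a + (d - c)) / h)) as [n Hn'].
  assert (Hl : b - a + (d - c) <= INR n * h).
  { apply Rlt_div_l in Hn'; lra. }
  exists (Rabs (f a c) + INR n). split; [pose proof (Rabs_pos (f a c)); pose proof (pos_INR n); lra|].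
  intros x y Hx Hy. apply Hn; lra.
Qed.

Lemma iterD_app w1 w2 f : iterD (w1 ++ w2) f = iterD w1 (iterD w2 f).
Proof. induction w1 as [|b w IH]; simpl; [auto|rewrite IH; auto]. Qed.

Lemma smooth_rect_iterD T a b w f : smooth_rect T a b f -> smooth_rect T a b (iterD w f).
Proof. intros H w' t th Ht Hth. rewrite <- iterD_app. apply H; auto. Qed.

Lemma smooth_rect_Ct {Om} T a b f : (forall t th, Om t th -> 0 < t < T /\ a < th < b) ->
  smooth_rect T a b f -> forall n, Ct Om n f.
Proof.
  intros Hs H.
  assert (Hsm : forall n f, smooth_rect T a b f -> smn Om n f).
  { clear f H. induction n as [|n IH]; intros f H.
    - intros t th Ht. destruct (Hs _ _ Ht) as [H1 H2]. apply continuity_2d_pt_filterlim.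
      exact (proj2 (proj2 (H nil t th H1 H2))).
    - split; [|apply IH; apply (smooth_rect_iterD T a b (false :: nil) f H)].
      intros t th Ht. destruct (Hs _ _ Ht) as [H1 H2]. destruct (H nil t th H1 H2) as (_ & D1 & D2).
      split; [apply continuity_2d_pt_filterlim; exact D2|exact D1]. }
  intros n; revert f H; induction n as [|n IH]; intros f H.
  - intros n. apply Hsm; auto.
  - split; [intros m; apply Hsm; auto|]. exists (dt f). split.
    + intros t th Ht. destruct (Hs _ _ Ht) as [H1 H2]. apply Derive_correct. exact (proj1 (H nil t th H1 H2)).
    + apply IH. apply (smooth_rect_iterD T a b (true :: nil) f H).
Qed.

(** The continuous extension of a theta-derivative to t = 0 is bounded on a compact rectangle, and
    the triangle lies in such a rectangle. *)
Lemma regular_OO T a b c r f : 0 < r <= 1 -> r <= T / 2 -> a < c - r -> c + r < b ->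
  regular T a b f -> OO (triangle c r) 0 f /\ forall n, Ct (triangle c r) n f.
Proof.
  intros Hr HrT Ha Hb [Hsr Hext]. pose proof (tri_good c r ltac:(lra)) as HOm.
  assert (Hsub : forall t th, triangle c r t th -> 0 < t < T /\ c - r < th < c + r).
  { intros t th [H1 H2]. pose proof (Rabs_pos (th - c)).
    assert (Rabs (th - c) < r) by lra. apply Rabs_lt_between in H0. lra. }
  assert (HC : forall n, Ct (triangle c r) n f).
  { apply (smooth_rect_Ct T a b); auto. intros t th Ht. specialize (Hsub t th Ht). lra. }
  split; auto. apply OO_of_dthn; [apply (HC 0%nat)|].
  intros n. destruct (Hext n) as (g & Hg & Hlim).
  (* Writing [Rmax t 0] extends g to negative times, since [box_bounded] asks for two-sided
     continuity at the edge t = 0. *)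
  destruct (box_bounded (fun t th => g (Rmax t 0) th) 0 (T / 2) (c - r) (c + r)) as (M & HM & HMb); [lra|lra| |].
  - intros x y Hx Hy eps.
    assert (Hx2 : 0 <= x < T) by lra. assert (Hy2 : a < y < b) by lra.
    destruct (proj1 (filterlim_locally _ _) (Hlim x y Hx2 Hy2) eps) as [d Hd].
    set (e := Rmin d (Rmin (T / 2) (Rmin (c - r - a) (b - c - r)))).
    assert (He : 0 < e) by (repeat apply Rmin_pos; try lra; apply cond_pos).
    assert (E1 : e <= d) by apply Rmin_l.
    assert (E2 : e <= Rmin (T / 2) (Rmin (c - r - a) (b - c - r))) by apply Rmin_r.
    pose proof (Rmin_l (T / 2) (Rmin (c - r - a) (b - c - r))).
    pose proof (Rmin_r (T / 2) (Rmin (c - r - a) (b - c - r))).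
    pose proof (Rmin_l (c - r - a) (b - c - r)). pose proof (Rmin_r (c - r - a) (b - c - r)).
    exists (mkposreal _ He). simpl. intros u v Hu Hv.
    assert (Hux : Rabs (Rmax u 0 - x) < e).
    { apply Rabs_lt_between in Hu. apply Rabs_lt_between. unfold Rmax. destruct (Rle_dec u 0); lra. }
    rewrite (Rmax_left x 0) by lra.
    apply (Hd (Rmax u 0, v)).
    + split; simpl; [change (Rabs (Rmax u 0 - x) < d)|change (Rabs (v - y) < d)]; lra.
    + simpl. apply Rabs_lt_between in Hux. apply Rabs_lt_between in Hv.
      pose proof (Rmax_r u 0). lra.
  - exists M. split; auto. intros t th Ht. destruct (Hsub t th Ht) as [H1 H2].
    assert (Htr : t < r) by (destruct Ht; pose proof (Rabs_pos (th - c)); lra).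
    rewrite (Rpower_0_1 t th Ht), Rmult_1_r, <- Hg by lra.
    specialize (HMb t th ltac:(lra) ltac:(lra)). cbv beta in HMb. rewrite Rmax_left in HMb by lra. auto.
Qed.

Lemma is_derive_0_const (f : R -> R) t : (forall s, 0 < s <= t -> is_derive f s 0) ->
  forall s, 0 < s <= t -> f s = f t.
Proof.
  intros H s Hs. destruct (MVT_gen f s t (fun _ => 0)) as (x & _ & E).
  - intros x Hx. rewrite Rmin_left, Rmax_right in Hx by lra. apply H; lra.
  - intros x Hx. rewrite Rmin_left, Rmax_right in Hx by lra.
    apply derivable_continuous_pt, ex_derive_Reals_0. eexists; apply H; lra.
  - simpl in E. lra.
Qed.

(** * Every solution of the given form solves the Fuchsian system *)

Section Reduction.
Context (N : nat) (p0 p1 q0 q1 : nat -> R -> R) (eps : nat -> R).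
Context (Hdata : forall I, (I < N)%nat ->
  smooth1 (p0 I) /\ smooth1 (p1 I) /\ smooth1 (q0 I) /\ smooth1 (q1 I)).
Context (Hkb : forall I th, (I < N)%nat -> / 2 < kk N p0 I th < 5 / 6).
Context {Om : R -> R -> Prop} {HOm : good Om}.
Context (pi kappa : nat -> R -> R -> R) (g : R) (Hg : 0 < g).
Context (Hpi : forall I, (I < N)%nat -> OO Om 0 (pi I) /\ forall n, Ct Om n (pi I)).
Context (Hkap : forall I, (I < N)%nat -> OO Om 0 (kappa I) /\ (forall n, Ct Om n (kappa I)) /\ tends0 Om (kappa I)).
Context (Hgap : forall I t th, (I < N)%nat -> Om t th -> g <= 2 - 2 * kk N p0 I th + eps I).

Notation k := (kk N p0).
Notation HOOk := (OO_kk N p0 p1 q0 q1 Hdata).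
Notation al := (alphaI N p0 p1 q0).
Notation P := (Pform N p0 p1 q0 eps pi).
Notation Q := (Qform N p0 q0 q1 kappa).
Notation bs := (base N p0 p1 q0 q1).

Context (Hsys : forall I t th, (I < N)%nat -> Om t th ->
  Dop (Dop (P I)) t th - t ^ 2 * dth (dth (P I)) t th
    = - / 2 * exp (- 2 * SS N P I t th) * ((Dop (Q I) t th) ^ 2 - (t * dth (Q I) t th) ^ 2) /\
  Dop (Dop (Q I)) t th - t ^ 2 * dth (dth (Q I)) t th
    = 2 * (Dop (SS N P I) t th * Dop (Q I) t th - t ^ 2 * dth (SS N P I) t th * dth (Q I) t th)).

(** A rate for P_I - p0 ln t - p1: the term with exponent 2 - 2k + eps >= g gives up g/2 for the
    logarithms of its theta-derivatives, and the cap 1/16 fits the other rates. *)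
Let om := Rmin (/ 16) (g / 2).

Lemma om_pos : 0 < om <= / 16.
Proof. unfold om; split; [apply Rmin_pos; lra|apply Rmin_l]. Qed.

Lemma affine_k a b I : (I < N)%nat -> OO Om 0 (fun _ th => a + b * k I th).
Proof. intros HI. apply (OO_affine_k N k HOOk); auto. Qed.

Definition rho (I : nat) : R -> R -> R := fun t th =>
  al I th * Rpower t (2 - 2 * k I th) + Rpower t (2 - 2 * k I th + eps I) * pi I t th.

Lemma P_eq I t th : P I t th = p0 I th * ln t + p1 I th + rho I t th.
Proof. unfold Pform, rho. fold (kk N p0 I th). ring. Qed.

Lemma OO_rho I : (I < N)%nat -> OO Om om (rho I).
Proof.
  intros HI. pose proof om_pos. apply OO_plus.
  - eapply (OO_mult 0 (5 / 16) om (fun _ th => al I th)); [|apply (OO_tb N k HOOk (Hkb' N p0 Hkb)); auto|lra].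
    apply (OO_alpha N p0 p1 q0 q1 Hdata Hkb); auto.
  - eapply OO_mult; [|apply Hpi; auto|].
    + apply (OO_tpow (fun th => 2 - 2 * k I th + eps I) (g / 2) (g / 2)); [|lra|].
      * eapply OO_ext; [|apply (affine_k (2 + eps I) (-2) I HI)]. intros t th _; ring.
      * intros t th Ht. specialize (Hgap I t th HI Ht). lra.
    + unfold om. pose proof (Rmin_r (/ 16) (g / 2)). lra.
Qed.

Lemma Ct_rho I n : (I < N)%nat -> Ct Om n (rho I).
Proof.
  intros HI. apply Ct_plus; apply Ct_mult.
  - apply (Ct_th n (al I)). eapply OO_sm, (OO_alpha N p0 p1 q0 q1 Hdata Hkb); auto.
  - apply (Ct_tpow n (fun th => 2 - 2 * k I th)).
    eapply sm_ext; [|eapply OO_sm, (affine_k 2 (-2) I HI)]. intros t th _; ring.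
  - apply (Ct_tpow n (fun th => 2 - 2 * k I th + eps I)).
    eapply sm_ext; [|eapply OO_sm, (affine_k (2 + eps I) (-2) I HI)]. intros t th _; ring.
  - apply Hpi; auto.
Qed.

Lemma Ct_smooth1 n f : smooth1 f -> Ct Om n (fun _ th => f th).
Proof. intros H. apply (Ct_th n f). apply sm_th; auto. Qed.

Lemma Ct_P I n : (I < N)%nat -> Ct Om n (P I).
Proof.
  intros HI. destruct (Hdata I HI) as (S1 & S2 & S3 & S4).
  apply (Ct_ext n (fun t th => p0 I th * ln t + p1 I th + rho I t th)).
  - intros t th _. symmetry. apply P_eq.
  - apply Ct_plus; [apply Ct_plus|apply Ct_rho; auto].
    + apply (Ct_mult n (fun _ th => p0 I th) (fun t _ => ln t)); [apply Ct_smooth1; auto|apply Ct_ln].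
    + apply Ct_smooth1; auto.
Qed.

Definition eta (I : nat) : R -> R -> R := fun t th =>
  Rpower t (2 * k I th) * (q1 I th + kappa I t th).

Lemma Q_eq I t th : Q I t th = q0 I th + eta I t th.
Proof. unfold Qform, eta. fold (kk N p0 I th). ring. Qed.

Lemma OO_eta I : (I < N)%nat -> OO Om (3 / 4) (eta I).
Proof.
  intros HI. destruct (Hdata I HI) as (_ & _ & _ & S4).
  eapply OO_mult; [apply (OO_t2k N k HOOk (Hkb' N p0 Hkb) I HI)| |].
  - apply OO_plus; [exact (OO_smooth1 (q1 I) S4)|apply Hkap; auto].
  - lra.
Qed.

Lemma Ct_eta I n : (I < N)%nat -> Ct Om n (eta I).
Proof.
  intros HI. destruct (Hdata I HI) as (S1 & S2 & S3 & S4). apply Ct_mult.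
  - apply (Ct_tpow n (fun th => 2 * k I th)).
    eapply sm_ext; [|eapply OO_sm, (affine_k 0 2 I HI)]. intros t th _; ring.
  - apply Ct_plus; [apply Ct_smooth1; auto|apply Hkap; auto].
Qed.

Lemma Ct_Q I n : (I < N)%nat -> Ct Om n (Q I).
Proof.
  intros HI. destruct (Hdata I HI) as (S1 & S2 & S3 & S4).
  apply (Ct_ext n (fun t th => q0 I th + eta I t th)); [intros t th _; symmetry; apply Q_eq|].
  apply Ct_plus; [apply Ct_smooth1; auto|apply Ct_eta; auto].
Qed.

Lemma hasD_of_Ct f : Ct Om 1 f -> hasD Om f (Dop f).
Proof.
  intros (_ & f' & H & _) t th Ht. destruct (good_pos _ _ Ht). unfold Dop, dt.
  evar_last; [apply Derive_correct; eexists; apply H; auto|]. simpl. field. lra.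
Qed.

Lemma Ct_Dop f : (forall n, Ct Om n f) -> forall n, Ct Om n (Dop f).
Proof.
  intros H n. apply (Ct_mult n (fun t _ => t) (dt f)); [apply Ct_id|]. apply Ct_dt; auto.
Qed.

(** Commutation of D with the theta-derivative, by [isDt_dth]. It supplies the equations of x and
    y. *)
Lemma hasD_dth f h : sm Om f -> sm Om h -> hasD Om f h -> hasD Om (dth f) (dth h).
Proof.
  intros Hf Hh Hd t th Ht. pose proof sm_inv_t as Hi.
  assert (H : isDt Om f (fun t th => / t * h t th)).
  { intros s x Hx. rewrite Rmult_comm. apply Hd; auto. }
  pose proof (isDt_dth _ _ Hf (sm_mult (fun t _ => / t) h Hi Hh) H t th Ht) as H2.
  evar_last; [exact H2|]. unfold dth at 1. rewrite (Derive_scal (fun s => h t s)). unfold dth, Rdiv; ring.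
Qed.

Definition Lm (I : nat) : R -> R -> R := SS N (fun i t th => p1 i th + rho i t th) I.

Lemma SSP I t th : SS N P I t th = k I th * ln t + Lm I t th.
Proof.
  unfold Lm, SS, kk, kI. rewrite P_eq.
  rewrite (sumI_ext N (fun i => P i t th) (fun i => ln t * p0 i th + 1 * (p1 i th + rho i t th)))
    by (intros; rewrite P_eq; ring).
  rewrite sumI_lin. ring.
Qed.

Lemma OO_Lm I : (I < N)%nat -> OO Om 0 (Lm I).
Proof.
  intros HI. pose proof om_pos. apply OO_SS; auto. intros i Hi. apply OO_plus.
  - apply OO_smooth1, (smooth_p1 N p0 p1 q0 q1 Hdata); auto.
  - eapply OO_weak; [|apply OO_rho; auto]. lra.
Qed.

Lemma Ct_Lm I n : (I < N)%nat -> Ct Om n (Lm I).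
Proof.
  intros HI. apply Ct_SS; auto. intros i Hi. apply Ct_plus; [|apply Ct_rho; auto].
  apply Ct_smooth1, (smooth_p1 N p0 p1 q0 q1 Hdata); auto.
Qed.

Lemma Lm_near I a : (I < N)%nat -> OO Om om (fun t th => exp (a * Lm I t th) - exp (a * Sp1 N p1 I th)).
Proof.
  intros HI. pose proof om_pos.
  assert (X : OO Om om (SS N rho I)) by (apply OO_SS; auto; apply OO_rho).
  apply (OO_ext om (fun t th => exp (a * Sp1 N p1 I th) * (exp (a * SS N rho I t th) - 1))).
  - intros t th _. replace (a * Lm I t th) with (a * Sp1 N p1 I th + a * SS N rho I t th).
    + rewrite exp_plus. ring.
    + unfold Lm, SS, Sp1. rewrite sumI_plus. ring.
  - apply (OO_mult 0 om om (fun _ th => exp (a * Sp1 N p1 I th))); [| |lra].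
    + apply (OO_exp0 (fun _ th => a * Sp1 N p1 I th)).
      apply (OO_scal 0 a (fun _ th => Sp1 N p1 I th)), (OO_Sp1 N p0 p1 q0 q1 Hdata); auto.
    + apply (OO_exp_minus_1 om (fun t th => a * SS N rho I t th)); [lra|]. apply OO_scal; auto.
Qed.

Lemma OO_expLm I a : (I < N)%nat -> OO Om 0 (fun t th => exp (a * Lm I t th)).
Proof. intros HI. apply (OO_exp0 (fun t th => a * Lm I t th)). apply OO_scal, OO_Lm; auto. Qed.

Lemma OO_expSp I a : (I < N)%nat -> OO Om 0 (fun t th => exp (a * Sp1 N p1 I th)).
Proof.
  intros HI. apply (OO_exp0 (fun _ th => a * Sp1 N p1 I th)).
  apply (OO_scal 0 a (fun _ th => Sp1 N p1 I th)), (OO_Sp1 N p0 p1 q0 q1 Hdata); auto.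
Qed.

Lemma dth_SSP I : (I < N)%nat -> eq_on Om (dth (SS N P I)) (fun t th => Derive (k I) th * ln t + dth (Lm I) t th).
Proof.
  intros HI t th Ht.
  assert (E : eq_on Om (SS N P I) (fun t th => k I th * ln t + Lm I t th)) by (intros s x _; apply SSP).
  assert (S2 : sm Om (fun t th => k I th * ln t)).
  { apply (sm_mult (fun _ th => k I th) (fun t _ => ln t)); [eapply OO_sm, HOOk; auto|apply sm_ln]. }
  rewrite (dth_ext _ _ E t th Ht), (dth_plus _ _ S2 (OO_sm _ _ (OO_Lm I HI)) t th Ht).
  f_equal. apply Derive_scal_l.
Qed.

Lemma hasD_P I : (I < N)%nat -> hasD Om (P I) (Dop (P I)).
Proof. intros HI. apply hasD_of_Ct, Ct_P; auto. Qed.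

Lemma hasD_Lm I : (I < N)%nat -> hasD Om (Lm I) (Dop (Lm I)).
Proof. intros HI. apply hasD_of_Ct, Ct_Lm; auto. Qed.

Lemma Dop_SSP I : (I < N)%nat -> eq_on Om (Dop (SS N P I)) (fun t th => k I th + Dop (Lm I) t th).
Proof.
  intros HI. apply hasD_Dop.
  eapply hasD_on; [intros t th _; apply SSP| |apply (hasD_plus _ _ _ _
    (hasD_mult _ _ _ _ (hasD_th (k I)) hasD_ln) (hasD_Lm I HI))].
  intros t th _; simpl; ring.
Qed.

(* [ww] is the momentum e^{-2(P + P_I)} DQ; by the second equation its D-derivative
   contains theta-derivatives only, hence is controlled by regularity alone. *)
Definition vv (I : nat) : R -> R -> R := fun t th => Rpower t (- (2 * k I th)) * exp (- 2 * Lm I t th).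
Definition ww (I : nat) : R -> R -> R := fun t th => vv I t th * Dop (Q I) t th.
Definition gw (I : nat) : R -> R -> R := fun t th => t * t * dth (fun t th => vv I t th * dth (Q I) t th) t th.

Lemma OO_vv I : (I < N)%nat -> OO Om (- 27 / 16) (vv I).
Proof.
  intros HI. eapply (OO_mult (- 27 / 16)); [|apply (OO_expLm I (- 2) HI)|lra].
  apply (OO_tpow (fun th => - (2 * k I th)) _ (/ 48)); [|lra|].
  - eapply OO_ext; [|apply (affine_k 0 (-2) I HI)]. intros t th _; ring.
  - intros t th _. specialize (Hkb I th HI). lra.
Qed.

Lemma OO_dQ I : (I < N)%nat -> OO Om (3 / 4) (fun t th => dth (Q I) t th - Derive (q0 I) th).
Proof.
  intros HI. destruct (Hdata I HI) as (S1 & S2 & S3 & S4).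
  eapply OO_ext; [|apply OO_dth, OO_eta; exact HI].
  intros t th Ht.
  assert (E : eq_on Om (Q I) (fun t th => q0 I th + eta I t th)) by (intros s x _; apply Q_eq).
  rewrite (dth_ext _ _ E t th Ht), (dth_plus (fun _ th => q0 I th) (eta I) (sm_th _ S3) (OO_sm _ _ (OO_eta I HI)) t th Ht).
  change (dth (fun _ th => q0 I th) t th) with (Derive (q0 I) th). ring.
Qed.

Lemma OO_dQ0 I : (I < N)%nat -> OO Om 0 (dth (Q I)).
Proof.
  intros HI. destruct (Hdata I HI) as (S1 & S2 & S3 & S4).
  apply (OO_ext 0 (fun t th => (dth (Q I) t th - Derive (q0 I) th) + Derive (q0 I) th)); [intros t th _; ring|].
  apply OO_plus; [eapply OO_weak; [|apply OO_dQ; auto]; lra|].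
  apply (OO_smooth1 (Derive (q0 I))), smooth1_Derive; auto.
Qed.

(** The weight [vv] is O(t^(-27/16)) because 2k < 5/3 = 27/16 - 1/48. The factor t^2 leaves a
    positive rate, so the momentum has a limit at t = 0. *)
Lemma OO_gw I : (I < N)%nat -> OO Om (/ 4) (gw I).
Proof.
  intros HI. eapply OO_mult; [apply OO_tt|apply OO_dth|].
  - eapply OO_mult; [apply OO_vv; auto|apply OO_dQ0; auto|apply Rle_refl].
  - lra.
Qed.

Lemma dth_vv I : (I < N)%nat -> eq_on Om (dth (vv I))
  (fun t th => - 2 * (Derive (k I) th * ln t + dth (Lm I) t th) * vv I t th).
Proof.
  intros HI t th Ht. unfold vv.
  assert (S1 : sm Om (fun _ th => - (2 * k I th))).
  { eapply sm_ext; [|eapply OO_sm, (affine_k 0 (-2) I HI)]. intros s x _; ring. }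
  assert (S2 : sm Om (fun t th => - 2 * Lm I t th)) by (apply sm_scal; eapply OO_sm, OO_Lm; auto).
  rewrite (dth_mult _ _ (sm_tpow (fun th => - (2 * k I th)) S1) (sm_exp _ S2) t th Ht).
  rewrite (dth_tpow (fun th => - (2 * k I th)) S1 t th Ht), (dth_exp _ S2 t th Ht).
  rewrite (dth_scal (- 2) (Lm I) t th Ht).
  rewrite Derive_opp, Derive_scal. ring.
Qed.

Lemma hasD_vv I : (I < N)%nat -> hasD Om (vv I)
  (fun t th => - 2 * (k I th + Dop (Lm I) t th) * vv I t th).
Proof.
  intros HI. eapply hasD_on; [intros t th _; reflexivity| |apply (hasD_mult _ _ _ _
    (hasD_tpow (fun th => - (2 * k I th))) (hasD_exp _ _ (hasD_scal (- 2) _ _ (hasD_Lm I HI))))].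
  intros t th _. unfold vv. ring.
Qed.

Lemma sm_vv I : (I < N)%nat -> sm Om (vv I).
Proof. intros HI; eapply OO_sm, OO_vv; auto. Qed.

(** With the weight e^(-2(P + P_I)) the second equation takes divergence form: the products of
    derivatives of P + P_I with those of Q are absorbed into the derivatives of the weight. *)
Lemma hasD_ww I : (I < N)%nat -> hasD Om (ww I) (gw I).
Proof.
  intros HI.
  assert (HDQ : hasD Om (Dop (Q I)) (Dop (Dop (Q I)))).
  { apply hasD_of_Ct, Ct_Dop. intros n; apply Ct_Q; auto. }
  eapply hasD_on; [intros t th _; reflexivity| |apply (hasD_mult _ _ _ _ (hasD_vv I HI) HDQ)].
  intros t th Ht. destruct (Hsys I t th HI Ht) as [_ E2].
  rewrite (Dop_SSP I HI t th Ht), (dth_SSP I HI t th Ht) in E2.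
  unfold gw.
  rewrite (dth_mult (vv I) (dth (Q I)) (sm_vv I HI) (OO_sm _ _ (OO_dQ0 I HI)) t th Ht).
  rewrite (dth_vv I HI t th Ht).
  set (A := k I th + Dop (Lm I) t th) in *. set (B := Derive (k I) th * ln t + dth (Lm I) t th) in *.
  replace (Dop (Dop (Q I)) t th) with (t ^ 2 * dth (dth (Q I)) t th
    + 2 * (A * Dop (Q I) t th - t ^ 2 * B * dth (Q I) t th)) by lra.
  ring.
Qed.

(** The limit of the momentum that results from differentiating t^(2k) q1 formally. *)
Definition w0 (I : nat) (th : R) : R := 2 * k I th * q1 I th * exp (- 2 * Sp1 N p1 I th).

Lemma hasD_eta I : (I < N)%nat -> hasD Om (eta I) (Dop (Q I)).
Proof.
  intros HI. assert (H : hasD Om (Q I) (Dop (Q I))) by (apply hasD_of_Ct, Ct_Q; auto).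
  eapply hasD_on; [| |apply (hasD_minus _ _ _ _ H (hasD_th (q0 I)))].
  - intros t th _. rewrite Q_eq. ring.
  - intros t th _. ring.
Qed.

Lemma DQ_eq I t th : Om t th -> Dop (Q I) t th = Rpower t (2 * k I th) * (exp (2 * Lm I t th) * ww I t th).
Proof.
  intros Ht. unfold ww, vv. rewrite Rpower_Ropp.
  replace (- 2 * Lm I t th) with (- (2 * Lm I t th)) by ring. rewrite exp_Ropp. field.
  split; [apply Rgt_not_eq, exp_pos|apply Rgt_not_eq, Rpower_pos].
Qed.

(** Nothing is assumed about the t-derivative of kappa near t = 0, so the limit c of the momentum
    cannot be read off by differentiating the expansion. It is found by integrating instead: c
    determines DQ to leading order, hence the coefficient of t^(2k) in Q, and this coefficient has
    to be q1. *)
Lemma ww_J I : (I < N)%nat -> eq_on Om (fun t th => ww I t th - w0 I th) (J 0 (gw I)).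
Proof.
  intros HI t th Ht. pose proof om_pos as Hom. destruct (good_pos _ _ Ht) as [Ht0 Ht1].
  assert (Hv : forall s, 0 < s <= t -> Om s th) by (intros; eapply Om_vert; eauto).
  assert (Hgw : OO Om (/ 16) (gw I)) by (eapply OO_weak; [|apply OO_gw; auto]; lra).
  set (c := ww I t th - J 0 (gw I) t th).
  assert (Hc : forall s, 0 < s <= t -> ww I s th = c + J 0 (gw I) s th).
  { intros s Hs. unfold c.
    enough (X : ww I s th - J 0 (gw I) s th = ww I t th - J 0 (gw I) t th) by lra.
    apply (is_derive_0_const (fun s => ww I s th - J 0 (gw I) s th) t); auto.
    intros x Hx. evar_last; [apply @is_derive_minus; [apply (hasD_ww I HI); auto|apply (hasD_J0 _ Hgw); auto]|].
    unfold minus, plus, opp; simpl. ring. }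
  destruct (OO_0 _ _ (Lm_near I 2 HI)) as (C1 & HC1 & B1).
  destruct (OO_0 _ _ (J_OO 0 Rabs_0_le_1 (/ 4) _ ltac:(lra) (OO_gw I HI))) as (C2 & HC2 & B2).
  destruct (OO_0 _ _ (OO_eta I HI)) as (C3 & HC3 & B3).
  pose proof (Hkb I th HI) as Hk. set (kt := k I th) in *.
  set (e2 := exp (2 * Sp1 N p1 I th)). assert (He2 : 0 < e2) by apply exp_pos.
  (* To leading order D eta is c e2 t^(2k), and integrating against dt/t divides it by 2k. *)
  set (A := c * e2 / (2 * kt)).
  set (C := C1 * (Rabs c + C2) + e2 * C2).
  assert (HC : 0 <= C).
  { pose proof (Rabs_pos c). unfold C. apply Rplus_le_le_0_compat; apply Rmult_le_pos; lra. }
  assert (Hest : forall s, 0 < s <= t -> Rabs (eta I s th - A * Rpower s (2 * kt)) <= C / (2 * kt + om) * Rpower s (2 * kt + om)).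
  { intros s Hs.
    apply (est_decay (fun s => eta I s th - A * Rpower s (2 * kt))
      (fun s => (Dop (Q I) s th - A * (2 * kt * Rpower s (2 * kt))) / s)); [lra|lra| |].
    - intros x Hx. assert (Hx' : 0 < x <= t) by lra. pose proof (Hv x Hx') as HOx. split.
      + apply (hasD_minus _ _ _ _ (hasD_eta I HI) (hasD_scal A _ _ (hasD_tpow (fun _ => 2 * kt)))); auto.
      + unfold Rdiv. rewrite Rabs_mult, (Rabs_right (/ x)) by (left; apply Rinv_0_lt_compat; lra).
        apply Rmult_le_compat_r; [left; apply Rinv_0_lt_compat; lra|].
        rewrite DQ_eq by auto. fold kt.
        replace (Rpower x (2 * kt) * (exp (2 * Lm I x th) * ww I x th) - A * (2 * kt * Rpower x (2 * kt)))
          with (((exp (2 * Lm I x th) - e2) * ww I x th + e2 * (ww I x th - c)) * Rpower x (2 * kt))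
          by (unfold A; field; lra).
        rewrite Rabs_mult, (Rabs_right (Rpower x (2 * kt))) by (left; apply Rpower_pos).
        rewrite (Rplus_comm (2 * kt)), Rpower_plus, <- Rmult_assoc.
        apply Rmult_le_compat_r; [left; apply Rpower_pos|].
        specialize (B1 x th HOx). specialize (B2 x th HOx). cbv beta in B1. fold e2 in B1.
        assert (Hp1 : Rpower x (/ 4) <= Rpower x om) by (apply Rpower_le_exp; lra).
        assert (Hp2 : Rpower x (/ 4) <= 1) by (apply (Rpower_le_1 x th); auto; lra).
        pose proof (Rpower_pos x (/ 4)). pose proof (Rpower_pos x om).
        assert (Hw : Rabs (ww I x th) <= Rabs c + C2).
        { rewrite (Hc x Hx'). eapply Rle_trans; [apply Rabs_triang|]. nra. }
        assert (Hw2 : Rabs (ww I x th - c) <= C2 * Rpower x om).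
        { rewrite (Hc x Hx'). replace (c + J 0 (gw I) x th - c) with (J 0 (gw I) x th) by ring. nra. }
        eapply Rle_trans; [apply Rabs_triang|]. rewrite !Rabs_mult, (Rabs_right e2) by lra.
        unfold C. rewrite Rmult_plus_distr_r. apply Rplus_le_compat.
        * replace (C1 * (Rabs c + C2) * Rpower x om) with ((C1 * Rpower x om) * (Rabs c + C2)) by ring.
          apply Rmult_le_compat; auto using Rabs_pos.
        * rewrite Rmult_assoc. apply Rmult_le_compat_l; lra.
    - intros e He. destruct (small_Rpower (C3 + Rabs A) (3 / 4) e ltac:(lra) He) as (d & Hd & Hd').
      exists d; split; auto. intros x Hx Hxs. assert (Hx' : 0 < x <= t) by lra.
      eapply Rle_trans; [|apply (Hd' x Hx)].
      unfold Rminus. eapply Rle_trans; [apply Rabs_triang|]. rewrite Rabs_Ropp, Rmult_plus_distr_r.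
      apply Rplus_le_compat; [apply B3; auto|].
      rewrite Rabs_mult, (Rabs_right (Rpower x (2 * kt))) by (left; apply Rpower_pos).
      apply Rmult_le_compat_l; [apply Rabs_pos|]. apply Rpower_le_exp; lra. }
  (* Dividing the estimate by s^(2k) and letting s tend to 0 leaves q1 = A, since kappa tends to 0
     on the vertical line. *)
  assert (HA : q1 I th = A).
  { apply cond_eq. intros e He.
    destruct (small_Rpower (C / (2 * kt + om)) om (e / 3) ltac:(lra) ltac:(lra)) as (d & Hd & Hd').
    destruct (proj2 (proj2 (Hkap I HI)) t th Ht (e / 3) ltac:(lra)) as (d2 & Hd2 & Hd2').
    set (s := Rmin (d / 2) (Rmin (d2 / 2) t)).
    assert (Hs0 : 0 < s) by (repeat apply Rmin_pos; lra).
    assert (Hs1 : s <= d / 2) by apply Rmin_l.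
    assert (Hs2 : s <= Rmin (d2 / 2) t) by apply Rmin_r.
    pose proof (Rmin_l (d2 / 2) t). pose proof (Rmin_r (d2 / 2) t).
    specialize (Hd' s ltac:(lra)). specialize (Hd2' s ltac:(lra) ltac:(lra)).
    specialize (Hest s ltac:(lra)). unfold eta in Hest. fold kt in Hest.
    pose proof (Rpower_pos s (2 * kt)) as PR.
    replace (Rpower s (2 * kt) * (q1 I th + kappa I s th) - A * Rpower s (2 * kt))
      with (Rpower s (2 * kt) * (q1 I th + kappa I s th - A)) in Hest by ring.
    rewrite Rabs_mult, (Rabs_right (Rpower s (2 * kt))), Rpower_plus in Hest by lra.
    assert (Hq : Rabs (q1 I th + kappa I s th - A) <= C / (2 * kt + om) * Rpower s om).
    { apply Rmult_le_reg_l with (Rpower s (2 * kt)); auto. lra. }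
    replace (q1 I th - A) with ((q1 I th + kappa I s th - A) + - kappa I s th) by ring.
    eapply Rle_lt_trans; [apply Rabs_triang|]. rewrite Rabs_Ropp. lra. }
  assert (Hcw : c = w0 I th).
  { unfold w0. rewrite HA. fold kt. unfold A.
    replace (- 2 * Sp1 N p1 I th) with (- (2 * Sp1 N p1 I th)) by ring. rewrite exp_Ropp. fold e2. field. lra. }
  rewrite (Hc t ltac:(lra)), Hcw. ring.
Qed.

(** The exponents are written with [1 *] and [- 1 *] so that [Lm_near] applies with a = 1 and a =
    -1. By the definition of [ww], the z entry is t^(-k) e^(-(P + P_I)) DQ. *)
Definition reduced : state := mkstate (fun I t th => Dop (P I) t th - p0 I th) (fun I => dth (P I))
  (fun I t th => exp (1 * Lm I t th) * ww I t th) (fun I t th => exp (- 1 * Lm I t th) * dth (Q I) t th).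

Lemma red_near_x I : (I < N)%nat -> OO Om om (fun t th => sx reduced I t th - sx bs I t th).
Proof.
  intros HI. destruct (Hdata I HI) as (S1 & S2 & S3 & S4).
  eapply OO_ext; [|apply OO_dth, OO_rho; exact HI].
  intros t th Ht. cbn [sx reduced base].
  assert (E : eq_on Om (P I) (fun t th => (p0 I th * ln t + p1 I th) + rho I t th)) by (intros s x _; apply P_eq).
  assert (T1 : sm Om (fun t th => p0 I th * ln t)).
  { apply (sm_mult (fun _ th => p0 I th) (fun t _ => ln t)); [apply sm_th; auto|apply sm_ln]. }
  assert (T2 : sm Om (fun _ th => p1 I th)) by (apply sm_th; auto).
  rewrite (dth_ext _ _ E t th Ht).
  rewrite (dth_plus (fun t th => p0 I th * ln t + p1 I th) (rho I) (sm_plus _ _ T1 T2) (OO_sm _ _ (OO_rho I HI)) t th Ht).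
  rewrite (dth_plus (fun t th => p0 I th * ln t) (fun _ th => p1 I th) T1 T2 t th Ht).
  replace (dth (fun t th => p0 I th * ln t) t th) with (Derive (p0 I) th * ln t)
    by (symmetry; apply Derive_scal_l).
  unfold dp0. change (dth (fun _ th => p1 I th) t th) with (Derive (p1 I) th). ring.
Qed.

Lemma red_near_y I : (I < N)%nat -> OO Om om (fun t th => sy reduced I t th - sy bs I t th).
Proof.
  intros HI. pose proof om_pos. cbn [sy reduced base].
  apply (OO_ext om (fun t th => (exp (- 1 * Lm I t th) - exp (- 1 * Sp1 N p1 I th)) * dth (Q I) t th
    + exp (- 1 * Sp1 N p1 I th) * (dth (Q I) t th - Derive (q0 I) th))).
  - intros t th _. replace (- Sp1 N p1 I th) with (- 1 * Sp1 N p1 I th) by ring. ring.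
  - apply OO_plus.
    + eapply OO_mult; [apply (Lm_near I (- 1) HI)|apply OO_dQ0; auto|lra].
    + eapply OO_mult; [apply (OO_expSp I (- 1) HI)|apply OO_dQ; auto|lra].
Qed.

Lemma OO_ww I : (I < N)%nat -> OO Om (/ 4) (fun t th => ww I t th - w0 I th) /\ OO Om 0 (ww I).
Proof.
  intros HI. destruct (Hdata I HI) as (S1 & S2 & S3 & S4).
  assert (X : OO Om (/ 4) (fun t th => ww I t th - w0 I th)).
  { eapply OO_ext; [apply on_sym, ww_J; auto|]. apply (J_OO 0 Rabs_0_le_1); [lra|apply OO_gw; auto]. }
  split; auto.
  apply (OO_ext 0 (fun t th => (ww I t th - w0 I th) + w0 I th)); [intros t th _; ring|].
  apply OO_plus; [eapply OO_weak; [|exact X]; lra|].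
  apply (OO_mult0 (fun _ th => 2 * k I th * q1 I th) (fun _ th => exp (- 2 * Sp1 N p1 I th))).
  - apply (OO_mult0 (fun _ th => 2 * k I th) (fun _ th => q1 I th)); [|apply OO_smooth1; auto].
    apply (OO_scal 0 2 (fun _ th => k I th)), HOOk; auto.
  - apply (OO_expSp I (- 2) HI).
Qed.

Lemma red_near_z I : (I < N)%nat -> OO Om om (fun t th => sz reduced I t th - sz bs I t th).
Proof.
  intros HI. pose proof om_pos. cbn [sz reduced base]. destruct (OO_ww I HI) as [X Y].
  apply (OO_ext om (fun t th => (exp (1 * Lm I t th) - exp (1 * Sp1 N p1 I th)) * ww I t th
    + exp (1 * Sp1 N p1 I th) * (ww I t th - w0 I th))).
  - intros t th _. unfold w0.
    replace (exp (- 2 * Sp1 N p1 I th)) with (exp (- Sp1 N p1 I th) * exp (- Sp1 N p1 I th))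
      by (rewrite <- exp_plus; f_equal; ring).
    rewrite Rmult_1_l, !exp_Ropp, Rmult_1_l. field. apply Rgt_not_eq, exp_pos.
  - apply OO_plus.
    + eapply OO_mult; [apply (Lm_near I 1 HI)|exact Y|lra].
    + eapply OO_mult; [apply (OO_expSp I 1 HI)|exact X|lra].
Qed.

Lemma red_base f f0 mu : OO Om om (fun t th => f t th - f0 t th) -> OO Om mu f0 -> mu <= 0 -> OO Om mu f.
Proof.
  intros H1 H2 Hmu. pose proof om_pos.
  apply (OO_ext mu (fun t th => (f t th - f0 t th) + f0 t th)); [intros t th _; ring|].
  apply OO_plus; [eapply OO_weak; [|exact H1]; lra|auto].
Qed.

Lemma red_xyz I : (I < N)%nat -> OO Om (- / 16) (sx reduced I) /\ OO Om 0 (sz reduced I) /\ OO Om 0 (sy reduced I).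
Proof.
  intros HI. destruct (base_Cls N p0 p1 q0 q1 Hdata I HI) as (_ & B2 & B3 & B4).
  split; [|split].
  - eapply red_base; [apply red_near_x; auto|exact B2|lra].
  - eapply red_base; [apply red_near_z; auto|exact B3|lra].
  - eapply red_base; [apply red_near_y; auto|exact B4|lra].
Qed.

Lemma OO_src_v I : (I < N)%nat -> OO Om (3 / 16) (sv (fuchs_rhs N k reduced) I).
Proof.
  intros HI. destruct (red_xyz I HI) as (X & Z & Y). cbn [sv fuchs_rhs].
  apply OO_minus; [eapply OO_mult; [apply OO_tt|apply OO_dth; exact X|lra]|].
  apply (OO_scal _ (/ 2)). apply OO_minus.
  - eapply OO_mult; [apply (OO_t2k N k HOOk (Hkb' N p0 Hkb)); auto|apply (OO_mult0 _ _ Z Z)|lra].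
  - eapply OO_mult; [apply (OO_tb N k HOOk (Hkb' N p0 Hkb)); auto|apply (OO_mult0 _ _ Y Y)|lra].
Qed.

Lemma hasD_DP I : (I < N)%nat -> hasD Om (Dop (P I)) (sv (fuchs_rhs N k reduced) I).
Proof.
  intros HI.
  assert (H : hasD Om (Dop (P I)) (Dop (Dop (P I)))).
  { apply hasD_of_Ct, Ct_Dop. intros n; apply Ct_P; auto. }
  eapply hasD_on; [intros t th _; reflexivity| |exact H].
  intros t th Ht. destruct (good_pos _ _ Ht) as [H0 _]. destruct (Hsys I t th HI Ht) as [E1 _].
  cbn [sv fuchs_rhs sx sy sz reduced]. unfold ww, vv.
  assert (E8 : exp (- 2 * SS N P I t th) = / Rpower t (2 * k I th) * / (exp (Lm I t th) * exp (Lm I t th))).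
  { rewrite SSP, <- exp_plus. unfold Rpower. rewrite <- !exp_Ropp, <- exp_plus. f_equal. ring. }
  assert (E9 : Rpower t (2 - 2 * k I th) = t * t * / Rpower t (2 * k I th)).
  { replace (2 - 2 * k I th) with (1 + 1 + - (2 * k I th)) by ring.
    rewrite !Rpower_plus, Rpower_Ropp, Rpower_1 by auto. ring. }
  rewrite E8 in E1. rewrite E9, Rpower_Ropp.
  replace (exp (- 2 * Lm I t th)) with (/ (exp (Lm I t th) * exp (Lm I t th)))
    by (rewrite <- exp_plus, <- exp_Ropp; f_equal; ring).
  replace (exp (- 1 * Lm I t th)) with (/ exp (Lm I t th)) by (rewrite <- exp_Ropp; f_equal; ring).
  rewrite Rmult_1_l.
  pose proof (Rpower_pos t (2 * k I th)) as Pa. set (a := Rpower t (2 * k I th)) in *.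
  pose proof (exp_pos (Lm I t th)) as PL. set (L := exp (Lm I t th)) in *.
  replace (Dop (Dop (P I)) t th) with (t ^ 2 * dth (dth (P I)) t th
    + - / 2 * (/ a * / (L * L)) * ((Dop (Q I) t th) ^ 2 - (t * dth (Q I) t th) ^ 2)) by lra.
  field. lra.
Qed.

(** The expansion bounds P but not DP. On each vertical line DP equals a constant c plus an integral
    that vanishes at t = 0; integrating once more gives P = c ln t + O(1), and comparison with P =
    p0 ln t + O(1) forces c = p0. *)
Lemma DP_J I : (I < N)%nat -> eq_on Om (sv reduced I) (J 0 (sv (fuchs_rhs N k reduced) I)).
Proof.
  intros HI t th Ht. cbn [sv reduced]. pose proof om_pos as Hom. destruct (good_pos _ _ Ht) as [Ht0 Ht1].
  assert (Hv : forall s, 0 < s <= t -> Om s th) by (intros; eapply Om_vert; eauto).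
  set (G := sv (fuchs_rhs N k reduced) I).
  assert (HG : OO Om (/ 16) G) by (eapply OO_weak; [|apply OO_src_v; auto]; lra).
  assert (HJG : OO Om (/ 16) (J 0 G)) by (apply (J_OO 0 Rabs_0_le_1); auto; lra).
  set (c := Dop (P I) t th - J 0 G t th).
  assert (Hc : forall s, 0 < s <= t -> Dop (P I) s th = c + J 0 G s th).
  { intros s Hs. unfold c.
    enough (X : Dop (P I) s th - J 0 G s th = Dop (P I) t th - J 0 G t th) by lra.
    apply (is_derive_0_const (fun s => Dop (P I) s th - J 0 G s th) t); auto.
    intros x Hx. evar_last; [apply @is_derive_minus; [apply (hasD_DP I HI); auto|apply (hasD_J0 _ HG); auto]|].
    change (G x th / x + - (G x th / x) = 0). ring. }
  set (c2 := P I t th - J 0 (J 0 G) t th - c * ln t).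
  assert (Hc2 : forall s, 0 < s <= t -> P I s th - J 0 (J 0 G) s th - c * ln s = c2).
  { intros s Hs. unfold c2.
    apply (is_derive_0_const (fun s => P I s th - J 0 (J 0 G) s th - c * ln s) t); auto.
    intros x Hx.
    evar_last; [apply (hasD_minus _ _ _ _ (hasD_minus _ _ _ _ (hasD_P I HI) (hasD_J0 _ HJG)) (hasD_scal c _ _ hasD_ln)); auto|].
    cbv beta. rewrite (Hc x Hx). unfold Rdiv; ring. }
  destruct (OO_0 _ _ (OO_rho I HI)) as (C1 & HC1 & B1).
  destruct (OO_0 _ _ (J_OO 0 Rabs_0_le_1 (/ 16) _ ltac:(lra) HJG)) as (C2 & HC2 & B2).
  set (B := Rabs c2 + C2 + Rabs (p1 I th) + C1).
  assert (HB : forall s, 0 < s <= t -> Rabs ((p0 I th - c) * ln s) <= B).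
  { intros s Hs. specialize (Hc2 s Hs). rewrite P_eq in Hc2.
    replace ((p0 I th - c) * ln s) with (c2 + J 0 (J 0 G) s th - p1 I th - rho I s th) by lra.
    pose proof (Hv s Hs) as HOs. specialize (B1 s th HOs). specialize (B2 s th HOs).
    pose proof (Rpower_le_1 s th om ltac:(lra) HOs). pose proof (Rpower_le_1 s th (/ 16) ltac:(lra) HOs).
    pose proof (Rpower_pos s om). pose proof (Rpower_pos s (/ 16)).
    unfold Rminus. eapply Rle_trans; [apply Rabs_triang|]. rewrite Rabs_Ropp.
    eapply Rle_trans; [apply Rplus_le_compat_r, Rabs_triang|]. rewrite Rabs_Ropp.
    eapply Rle_trans; [apply Rplus_le_compat_r, Rplus_le_compat_r, Rabs_triang|].
    unfold B. nra. }
  assert (Hp : p0 I th = c).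
  { destruct (Req_dec (p0 I th) c) as [|Hne]; auto. exfalso.
    assert (Hd : 0 < Rabs (p0 I th - c)) by (apply Rabs_pos_lt; lra).
    assert (HBp : 0 <= B) by (eapply Rle_trans; [apply Rabs_pos|apply (HB t); lra]).
    (* Chosen so small that |ln s| >= (B + 1) / |p0 - c|, which contradicts [HB]. *)
    set (s := Rmin t (exp (- ((B + 1) / Rabs (p0 I th - c))))).
    assert (Hs : 0 < s) by (apply Rmin_pos; [lra|apply exp_pos]).
    assert (Hs1 : s <= t) by apply Rmin_l.
    assert (Hs2 : s <= exp (- ((B + 1) / Rabs (p0 I th - c)))) by apply Rmin_r.
    assert (Hl : ln s <= - ((B + 1) / Rabs (p0 I th - c))).
    { rewrite <- (ln_exp (- ((B + 1) / Rabs (p0 I th - c)))).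
      destruct (Req_dec s (exp (- ((B + 1) / Rabs (p0 I th - c))))) as [->|]; [lra|].
      left. apply ln_increasing; lra. }
    assert (0 < (B + 1) / Rabs (p0 I th - c)) by (apply Rdiv_lt_0_compat; lra).
    specialize (HB s ltac:(lra)). rewrite Rabs_mult, (Rabs_left (ln s)) in HB by lra.
    assert (Rabs (p0 I th - c) * ((B + 1) / Rabs (p0 I th - c)) = B + 1) by (field; lra).
    nra. }
  rewrite (Hc t ltac:(lra)), Hp. ring.
Qed.

Lemma reduced_admissible : admissible Om N reduced.
Proof.
  intros I HI. destruct (red_xyz I HI) as (X & Z & Y). split4; auto.
  eapply OO_ext; [apply on_sym, DP_J; auto|]. eapply OO_weak; [|apply (J_OO 0 Rabs_0_le_1); [|apply OO_src_v; auto]]; lra.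
Qed.

Lemma dL_eq I : (I < N)%nat -> eq_on Om (Dop (Lm I)) (SS N (sv reduced) I).
Proof.
  intros HI t th Ht.
  enough (k I th + Dop (Lm I) t th = k I th + SS N (sv reduced) I t th) by lra.
  rewrite <- (Dop_SSP I HI t th Ht), (hasD_Dop _ _ (hasD_SS N P (fun i => Dop (P i)) I HI hasD_P) t th Ht).
  unfold SS, kk, kI. cbn [sv reduced].
  rewrite (sumI_ext N (fun i => Dop (P i) t th) (fun i => p0 i th + (Dop (P i) t th - p0 i th))) by (intros; ring).
  rewrite sumI_plus. ring.
Qed.

Lemma dthLm_eq I : (I < N)%nat -> eq_on Om (dth (Lm I)) (fun t th => SS N (sx reduced) I t th - Derive (k I) th * ln t).
Proof.
  intros HI t th Ht.
  enough (Derive (k I) th * ln t + dth (Lm I) t th = SS N (sx reduced) I t th) by lra.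
  rewrite <- (dth_SSP I HI t th Ht).
  apply (dth_SS (Om := Om)); auto. intros i Hi. apply (Ct_sm 0), Ct_P; auto.
Qed.

Lemma DQ_z I t th : Om t th -> Dop (Q I) t th = Rpower t (2 * k I th) * (exp (Lm I t th) * sz reduced I t th).
Proof.
  intros Ht. rewrite DQ_eq by auto. cbn [sz reduced]. rewrite Rmult_1_l, <- (Rmult_assoc (exp _)), <- exp_plus.
  do 3 f_equal. ring.
Qed.

Lemma dQ_y I t th : dth (Q I) t th = exp (Lm I t th) * sy reduced I t th.
Proof.
  cbn [sy reduced]. rewrite <- Rmult_assoc, <- exp_plus.
  replace (Lm I t th + - 1 * Lm I t th) with 0 by ring. rewrite exp_0. ring.
Qed.

(** The v row is the first equation of the system and the z row its second one in momentum form. The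
    x and y rows express that D commutes with the theta-derivative of P and of Q. *)
Lemma red_D I : (I < N)%nat -> hasD Om (sv reduced I) (sv (fuchs_rhs N k reduced) I) /\
    hasD Om (sx reduced I) (fun t th => dp0 p0 I th + sx (fuchs_rhs N k reduced) I t th) /\
    hasD Om (sz reduced I) (sz (fuchs_rhs N k reduced) I) /\ hasD Om (sy reduced I) (sy (fuchs_rhs N k reduced) I).
Proof.
  intros HI. destruct (Hdata I HI) as (S1 & S2 & S3 & S4).
  destruct (reduced_admissible I HI) as (C1 & C2 & C3 & C4).
  assert (SL : sm Om (Lm I)) by (eapply OO_sm, OO_Lm; auto).
  assert (CP : forall n, Ct Om n (P I)) by (intros; apply Ct_P; auto).
  assert (CQ : forall n, Ct Om n (Q I)) by (intros; apply Ct_Q; auto).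
  assert (Sk2 : forall a, sm Om (fun _ th => a * k I th)).
  { intros a. apply (sm_scal a (fun _ th => k I th)). eapply OO_sm, HOOk; auto. }
  split4.
  - eapply hasD_on; [intros t th _; reflexivity| |apply (hasD_minus _ _ _ _ (hasD_DP I HI) (hasD_th (p0 I)))].
    intros t th _; ring.
  - eapply hasD_on; [intros t th _; reflexivity| |apply (hasD_dth (P I) (Dop (P I)))].
    + intros t th Ht. cbn [sx fuchs_rhs sv reduced].
      rewrite (dth_minus (Dop (P I)) (fun _ th => p0 I th) (Ct_sm 0 _ (Ct_Dop _ CP 0)) (sm_th _ S1) t th Ht).
      unfold dp0. change (dth (fun _ th => p0 I th) t th) with (Derive (p0 I) th). ring.
    + apply (CP 0%nat).
    + apply (Ct_Dop _ CP 0).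
    + apply hasD_P; auto.
  - eapply hasD_on; [intros t th _; reflexivity| |apply (hasD_mult _ _ _ _
      (hasD_exp _ _ (hasD_scal 1 _ _ (hasD_Lm I HI))) (hasD_ww I HI))].
    intros t th Ht. destruct (good_pos _ _ Ht) as [H0 _]. cbv beta. rewrite (dL_eq I HI t th Ht).
    unfold gw.
    assert (E : eq_on Om (fun t th => vv I t th * dth (Q I) t th)
      (fun t th => Rpower t (- 2 * k I th) * (exp (- 1 * Lm I t th) * sy reduced I t th))).
    { intros s x _. rewrite dQ_y. unfold vv. replace (- (2 * k I x)) with (- 2 * k I x) by ring.
      replace (exp (- 2 * Lm I s x)) with (exp (- 1 * Lm I s x) * exp (- 1 * Lm I s x))
        by (rewrite <- exp_plus; f_equal; ring).
      replace (exp (Lm I s x)) with (/ exp (- 1 * Lm I s x)) by (rewrite <- exp_Ropp; f_equal; ring).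
      field. apply Rgt_not_eq, exp_pos. }
    assert (SE : sm Om (fun t th => exp (- 1 * Lm I t th))) by (apply (sm_exp (fun t th => - 1 * Lm I t th)), sm_scal; auto).
    rewrite (dth_ext _ _ E t th Ht).
    rewrite (dth_mult (fun t th => Rpower t (- 2 * k I th)) _ (sm_tpow (fun th => - 2 * k I th) (Sk2 (- 2))) (sm_mult _ _ SE (OO_sm _ _ C4)) t th Ht).
    rewrite (dth_tpow (fun th => - 2 * k I th) (Sk2 (- 2)) t th Ht).
    rewrite (dth_mult _ (sy reduced I) SE (OO_sm _ _ C4) t th Ht).
    rewrite (dth_exp (fun t th => - 1 * Lm I t th) (sm_scal (- 1) _ SL) t th Ht).
    rewrite (dth_scal (- 1) (Lm I) t th Ht), (dthLm_eq I HI t th Ht), Derive_scal.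
    change (sz (fuchs_rhs N k reduced) I t th) with (Rpower t (2 - 2 * k I th) * (dth (sy reduced I) t th - Derive (k I) th * ln t * sy reduced I t th)
     + SS N (sv reduced) I t th * sz reduced I t th - Rpower t (2 - 2 * k I th) * (SS N (sx reduced) I t th * sy reduced I t th)).
    replace (Rpower t (2 - 2 * k I th)) with (t * t * Rpower t (- 2 * k I th)).
    2: { replace (2 - 2 * k I th) with (1 + 1 + - 2 * k I th) by ring. rewrite !Rpower_plus, Rpower_1 by auto. ring. }
    change (sz reduced I t th) with (exp (1 * Lm I t th) * ww I t th).
    replace (exp (- 1 * Lm I t th)) with (/ exp (1 * Lm I t th)) by (rewrite <- exp_Ropp; f_equal; ring).
    set (DY := dth (sy reduced I) t th). set (Y := sy reduced I t th).
    pose proof (exp_pos (1 * Lm I t th)). field. lra.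
  - eapply hasD_on; [intros t th _; reflexivity| |apply (hasD_mult _ _ _ _
      (hasD_exp _ _ (hasD_scal (- 1) _ _ (hasD_Lm I HI))) (hasD_dth (Q I) (Dop (Q I)) (CQ 0%nat) (Ct_Dop _ CQ 0) (hasD_of_Ct _ (CQ 1%nat))))].
    intros t th Ht. cbv beta. rewrite (dL_eq I HI t th Ht).
    assert (E : eq_on Om (Dop (Q I)) (fun t th => Rpower t (2 * k I th) * (exp (Lm I t th) * sz reduced I t th)))
      by (intros s x Hx; apply DQ_z; auto).
    rewrite (dth_ext _ _ E t th Ht).
    rewrite (dth_mult (fun t th => Rpower t (2 * k I th)) _ (sm_tpow (fun th => 2 * k I th) (Sk2 2)) (sm_mult _ _ (sm_exp _ SL) (OO_sm _ _ C3)) t th Ht).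
    rewrite (dth_tpow (fun th => 2 * k I th) (Sk2 2) t th Ht).
    rewrite (dth_mult _ (sz reduced I) (sm_exp _ SL) (OO_sm _ _ C3) t th Ht).
    rewrite (dth_exp (Lm I) SL t th Ht), (dthLm_eq I HI t th Ht), Derive_scal.
    change (sy (fuchs_rhs N k reduced) I t th) with (Rpower t (2 * k I th) * (dth (sz reduced I) t th + Derive (k I) th * ln t * sz reduced I t th)
     - SS N (sv reduced) I t th * sy reduced I t th + Rpower t (2 * k I th) * (SS N (sx reduced) I t th * sz reduced I t th)).
    change (sy reduced I t th) with (exp (- 1 * Lm I t th) * dth (Q I) t th).
    replace (exp (- 1 * Lm I t th)) with (/ exp (Lm I t th)) by (rewrite <- exp_Ropp; f_equal; ring).
    set (DZ := dth (sz reduced I) t th). set (Z := sz reduced I t th).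
    pose proof (exp_pos (Lm I t th)). field. lra.
Qed.

Lemma red_FP : fixed_point Om N k bs reduced.
Proof.
  pose proof om_pos as Hom.
  apply (FP_intro N k (dp0 p0)) with (om := om).
  - reflexivity.
  - intros I HI. apply (base_D N p0 p1 q0 q1); auto.
  - lra.
  - apply (src_In16 N k HOOk (Hkb' N p0 Hkb)), reduced_admissible.
  - intros I HI. split4; [|apply red_near_x; auto|apply red_near_z; auto|apply red_near_y; auto].
    apply (OO_ext om (J 0 (sv (fuchs_rhs N k reduced) I))).
    + intros t th Ht. rewrite <- (DP_J I HI t th Ht). cbn [sv reduced base]. ring.
    + eapply OO_weak; [|apply (J_OO 0 Rabs_0_le_1); [|apply OO_src_v; auto]]; lra.
  - exact red_D.
Qed.

Lemma rho_J I : (I < N)%nat -> eq_on Om (rho I) (J 0 (sv reduced I)).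
Proof.
  intros HI. pose proof om_pos. apply J0_unique.
  - eapply OO_weak; [|apply reduced_admissible; auto]. lra.
  - eapply hasD_on; [| |apply (hasD_minus _ _ _ _ (hasD_P I HI) (hasD_plus _ _ _ _
      (hasD_mult _ _ _ _ (hasD_th (p0 I)) hasD_ln) (hasD_th (p1 I))))].
    + intros t th _. rewrite P_eq. ring.
    + intros t th _. cbn [sv reduced]. ring.
  - apply (tends0_OO om); [lra|apply OO_rho; auto].
Qed.

Theorem reduction : exists u, admissible Om N u /\ fixed_point Om N k bs u /\ forall I, (I < N)%nat ->
  eq_on Om (P I) (PP p0 p1 u I) /\ eq_on Om (Q I) (QQ N p0 p1 q0 u I).
Proof.
  exists reduced. split; [apply reduced_admissible|split; [apply red_FP|]]. intros I HI. split.
  - intros t th Ht. rewrite P_eq. unfold PP. rewrite (rho_J I HI t th Ht). ring.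
  - intros t th Ht. rewrite Q_eq. unfold QQ. f_equal.
    assert (HL : eq_on Om (Lam N p1 reduced I) (Lm I)).
    { intros s x Hx. unfold Lam, Lm, SS. f_equal.
      - apply sumI_ext. intros i Hi. rewrite (rho_J i Hi s x Hx). auto.
      - rewrite (rho_J I HI s x Hx). auto. }
    apply (J0_unique (eta I) (hh N p0 p1 reduced I)); auto.
    + eapply OO_weak; [|apply (OO_hh N p0 p1 q0 q1 Hdata Hkb reduced reduced_admissible); auto]. lra.
    + eapply hasD_on; [intros s x _; reflexivity| |apply hasD_eta; auto].
      intros s x Hx. unfold hh. rewrite (HL s x Hx), DQ_z by auto. auto.
    + apply (tends0_OO (3 / 4)); [lra|apply OO_eta; auto].
Qed.

End Reduction.

Lemma FP_sub {Om0 Om : R -> R -> Prop} N k u0 u : (forall t th, Om t th -> Om0 t th) ->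
  fixed_point Om0 N k u0 u -> fixed_point Om N k u0 u.
Proof.
  intros Hs H I HI. destruct (H I HI) as (H1 & H2 & H3 & H4).
  split4; intros t th Ht; auto.
Qed.

(** * Existence and uniqueness *)

Section Final.
Context (N : nat) (p0 p1 q0 q1 : nat -> R -> R) (eps : nat -> R) (HN : (0 < N)%nat).
Context (Hdata : forall I, (I < N)%nat ->
  smooth1 (p0 I) /\ smooth1 (p1 I) /\ smooth1 (q0 I) /\ smooth1 (q1 I)).
Context (Hkb : forall I th, (I < N)%nat -> / 2 < kk N p0 I th < 5 / 6).
Context (Heps : forall I J th, (I < N)%nat -> (J < N)%nat ->
  2 * (kk N p0 I th + kk N p0 J th) - 3 < eps J /\
  eps J < Rmin (2 * kk N p0 I th - 1) (2 - 2 * kk N p0 I th)).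

Lemma expansion_reduces c T a b pi kappa : a < c < b ->
  expansion_solution N p0 p1 q0 q1 eps T a b pi kappa ->
  exists r u, 0 < r <= 1 /\ admissible (triangle c r) N u /\
    fixed_point (triangle c r) N (kk N p0) (base N p0 p1 q0 q1) u /\
    forall I, (I < N)%nat -> eq_on (triangle c r) (Pform N p0 p1 q0 eps pi I) (PP p0 p1 u I) /\
      eq_on (triangle c r) (Qform N p0 q0 q1 kappa I) (QQ N p0 p1 q0 u I).
Proof.
  intros Hc (HT & _ & Hreg & Hsol).
  (* The index j has the smallest exponent G = 2 - 2k + eps at [c], positive because eps > 4k - 3
     and k > 1/2. Where the k_J vary by less than G/8 all these exponents stay above G/2. *)
  destruct (argmax N (fun J => - (2 - 2 * kk N p0 J c + eps J)) HN) as (j & Hj & Mj).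
  set (G := 2 - 2 * kk N p0 j c + eps j).
  assert (HG : 0 < G).
  { unfold G. destruct (Heps j j c Hj Hj) as [H _]. pose proof (Hkb j c Hj). lra. }
  destruct (k_near N p0 p1 q0 q1 c Hdata (G / 8)) as (rk & Hrk & Hk); [lra|].
  set (r := Rmin (Rmin 1 (T / 2)) (Rmin rk (Rmin ((c - a) / 2) ((b - c) / 2)))).
  assert (Hr : 0 < r) by (repeat apply Rmin_pos; lra).
  assert (R1 : r <= Rmin 1 (T / 2)) by apply Rmin_l.
  assert (R2 : r <= Rmin rk (Rmin ((c - a) / 2) ((b - c) / 2))) by apply Rmin_r.
  pose proof (Rmin_l 1 (T / 2)). pose proof (Rmin_r 1 (T / 2)).
  pose proof (Rmin_l rk (Rmin ((c - a) / 2) ((b - c) / 2))).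
  pose proof (Rmin_r rk (Rmin ((c - a) / 2) ((b - c) / 2))).
  pose proof (Rmin_l ((c - a) / 2) ((b - c) / 2)). pose proof (Rmin_r ((c - a) / 2) ((b - c) / 2)).
  pose proof (tri_good c r ltac:(lra)) as HOm.
  assert (Hsub : forall t th, triangle c r t th -> 0 < t < T /\ a < th < b /\ Rabs (th - c) < rk).
  { intros t th [X1 X2]. pose proof (Rabs_pos (th - c)).
    assert (X3 : Rabs (th - c) < r) by lra. pose proof X3 as X4. apply Rabs_lt_between in X3. lra. }
  exists r.
  enough (exists u, admissible (triangle c r) N u /\ fixed_point (triangle c r) N (kk N p0) (base N p0 p1 q0 q1) u /\
    forall I, (I < N)%nat -> eq_on (triangle c r) (Pform N p0 p1 q0 eps pi I) (PP p0 p1 u I) /\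
      eq_on (triangle c r) (Qform N p0 q0 q1 kappa I) (QQ N p0 p1 q0 u I)) as [u Hu].
  { exists u. split; [lra|exact Hu]. }
  apply (reduction N p0 p1 q0 q1 eps Hdata Hkb pi kappa (G / 2)).
  - lra.
  - intros I HI. destruct (Hreg I HI) as (X & _ & _). apply (regular_OO T a b); auto; lra.
  - intros I HI. destruct (Hreg I HI) as (_ & X & Y).
    destruct (regular_OO T a b c r (kappa I)) as [Z1 Z2]; auto; try lra.
    split; [auto|split; [auto|]]. intros t th Ht e He.
    destruct (Hsub t th Ht) as (S1 & S2 & _). destruct (Y th S2) as [_ Y2].
    destruct (proj1 (filterlim_locally _ _) Y2 (mkposreal e He)) as [d Hd].
    exists d. split; [apply cond_pos|]. intros s Hs _.
    assert (HB : ball 0 d s).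
    { change (Rabs (s - 0) < d). rewrite Rminus_0_r, Rabs_right; lra. }
    specialize (Hd s HB (proj1 Hs)). change (Rabs (kappa I s th - 0) < e) in Hd.
    rewrite Rminus_0_r in Hd. lra.
  - intros I t th HI Ht. destruct (Hsub t th Ht) as (_ & _ & S3).
    specialize (Hk I th HI S3). apply Rabs_lt_between in Hk.
    specialize (Mj I HI). cbv beta in Mj. unfold G in *. lra.
  - intros I t th HI Ht. destruct (Hsub t th Ht) as (S1 & S2 & _). exact (Hsol I t th HI S1 S2).
Qed.

(** Both solutions are recovered from their reduced states by integrals along vertical lines inside
    a triangle, so equality of the reduced states there is enough. *)
Lemma expansion_unique c T a b pi kappa T' a' b' pi' kappa' : a < c < b -> a' < c < b' ->
  expansion_solution N p0 p1 q0 q1 eps T a b pi kappa ->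
  expansion_solution N p0 p1 q0 q1 eps T' a' b' pi' kappa' ->
  exists eta, 0 < eta /\ forall I t th, (I < N)%nat -> 0 < t < eta -> Rabs (th - c) < eta ->
    Pform N p0 p1 q0 eps pi' I t th = Pform N p0 p1 q0 eps pi I t th /\
    Qform N p0 q0 q1 kappa' I t th = Qform N p0 q0 q1 kappa I t th.
Proof.
  intros H1 H2 S1 S2.
  destruct (expansion_reduces c T a b pi kappa H1 S1) as (r1 & u & Hr1 & Cu & Fu & Eu).
  destruct (expansion_reduces c T' a' b' pi' kappa' H2 S2) as (r2 & w & Hr2 & Cw & Fw & Ew).
  assert (Hm1 : Rmin r1 r2 <= r1) by apply Rmin_l. assert (Hm2 : Rmin r1 r2 <= r2) by apply Rmin_r.
  assert (Hm : 0 < Rmin r1 r2 <= 1) by (split; [apply Rmin_pos|]; lra).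
  assert (Q1 : forall t th, triangle c (Rmin r1 r2) t th -> triangle c r1 t th) by (intros; eapply tri_sub; eauto).
  assert (Q2 : forall t th, triangle c (Rmin r1 r2) t th -> triangle c r2 t th) by (intros; eapply tri_sub; eauto).
  destruct (reduced_unique N p0 p1 q0 q1 Hdata Hkb c (Rmin r1 r2) u w Hm (Cls_sub Q1 N u Cu)
    (FP_sub _ _ _ _ Q1 Fu) (Cls_sub Q2 N w Cw) (FP_sub _ _ _ _ Q2 Fw)) as (r & Hr & Huw).
  pose proof (tri_good c r ltac:(lra)) as HOm.
  exists (r / 2). split; [lra|]. intros I t th HI Ht Hth.
  assert (HO : triangle c r t th) by (split; lra).
  assert (HO1 : triangle c r1 t th) by (eapply tri_sub; [|exact HO]; lra).
  assert (HO2 : triangle c r2 t th) by (eapply tri_sub; [|exact HO]; lra).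
  destruct (Eu I HI) as [U1 U2]. destruct (Ew I HI) as [W1 W2].
  rewrite (U1 t th HO1), (U2 t th HO1), (W1 t th HO2), (W2 t th HO2).
  assert (EJ : forall i, (i < N)%nat -> eq_on (triangle c r) (J 0 (sv w i)) (J 0 (sv u i))).
  { intros i Hi. apply (J_ext 0 Rabs_0_le_1). apply on_sym, Huw; auto. }
  assert (EL : eq_on (triangle c r) (Lam N p1 w I) (Lam N p1 u I)).
  { intros s x Hx. unfold Lam, SS. f_equal.
    - apply sumI_ext. intros i Hi. rewrite (EJ i Hi s x Hx). auto.
    - rewrite (EJ I HI s x Hx). auto. }
  split.
  - unfold PP. rewrite (EJ I HI t th HO). auto.
  - unfold QQ. f_equal. apply (J_ext 0 Rabs_0_le_1 (hh N p0 p1 w I) (hh N p0 p1 u I)); auto.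
    intros s x Hx. unfold hh. rewrite (EL s x Hx).
    destruct (Huw I HI) as (_ & _ & Z & _). rewrite (Z s x Hx). auto.
Qed.

End Final.

Theorem theorem5 :
  forall (D : nat) (p0 p1 q0 q1 : nat -> R -> R) (eps : nat -> R),
    (4 <= D)%nat ->
    (forall I, (I < D - 3)%nat ->
       smooth1 (p0 I) /\ smooth1 (p1 I) /\ smooth1 (q0 I) /\ smooth1 (q1 I)) ->
    (forall I th, (I < D - 3)%nat ->
       / 2 < kI (D - 3) p0 I th < 5 / 6) ->
    (forall I J th, (I < D - 3)%nat -> (J < D - 3)%nat ->
       2 * (kI (D - 3) p0 I th + kI (D - 3) p0 J th) - 3 < eps J /\
       eps J < Rmin (2 * kI (D - 3) p0 I th - 1) (2 - 2 * kI (D - 3) p0 I th)) ->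
    forall theta0 : R,
      exists (T a b : R) (pi kappa : nat -> R -> R -> R),
        a < theta0 < b /\
        expansion_solution (D - 3) p0 p1 q0 q1 eps T a b pi kappa /\
        (forall (T' a' b' : R) (pi' kappa' : nat -> R -> R -> R),
           a' < theta0 < b' ->
           expansion_solution (D - 3) p0 p1 q0 q1 eps T' a' b' pi' kappa' ->
           exists eta : R, 0 < eta /\
             forall I t th, (I < D - 3)%nat -> 0 < t < eta ->
               Rabs (th - theta0) < eta ->
               Pform (D - 3) p0 p1 q0 eps pi' I t th
                 = Pform (D - 3) p0 p1 q0 eps pi I t th /\
               Qform (D - 3) p0 q0 q1 kappa' I t th
                 = Qform (D - 3) p0 q0 q1 kappa I t th).
Proof.
  intros D p0 p1 q0 q1 eps HD Hdata Hkb Heps theta0.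
  assert (HN : (0 < D - 3)%nat) by lia.
  destruct (expansion_exists (D - 3) p0 p1 q0 q1 eps theta0 HN Hdata Hkb Heps)
    as (T & a & b & pi & kappa & Hab & Hsol).
  exists T, a, b, pi, kappa. split; [exact Hab|split; [exact Hsol|]].
  intros T' a' b' pi' kappa' Hab' Hsol'.
  exact (expansion_unique (D - 3) p0 p1 q0 q1 eps HN Hdata Hkb Heps theta0
    T a b pi kappa T' a' b' pi' kappa' Hab Hab' Hsol Hsol').
Qed.
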